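(* For every $n$-vertex graph $G$ and every positive integer $k$ with $n^{\frac{6}{k+6}}>(k+6)!$, one can compute, in time $O(n^{18})$, a graph $G'$ such that $G'$ contains a subgraph isomorphic to $K_{k',k'}$ if and only if $G$ contains a subgraph isomorphic to $K_k$, where $k'$ depends only on $k$ and $k'=\Theta(k!)$.
   Context: $K_k$ denotes the complete graph (clique) on $k$ vertices, and $K_{a,b}$ the complete bipartite graph with $a$ vertices on one side and $b$ on the other. *)

(* Defs.v *)
From mathcomp Require Import all_boot.

Set Implicit Arguments.
Unset Strict Implicit.
Unset Printing Implicit Defensive.

Record sgraph (T : finType) := SGraph {
  edge :> rel T;
  edge_sym : symmetric edge;
  edge_irr : irreflexive edge
}.

Definition clique_rel (k : nat) : rel 'I_k := fun x y => x != y.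

Lemma clique_sym k : symmetric (@clique_rel k).
Proof. by move=> x y; rewrite /clique_rel eq_sym. Qed.

Lemma clique_irr k : irreflexive (@clique_rel k).
Proof. by move=> x; rewrite /clique_rel eqxx. Qed.

Definition clique (k : nat) : sgraph 'I_k :=
  SGraph (@clique_sym k) (@clique_irr k).

Definition biclique_rel (a b : nat) : rel ('I_a + 'I_b)%type :=
  fun x y => match x, y with
             | inl _, inr _ | inr _, inl _ => true
             | _, _ => false
             end.

Lemma biclique_sym a b : symmetric (@biclique_rel a b).
Proof. by case=> [x|x] [y|y]. Qed.

Lemma biclique_irr a b : irreflexive (@biclique_rel a b).
Proof. by case. Qed.

Definition biclique (a b : nat) : sgraph ('I_a + 'I_b)%type :=
  SGraph (@biclique_sym a b) (@biclique_irr a b).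

Definition isomorphic (S T : finType) (H : sgraph S) (G : sgraph T) : Prop :=
  exists2 f : S -> T, bijective f & forall x y, G (f x) (f y) = H x y.

(* Subgraphs need not be induced: S keeps only some of the edges inside V. *)
Definition subgraph (T : finType) (V : {set T})
    (S : sgraph {x : T | x \in V}) (G : sgraph T) : Prop :=
  forall x y, S x y -> G (val x) (val y).

Definition has_subgraph_isomorphic_to (S T : finType)
    (G : sgraph T) (H : sgraph S) : Prop :=
  exists (V : {set T}) (K : sgraph {x : T | x \in V}),
    subgraph K G /\ isomorphic H K.

(* Unit-cost word RAM.  Memory cells and their addresses are w-bit words; all
   written values are reduced modulo 2 ^ w.  Since w will be proportional to
   log n, charging one time unit per instruction (multiplication and division
   included) is the usual cost measure. *)

Inductive binop := OpAdd | OpSub | OpMul | OpDiv | OpMod.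

(* Subtraction is truncated at 0, so that it also serves as a comparison;
   x / 0 = 0 and x mod 0 = x. *)
Definition eval_binop (o : binop) : nat -> nat -> nat :=
  match o with
  | OpAdd => addn
  | OpSub => subn
  | OpMul => muln
  | OpDiv => divn
  | OpMod => modn
  end.

Inductive instr :=
  | Const (d v : nat)
  | Arith (o : binop) (d a b : nat)
  | ReadAt (d a : nat)
  | WriteAt (a s : nat)
  | JumpZ (a l : nat).

Definition program := seq instr.
Definition memory := nat -> nat.

Record config := Config { pc : nat; mem : memory }.

Definition exec (w : nat) (i : instr) (s : config) : config :=
  let M := mem s in
  let write d v := Config (pc s).+1 [eta M with d |-> v %% 2 ^ w] in
  match i with
  | Const d v => write d v
  | Arith o d a b => write d (eval_binop o (M a) (M b))
  | ReadAt d a => write d (M (M a))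
  | WriteAt a x => write (M a) (M x)
  | JumpZ a l => Config (if M a == 0 then l else (pc s).+1) M
  end.

(* The machine halts when the program counter leaves the program. *)
Definition step (w : nat) (P : program) (s : config) : config :=
  if onth P (pc s) is Some i then exec w i s else s.

Definition halted (P : program) (s : config) : bool := size P <= pc s.

(* The adjacency matrix, row by row. *)
Definition adj_seq (n : nat) (G : sgraph 'I_n) : seq nat :=
  [seq nat_of_bool (G i j) | i <- enum 'I_n, j <- enum 'I_n].

(* Input: n in cell 0, k in cell 1, the matrix of G from cell 2 on, and 0 in
   all the other cells. *)
Definition input_memory (n : nat) (G : sgraph 'I_n) (k : nat) : memory :=
  nth 0 [:: n, k & adj_seq G].

(* Output: the number of vertices in cell 0, and in cell 1 the address from
   which the adjacency matrix is stored. *)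
Definition output_memory (w : nat) (M : memory)
    (m : nat) (H : sgraph 'I_m) : Prop :=
  [/\ M 0 = m,
      M 1 + m * m <= 2 ^ w &
      mkseq (fun a => M (M 1 + a)) (m * m) = adj_seq H].

(* c times the length of n in binary. *)
Definition word_size (c n : nat) : nat := c * (trunc_log 2 n).+1.

Definition computes_within (P : program) (c : nat) (n : nat) (G : sgraph 'I_n)
    (k : nat) (m : nat) (H : sgraph 'I_m) (t : nat) : Prop :=
  let w := word_size c n in
  exists2 t' : nat, t' <= t &
    let s := iter t' (step w P) (Config 0 (input_memory G k)) in
    halted P s /\ output_memory w (mem s) H.

(* Main.v *)
(* Let q be a power of 2 with q > k! + k and q ^ k >= n, let F be the field with
   q ^ k elements, embed the vertices of G into F, and let N be the norm from F
   to its subfield of q elements.  In the projective norm graph,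
   (a, alpha) and (b, beta) in F * F_q^* are adjacent when N (a + b) = alpha beta.

   - Any k + 1 vertices have at most k! common neighbours.  After the
     substitution x = 1 / (a_0 + b) the common neighbours solve a system
     prod_j (x_j - a_ij) = b_i, i < k, with x_j = x ^ (q ^ j).  Modulo this
     system every polynomial reduces to the span of the k! monomials with
     exponent of x_j at most j, and distinct solutions are separated by the
     powers of x_0.
   - For any k vertices a_i some choice of the alpha_i yields more than k!
     common neighbours: each (b, beta) determines the alpha_i, so average over
     all (b, beta).

   The left side of G' consists of the pairs of (i, alpha) and (j, alpha') with
   i and j adjacent in G, joined to the common neighbours of both, and of enough
   vertices joined to everything; the right side is that of the norm graph.  A
   k-clique gives 'C(k, 2) pairs with k! + 1 common neighbours.  Without one,
   'C(k, 2) pairs involve at least k + 1 vertices of the norm graph.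

   The machine represents F as F_2[X] / h and finds h by brute force, testing
   whether X has order |F| - 1 modulo h.  Then the powers of X provide a table
   of discrete logarithms, and N compares logarithms modulo q - 1. *)

Require Import Defs.
From mathcomp Require Import all_boot all_order all_algebra all_fingroup all_solvable.
From mathcomp Require Import all_field.
From mathcomp Require Import zify ring.
Set Implicit Arguments.
Unset Strict Implicit.
Unset Printing Implicit Defensive.

(** * The norm-graph system over a finite field *)

(** The hypothesis says (k+6)!^(k+6) < n^6, and its use is to keep the least admissible q so small
    that q^(k+1) <= n^6. Then the candidates for h, the powers of X to test and the vertices of G'
    all number O(n^6), and so do the bits of a field element. The search for h and the filling of
    the adjacency matrix of G' are each three nested loops over such ranges; this is where n^18
    comes from. The averaging only shows that good alpha_i exist. The machine need not find them,
    since the left side of G' offers every alpha with every vertex of G. A biclique might therefore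
    use several alpha for one vertex of G; this is excluded because the norm graph vertices that
    occur are so few that all their pairs must come from edges of G. Characteristic 2 removes the
    signs: a + b is symmetric, vanishes only for a = b, and is the exclusive or of the codes. The
    value k! + 1 of k' is the first number of common neighbours that the bound k! excludes for k + 1
    vertices. *)

Section FieldTheory.

Import GRing.Theory.
Local Open Scope ring_scope.

(** * Spans of monomials, seen as functions on the solution set *)

Section FunctionSpans.

Variables (K : fieldType) (X : Type).
Implicit Types (f g h : X -> K) (B : (X -> K) -> Prop).

(** An inductive predicate stated with pointwise equalities: [X -> K] then needs neither a vector
    space structure nor extensionality, and proofs go by induction on the linear combination. *)
Inductive lspan B : (X -> K) -> Prop :=
  | Lspan0 g : (forall x, g x = 0) -> lspan B g
  | LspanS c b h g : B b -> lspan B h ->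
      (forall x, g x = c * b x + h x) -> lspan B g.

Lemma lspan_ext B f g : f =1 g -> lspan B f -> lspan B g.
Proof.
move=> fg Bf; case: Bf fg => [h h0|c b h h1 Bb Bh hE] fg.
  by apply: Lspan0 => x; rewrite -fg h0.
by apply: (LspanS (c := c) Bb Bh) => x; rewrite -fg hE.
Qed.

Lemma lspanD B f g : lspan B f -> lspan B g -> lspan B (fun x => f x + g x).
Proof.
move=> Bf; elim: Bf g => [f0 f00|c b h f0 Bb _ IH fE] g Bg.
  by apply: lspan_ext Bg => x; rewrite f00 add0r.
by apply: (LspanS (c := c) Bb (IH _ Bg)) => x; rewrite fE addrA.
Qed.

Lemma lspanZ B c f : lspan B f -> lspan B (fun x => c * f x).
Proof.
elim=> [g g0|d b h g Bb _ IH gE]; first by apply: Lspan0 => x; rewrite g0 mulr0.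
by apply: (LspanS (c := c * d) Bb IH) => x; rewrite gE mulrDr mulrA.
Qed.

Lemma lspan_gen B b : B b -> lspan B b.
Proof.
move=> Bb; apply: (LspanS (c := 1) (h := fun=> 0) Bb) => [|x].
  by apply: Lspan0.
by rewrite mul1r addr0.
Qed.

Lemma lspan_sum B (I : Type) (r : seq I) (P : pred I) (F : I -> X -> K) :
  (forall i, P i -> lspan B (F i)) ->
  lspan B (fun x => \sum_(i <- r | P i) F i x).
Proof.
move=> BF; elim: r => [|i r IH].
  by apply: Lspan0 => x; rewrite big_nil.
case Pi: (P i); last first.
  by apply: lspan_ext IH => x; rewrite big_cons Pi.
by apply: lspan_ext (lspanD (BF _ Pi) IH) => x; rewrite big_cons Pi.
Qed.

Lemma lspan_sum_seq B (I : eqType) (r : seq I) (F : I -> X -> K) :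
  (forall i, i \in r -> lspan B (F i)) ->
  lspan B (fun x => \sum_(i <- r) F i x).
Proof.
move=> BF; apply: (@lspan_ext _ (fun x => \sum_(i <- r | i \in r) F i x)).
  by move=> x; rewrite [RHS]big_seq.
exact: lspan_sum.
Qed.

Lemma lspan_mul B B' m f :
  (forall b, B b -> lspan B' (fun x => m x * b x)) -> lspan B f ->
  lspan B' (fun x => m x * f x).
Proof.
move=> BB'; elim=> [g g0|c b h g Bb _ IH gE].
  by apply: Lspan0 => x; rewrite g0 mulr0.
apply: lspan_ext (lspanD (lspanZ c (BB' _ Bb)) IH) => x.
by rewrite gE mulrDr mulrCA.
Qed.

Lemma lspan_trans B B' f :
  (forall b, B b -> lspan B' b) -> lspan B f -> lspan B' f.
Proof.
move=> BB' Bf; apply: (@lspan_ext _ (fun x => 1 * f x)).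
  by move=> x; rewrite mul1r.
apply: lspan_mul Bf => b /BB'; apply: lspan_ext => x; by rewrite mul1r.
Qed.

Variable y : nat -> X -> K.

(** The variables are functions on [X], not indeterminates. When [X] is the set of solutions, the
    equations of the system become identities and no multivariate polynomials or ideals are
    needed. *)
Definition mono (s : seq nat) (e : nat -> nat) (x : X) : K :=
  \prod_(l <- s) y l x ^+ e l.

Definition bounded_mono (s : seq nat) (d : nat -> nat) (b : X -> K) : Prop :=
  exists2 e : nat -> nat, {in s, forall l, (e l <= d l)%N} & b =1 mono s e.

Definition monospan (s : seq nat) (d : nat -> nat) := lspan (bounded_mono s d).

Lemma monospan_le s d d' f :
  {in s, forall l, (d l <= d' l)%N} -> monospan s d f -> monospan s d' f.
Proof.
move=> dd'; apply: lspan_trans => b [e eP bE]; apply: lspan_gen; exists e => //.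
by move=> l sl; apply: leq_trans (eP _ sl) (dd' _ sl).
Qed.

Lemma monospan_mulv s d l f : uniq s -> l \in s -> monospan s d f ->
  monospan s (fun i => d i + (i == l))%N (fun x => y l x * f x).
Proof.
move=> us sl; apply: lspan_mul => b [e eP bE]; apply: lspan_gen.
exists (fun i => e i + (i == l))%N => [i si|x].
  by rewrite leq_add2r eP.
rewrite bE /mono (bigD1_seq l) //= [RHS](bigD1_seq l) //= eqxx addn1 exprS.
rewrite mulrA; congr (_ * _); apply: eq_bigr => i /negbTE->.
by rewrite addn0.
Qed.

Lemma monospan_mul_prod s d r a f : uniq s -> uniq r -> {subset r <= s} ->
  monospan s d f ->
  monospan s (fun i => d i + (i \in r))%N
    (fun x => (\prod_(l <- r) (y l x - a l)) * f x).
Proof.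
move=> us; elim: r => [|l r IH] /= ur rs sf.
  apply: lspan_ext (monospan_le _ sf) => [x|i si]; last by rewrite leq_addr.
  by rewrite big_nil mul1r.
case/andP: ur => lr ur.
have sl : l \in s by apply: rs; rewrite mem_head.
have {}IH := IH ur (fun i ri => rs i (mem_behead (s := l :: r) ri)) sf.
have H1 := monospan_mulv us sl IH.
have H2 := lspanZ (- a l) IH.
apply: (@lspan_ext _ (fun x => y l x * ((\prod_(l <- r) (y l x - a l)) * f x)
   + - a l * ((\prod_(l <- r) (y l x - a l)) * f x))).
  by move=> x; rewrite big_cons; ring.
apply: lspanD.
  apply: monospan_le H1 => i si; rewrite inE; case: eqP => [->|] /=.
    by rewrite (negbTE lr) addn0.
  by rewrite addn0.
apply: monospan_le H2 => i si; rewrite inE leq_add2l.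
by case: (i \in r); rewrite ?orbT.
Qed.

Lemma monospan_cons s d l k f : l \notin s -> (k <= d l)%N -> monospan s d f ->
  monospan (l :: s) d (fun x => y l x ^+ k * f x).
Proof.
move=> ls kd; apply: lspan_mul => b [e eP bE]; apply: lspan_gen.
exists (fun i => if i == l then k else e i) => [i|x].
  rewrite inE; case: eqP => [-> //|_] /=; exact: eP.
rewrite bE /mono big_cons eqxx; congr (_ * _).
rewrite !big_seq; apply: eq_bigr => i si.
by case: eqP => // il; rewrite -il si in ls.
Qed.

Lemma perm_monospan s s' d f : perm_eq s s' -> monospan s d f -> monospan s' d f.
Proof.
move=> ss'; apply: lspan_trans => b [e eP bE]; apply: lspan_gen; exists e.
  by move=> l sl; apply: eP; rewrite (perm_mem ss').
by move=> x; rewrite bE /mono (perm_big _ ss').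
Qed.


Lemma monospan_horner s d l (p : {poly K}) f : l \notin s ->
  (size p <= (d l).+1)%N -> monospan s d f ->
  monospan (l :: s) d (fun x => p.[y l x] * f x).
Proof.
move=> ls sp sf.
apply: (@lspan_ext _ (fun x =>
  \sum_(k < size p) p`_k * (y l x ^+ k * f x))).
  move=> x; rewrite horner_coef mulr_suml.
  by apply: eq_bigr => k _; rewrite mulrA.
apply: lspan_sum => k _; apply: lspanZ; apply: monospan_cons => //.
by rewrite -ltnS; apply: leq_trans sp.
Qed.

(** Lagrange interpolation: as a polynomial in [z], the difference of both sides has degree below
    [size I] and vanishes at the [size I] distinct nodes. *)
Lemma lagrange_expr (I : seq nat) (a : nat -> K) (e : nat) :
  uniq I -> {in I &, injective a} -> (e < size I)%N -> forall z : K,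
  z ^+ e = \sum_(p <- I) a p ^+ e / (\prod_(j <- I | j != p) (a p - a j))
                         * \prod_(j <- I | j != p) (z - a j).
Proof.
move=> uI ainj eI z.
pose L p := \prod_(j <- I | j != p) ('X - (a j)%:P).
pose c p := a p ^+ e / (\prod_(j <- I | j != p) (a p - a j)).
have HL p w : (L p).[w] = \prod_(j <- I | j != p) (w - a j).
  by rewrite /L horner_prod; apply: eq_bigr => j _; rewrite hornerXsubC.
have sL p : p \in I -> (size (L p) <= size I)%N.
  move=> Ip; rewrite /L -big_filter size_prod_XsubC size_filter.
  rewrite -(count_predC (pred1 p) I) -addn1 addnC leq_add2r.
  by rewrite -has_count; apply/hasP; exists p => /=.
pose P := 'X^e - \sum_(p <- I) c p *: L p.
have P0 : P = 0.
  apply: (@roots_geq_poly_eq0 _ P [seq a i | i <- I]).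
  - apply/allP => _ /mapP[i Ii ->]; rewrite /root /P.
    suff E : \sum_(p <- I) (c p *: L p).[a i] = a i ^+ e.
      by rewrite hornerD hornerN horner_sum E hornerXn subrr.
    rewrite (bigD1_seq i) //= big1_seq => [|j /andP[ji Ij]].
      rewrite addr0 hornerZ HL /c mulfVK //.
      rewrite prodf_seq_neq0; apply/allP => j Ij; apply/implyP => ji.
      by rewrite subr_eq0; apply: contraNneq ji => /ainj ->.
    rewrite hornerZ HL; apply/eqP; rewrite mulf_eq0; apply/orP; right.
    rewrite prodf_seq_eq0; apply/hasP; exists i => //=.
    by rewrite eq_sym ji subrr eqxx.
  - by rewrite map_inj_in_uniq.
  rewrite size_map; apply: leq_trans (size_polyD _ _) _.
  rewrite geq_max size_polyXn eI size_polyN.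
  apply: (leq_trans (size_sum _ _ _)); apply/bigmax_leqP_seq => p Ip _.
  by apply: leq_trans (size_scale_leq _ _) (sL _ Ip).
have: P.[z] = 0 by rewrite P0 horner0.
rewrite /P !hornerE horner_sum => /eqP; rewrite subr_eq0 => /eqP ->.
by apply: eq_bigr => p _; rewrite hornerZ HL.
Qed.

(** Multiples of one of the products of the system. The bound [d] on the cofactor is the point: it
    controls the exponents that appear once the product is replaced. *)
Definition multiples (s : seq nat) (d : nat -> nat) (I : seq nat)
    (a : nat -> nat -> K) (b : X -> K) : Prop :=
  exists i h, [/\ i \in I, monospan s d h &
    forall x, b x = (\prod_(l <- s) (y l x - a i l)) * h x].

(* Lagrange interpolation in the first variable leaves, at the node [a p l],
   products that vanish for [i = p]; so one factor and one variable drop. *)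
Lemma mono_span_multiples s d I a e :
  uniq s -> map d s = rev (iota 0 (size s)) ->
  uniq I -> size I = (size s).+1 ->
  {in s, forall l, {in I &, injective (a^~ l)}} ->
  {in s, forall l, (e l <= (d l).+1)%N} ->
  lspan (multiples s d I a) (mono s e).
Proof.
elim: s I => [|l s IH] I us ds uI sI ainj es.
  case: I sI {ainj uI} => [//|i I _]; apply: lspan_gen.
  exists i, (mono [::] e); split; first by rewrite mem_head.
    by apply: lspan_gen; exists e.
  by move=> x; rewrite big_nil mul1r.
case/andP: us => ls us.
move: ds; rewrite [size _]/= -[(size s).+1]addn1 iotaD add0n rev_cat /=.
case=> dl ds.
pose c p := a p l ^+ e l / (\prod_(j <- I | j != p) (a p l - a j l)).
apply: (@lspan_ext _ (fun x => \sum_(p <- I)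
   ((c p * \prod_(j <- I | j != p) (y l x - a j l)) * mono s e x))).
  move=> x; rewrite /mono big_cons -mulr_suml; congr (_ * _).
  rewrite [RHS](@lagrange_expr I (a^~ l)) //.
    by apply: ainj; rewrite mem_head.
  by rewrite sI /= ltnS (leq_trans (es _ (mem_head _ _))) // dl.
apply: lspan_sum_seq => p Ip.
have sIp : size (rem p I) = (size s).+1 by rewrite size_rem // sI.
have {}IH : lspan (multiples s d (rem p I) a) (mono s e).
  apply: IH; rewrite ?rem_uniq //.
    move=> k sk i j Ii Ij; apply: ainj; first by rewrite inE sk orbT.
      by apply: mem_rem Ii.
    by apply: mem_rem Ij.
  by move=> k sk; apply: es; rewrite inE sk orbT.
apply: lspan_mul IH => b [i [h [Ii sh bE]]]; apply: lspan_gen.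
have [ip Ii'] : i != p /\ i \in I.
  by move: Ii; rewrite mem_rem_uniq // !inE => /andP[].
(* Node [p] is the one interpolated at, and node [i] gives the factor that completes the smaller
   product. The other nodes form a cofactor in [y l] of degree at most [size s], which is exactly
   [d l]. *)
pose P := c p *: \prod_(j <- rem i (rem p I)) ('X - (a j l)%:P).
exists i, (fun x => P.[y l x] * h x); split => //.
  apply: monospan_horner => //.
  apply: leq_trans (size_scale_leq _ _) _.
  by rewrite size_prod_XsubC size_rem // sIp dl.
move=> x; rewrite big_cons bE hornerZ horner_prod.
under [X in _ = _ * (_ * X * _)]eq_bigr do rewrite hornerXsubC.
have -> : \prod_(j <- I | j != p) (y l x - a j l) =
   (y l x - a i l) * \prod_(j <- rem i (rem p I)) (y l x - a j l).
  rewrite -big_filter -rem_filter // (perm_big _ (perm_to_rem Ii)).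
  by rewrite big_cons.
by ring.
Qed.


Section Reduction.

Variables (t : nat) (a : nat -> nat -> K) (b : nat -> K).
Hypothesis a_inj : forall l, (l < t)%N -> {in iota 0 t &, injective (a^~ l)}.
Hypothesis prod_const : forall i x, (i < t)%N ->
  \prod_(l <- iota 0 t) (y l x - a i l) = b i.

Let vars := iota 0 t.

(** Intermediate exponent bounds: descending from [stair t] to [stair 0], the bound [l], lowers the
    exponents one variable at a time, the last variable first. *)
Definition stair (j l : nat) : nat := if (l < j)%N then l.+1 else l.

(* If the exponent of [y j] is [j.+1], the rest of the monomial is a combination
   of multiples of the products over [l != j], and multiplying such a product
   by [y j] gives a constant plus a multiple of itself. *)
Lemma stair_step j f : (j < t)%N ->
  monospan vars (stair j.+1) f -> monospan vars (stair j) f.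
Proof.
move=> jt; apply: lspan_trans => m [e eP mE].
have [ej|ej] := leqP (e j) j.
  apply: lspan_gen; exists e => // l vl; have := eP l vl.
  rewrite /stair ltnS; case: (ltngtP l j) => // -> _; exact: ej.
(* The variables other than [j], ordered so that the bounds [d] below run through t - 2, ..., 0 as
   the interpolation requires; off [j], [stair j.+1] is this [d] plus one. *)
pose s := rev (iota j.+1 (t - j.+1)) ++ rev (iota 0 j).
have perm_s : perm_eq (j :: s) vars.
  have tE : (t = j + (t - j.+1).+1)%N by lia.
  rewrite /vars [in X in perm_eq _ X]tE iotaD add0n /=.
  rewrite perm_sym perm_catC /= perm_cons; apply: perm_cat;
    by rewrite perm_sym perm_rev.
have js : j \notin s.
  by rewrite mem_cat !mem_rev !mem_iota !ltnn.
have us : uniq s by have := perm_uniq perm_s; rewrite iota_uniq /= js.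
have sv : {subset s <= vars}.
  by move=> l sl; rewrite -(perm_mem perm_s) inE sl orbT.
have sizes : (size s).+1 = t by have := perm_size perm_s; rewrite size_iota.
pose d l := if (l < j)%N then l else l.-1.
have ds : map d s = rev (iota 0 (size s)).
  have st : size s = (j + (t - j.+1))%N by lia.
  rewrite st iotaD rev_cat map_cat !map_rev add0n; congr (rev _ ++ rev _).
    rewrite -[in LHS]add1n iotaDl -map_comp -[RHS]map_id.
    apply/eq_in_map => l; rewrite mem_iota => /andP[jl _] /=.
    by rewrite /d ltnNge (leqW jl).
  rewrite -[RHS]map_id; apply/eq_in_map => l; rewrite mem_iota /d.
  by case/andP => _ ->.
have Hs : lspan (multiples s d vars a) (mono s e).
  apply: mono_span_multiples => //; rewrite ?iota_uniq ?size_iota ?sizes //.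
    by move=> l /sv; rewrite mem_iota => vl; apply: a_inj.
  move=> l sl; have := eP l (sv l sl); rewrite /stair /d ltnS.
  case: (ltngtP l j) => [//|jl|lj]; last by rewrite lj (negbTE js) in sl.
  by rewrite prednK // (leq_ltn_trans _ jl).
apply: (@lspan_ext _ (fun x => y j x ^+ j.+1 * mono s e x)).
  move=> x; rewrite mE /mono -(perm_big _ perm_s) big_cons.
  congr (_ ^+ _ * _); apply/eqP; rewrite eqn_leq ej.
  have := eP j; rewrite mem_iota /stair add0n jt ltnSn; exact.
apply: lspan_mul Hs => {mE}m [i [h [vi sh mE]]].
move: vi; rewrite mem_iota add0n => /= it.
have h1 : monospan (j :: s) (stair j) (fun x => y j x ^+ j * h x).
  apply: monospan_cons => //; first by rewrite /stair ltnn.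
  apply: monospan_le sh => l sl; rewrite /d /stair; case: ltnP => // jl.
  exact: leq_pred.
have h2 : monospan (j :: s) (stair j)
    (fun x => y j x ^+ j * ((\prod_(l <- s) (y l x - a i l)) * h x)).
  apply: monospan_cons => //; first by rewrite /stair ltnn.
  apply: monospan_le (monospan_mul_prod (a i) us us _ sh) => // l sl.
  rewrite sl addn1 /d /stair; case: (ltnP l j) => // jl.
  case: l jl sl => [|//]; rewrite leqn0 => /eqP j0 sl.
  by rewrite j0 sl in js.
apply: (perm_monospan perm_s).
apply: lspan_ext (lspanD (lspanZ (b i) h1) (lspanZ (a i j) h2)) => x.
have := prod_const x it; rewrite -(perm_big _ perm_s) big_cons /= => bE.
by rewrite mE -bE exprS; ring.
Qed.

Lemma stair_le j f : (j <= t)%N ->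
  monospan vars (stair j) f -> monospan vars id f.
Proof.
elim: j => [_|j IH jt sf]; last by apply: IH (stair_step jt sf); apply: ltnW.
exact: monospan_le.
Qed.

(** One more factor [y 0] raises a single exponent bound from 0 to 1, which [stair t] allows; so
    each power can be reduced before the next multiplication. *)
Lemma monospan_exp k : (0 < t)%N -> monospan vars id (fun x => y 0%N x ^+ k).
Proof.
move=> t0; elim: k => [|k IH].
  apply: lspan_gen; exists (fun=> 0%N) => // x.
  by rewrite /mono big1.
apply: (@stair_le t) => //.
have v0 : 0%N \in vars by rewrite mem_iota.
apply: lspan_ext (monospan_le _ (monospan_mulv (iota_uniq _ _) v0 IH)) => [x|l].
  by rewrite exprS.
by rewrite mem_iota /stair add0n /= => ->; case: eqP; lia.
Qed.

End Reduction.

(** Makes the spanning set finite and countable: an exponent of variable [l] is at most [l], hence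
    below [t], so exponents become finite functions. *)
Lemma monospan_coef t f : monospan (iota 0 t) id f ->
  exists c : {ffun 'I_t -> 'I_t} -> K, forall x,
    f x = \sum_(e in family (fun l : 'I_t => [pred i : 'I_t | (i <= l)%N]))
             c e * \prod_(l < t) y l x ^+ e l.
Proof.
elim=> [g g0|c m h g [e eP mE] _ [c' hE] gE].
  by exists (fun=> 0) => x; rewrite g0 big1 // => i _; rewrite mul0r.
have et (l : 'I_t) : (e l < t)%N.
  by apply: leq_ltn_trans (ltn_ord l); apply: eP; rewrite mem_iota /=.
pose e0 : {ffun 'I_t -> 'I_t} := [ffun l => Ordinal (et l)].
have e0F : e0 \in family (fun l : 'I_t => [pred i : 'I_t | (i <= l)%N]).
  by apply/familyP => l; rewrite ffunE inE /= eP // mem_iota /=.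
exists (fun e1 => (if e1 == e0 then c else 0) + c' e1) => x.
under eq_bigr do rewrite mulrDl.
rewrite big_split /= -hE gE (bigD1 e0 e0F) /= eqxx.
rewrite [X in _ + X + _]big1 => [|e1 /andP[_ /negbTE ->]].
  rewrite addr0 mE /mono; congr (_ * _ + _).
  have -> : iota 0 t = index_iota 0 t by rewrite /index_iota subn0.
  by rewrite big_mkord; apply: eq_bigr => l _; rewrite ffunE.
by rewrite mul0r.
Qed.

End FunctionSpans.

Lemma card_stair t :
  #|family (fun l : 'I_t => [pred i : 'I_t | (i <= l)%N])| = t`!%N.
Proof.
rewrite card_family -[RHS]/(t`!) fact_prod big_add1 /= big_mkord.
rewrite foldrE big_map big_enum /=; apply: eq_bigr => l _.
have -> : #|[pred i : 'I_t | (i <= l)%N]| = #|[set widen_ord (ltn_ord l) i | i : 'I_l.+1]|.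
  apply: eq_card => i; rewrite inE; apply/idP/imsetP => [il|[j _ ->]].
    by exists (Ordinal (n := l.+1) (il : i < l.+1)%N) => //; apply: val_inj.
  by rewrite /= -ltnS.
by rewrite card_imset ?card_ord // => i j /(congr1 val) ij; apply: val_inj.
Qed.

(* The lemma of Kollar, Ronyai and Szabo that underlies norm graphs. *)
Lemma card_product_system (K : fieldType) (t : nat) (xs : seq K)
    (y : nat -> K -> K) (a : nat -> nat -> K) (b : nat -> K) :
  (0 < t)%N -> uniq xs -> (forall x, y 0%N x = x) ->
  (forall l, (l < t)%N -> {in iota 0 t &, injective (a^~ l)}) ->
  (forall i x, (i < t)%N -> x \in xs ->
     \prod_(l <- iota 0 t) (y l x - a i l) = b i) ->
  (size xs <= t`!)%N.
Proof.
move=> t0 uxs y0 ainj prodE.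
set m := size xs.
pose y' l (p : 'I_m) := y l xs`_p.
have H k : exists c : {ffun 'I_t -> 'I_t} -> K, forall p : 'I_m,
    y' 0%N p ^+ k = \sum_(e in family (fun l : 'I_t => [pred i : 'I_t | (i <= l)%N]))
             c e * \prod_(l < t) y' l p ^+ e l.
  apply: monospan_coef; apply: (monospan_exp (a := a) (b := b)) => // i p it.
  by apply: prodE => //; apply: mem_nth.
(* The Vandermonde matrix of the distinct solutions, of full rank [m]. Its rows are powers of [y 0],
   hence lie in the row space of [N], which has only t! rows. *)
pose V : 'M[K]_m := \matrix_(i, p) xs`_p ^+ i.
set F := family _ in H.
pose N : 'M[K]_(#|F|, m) := \matrix_(e, p) \prod_(l < t) y' l p ^+ ((enum_val e : {ffun 'I_t -> 'I_t}) l).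
have VN : (V <= N)%MS.
  apply/row_subP => i; have [c cE] := H i.
  apply/submxP; exists (\row_e c (enum_val e)).
  apply/rowP => p; rewrite !mxE -[xs`_p]y0 -/(y' 0%N p) cE big_enum_val.
  by apply: eq_bigr => e _; rewrite !mxE.
have rV : \rank V = m.
  apply/eqP; rewrite -[_ == m]/(row_free V) row_free_unit unitmxE unitfE.
  pose u : 'rV[K]_m := \row_p xs`_p.
  have -> : V = Vandermonde m u by apply/matrixP => i p; rewrite !mxE.
  rewrite det_Vandermonde; apply/prodf_neq0 => i _; apply/prodf_neq0 => j ij.
  by rewrite !mxE subr_eq0 nth_uniq // neq_ltn ij orbT.
by rewrite -[m]rV -card_stair (leq_trans (mxrankS VN)) // rank_leq_row.
Qed.

(** * Linear feedback shift registers and fields of characteristic 2 *)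

(** Addition of polynomials over F_2 on codes, in the form in which the machine computes it: the
    quotients are added whole, since only their parities matter. *)
Definition xorn (r x y : nat) : nat :=
  (\sum_(j < r) ((x %/ 2 ^ j + y %/ 2 ^ j) %% 2) * 2 ^ j)%N.

(* Multiplication by X modulo X ^ r + f, for polynomials over F_2 coded by their
   binary digits. *)
Definition lfsr (r f v : nat) : nat :=
  (if 2 * v < 2 ^ r then 2 * v else xorn r (2 * v - 2 ^ r) f)%N.

(** The known object is a primitive polynomial X^r + f over F_2; phrased through the orbit of 1, the
    property can be tested by running the register. *)
Definition primitive_taps (r f : nat) : Prop :=
  iter (2 ^ r).-1 (lfsr r f) 1%N = 1%N /\
  forall i, (0 < i < (2 ^ r).-1)%N -> iter i (lfsr r f) 1%N <> 1%N.

Lemma bits_lt r (b : nat -> nat) : (forall i, b i < 2)%N ->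
  (\sum_(j < r) b j * 2 ^ j < 2 ^ r)%N.
Proof.
move=> b2; elim: r => [|r IH]; first by rewrite big_ord0.
rewrite big_ord_recr /= expnS mul2n -addnn -addSn leq_add //.
by rewrite -[leqRHS]mul1n leq_mul2r -ltnS b2 orbT.
Qed.

Lemma bits_nth r (b : nat -> nat) j : (forall i, b i < 2)%N -> (j < r)%N ->
  (((\sum_(i < r) b i * 2 ^ i) %/ 2 ^ j) %% 2 = b j)%N.
Proof.
move=> b2; elim: r => [//|r IH]; rewrite ltnS leq_eqVlt big_ord_recr /=.
case/orP => [/eqP->|jr].
  by rewrite addnC divnMDl ?expn_gt0 // divn_small ?bits_lt // addn0 modn_small.
have rE : (2 ^ r = 2 ^ (r - j.+1) * 2 * 2 ^ j)%N by rewrite -mulnA -expnS -expnD subnK.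
rewrite addnC rE !mulnA divnMDl ?expn_gt0 //.
by rewrite -modnDml modnMl add0n IH.
Qed.

Lemma xorn_lt r x y : (xorn r x y < 2 ^ r)%N.
Proof.
apply: (@bits_lt r (fun j => (x %/ 2 ^ j + y %/ 2 ^ j) %% 2)%N) => i.
by rewrite ltn_mod.
Qed.

Lemma xorn_bit r x y j : (j < r)%N ->
  ((xorn r x y %/ 2 ^ j) %% 2 = (x %/ 2 ^ j + y %/ 2 ^ j) %% 2)%N.
Proof.
apply: (@bits_nth r (fun j => (x %/ 2 ^ j + y %/ 2 ^ j) %% 2)%N) => i.
by rewrite ltn_mod.
Qed.

Lemma lfsr_lt r f v : (lfsr r f v < 2 ^ r)%N.
Proof. by rewrite /lfsr; case: ifP => // _; apply: xorn_lt. Qed.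

Section BitEvaluation.

Variables (R : comNzRingType) (g : R).
Hypothesis charR : 2%N \in [pchar R].

(** The value at [g] of the polynomial coded by [v]. The quotients stand for binary digits: in
    characteristic 2 only their parities count. *)
Definition biteval (r v : nat) : R := \sum_(j < r) (v %/ 2 ^ j)%:R * g ^+ j.

Lemma natr_mod2 (m : nat) : (m %% 2)%:R = m%:R :> R.
Proof.
have c2 : 2%:R = 0 :> R by apply: pcharf0.
by rewrite {2}(divn_eq m 2) natrD natrM c2 mulr0 add0r.
Qed.

Lemma biteval0 r : biteval r 0 = 0.
Proof. by apply: big1 => j _; rewrite div0n mul0r. Qed.

Lemma biteval1 r : (0 < r)%N -> biteval r 1 = 1.
Proof.
case: r => // r _; rewrite /biteval big_ord_recl divn1 mul1r expr0 big1 ?addr0 //.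
by move=> i _; rewrite divn_small ?mul0r // (ltn_exp2l 0).
Qed.

Lemma biteval_xorn r x y : biteval r (xorn r x y) = biteval r x + biteval r y.
Proof.
rewrite /biteval -big_split /=; apply: eq_bigr => j _.
by rewrite -mulrDl -natrD -natr_mod2 xorn_bit // natr_mod2.
Qed.

(** Doubling shifts the digits by one place; the digit that leaves the range, if it is 1,
    contributes [g ^+ r]. *)
Lemma biteval_shift r v : (v < 2 ^ r)%N ->
  g * biteval r v = if (2 * v < 2 ^ r)%N then biteval r (2 * v)
                    else biteval r (2 * v - 2 ^ r) + g ^+ r.
Proof.
move=> vr.
have E : g * biteval r v = biteval r.+1 (2 * v).
  rewrite /biteval big_ord_recl divn1 natrM (pcharf0 charR) !mul0r add0r mulr_sumr.
  apply: eq_bigr => j _; rewrite lift0 expnS divnMl // exprS; ring.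
rewrite E {1}/biteval big_ord_recr /=; case: ltnP => [lt|ge].
  by rewrite divn_small // mul0r addr0.
have vE : (2 * v = 2 * v - 2 ^ r + 2 ^ r)%N by rewrite subnK.
congr (_ + _).
  apply: eq_bigr => j _; congr (_ * _).
  have vE' : (2 * v = 2 ^ (r - j.+1) * 2 * 2 ^ j + (2 * v - 2 ^ r))%N.
    by rewrite -mulnA -expnS -expnD subnK // addnC.
  rewrite {1}vE' divnMDl ?expn_gt0 //.
  by rewrite natrD natrM (pcharf0 charR) mulr0 add0r.
rewrite vE divnDr // divnn expn_gt0 /= divn_small ?mul1r //.
by rewrite ltn_subLR // addnn -mul2n ltn_mul2l.
Qed.

Lemma biteval_lfsr r f v : (v < 2 ^ r)%N -> biteval r f = g ^+ r ->
  biteval r (lfsr r f v) = g * biteval r v.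
Proof.
move=> vr fr; rewrite biteval_shift // /lfsr; case: ifP => // _.
by rewrite biteval_xorn fr.
Qed.

Lemma biteval_iter_lfsr r f i : (0 < r)%N -> biteval r f = g ^+ r ->
  biteval r (iter i (lfsr r f) 1%N) = g ^+ i.
Proof.
move=> r0 fr; elim: i => [|i IH]; first by rewrite biteval1.
rewrite iterS biteval_lfsr ?IH ?exprS //.
by case: i {IH} => [|i]; rewrite ?iterS ?lfsr_lt // (ltn_exp2l 0).
Qed.

Lemma biteval_mod r v : biteval r (v %% 2 ^ r) = biteval r v.
Proof.
apply: eq_bigr => j _; congr (_ * _).
have vE : (v = v %/ 2 ^ r * 2 ^ (r - j.+1) * 2 * 2 ^ j + v %% 2 ^ r)%N.
  by rewrite -!mulnA -expnS -expnD subnK // -divn_eq.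
rewrite {2}vE divnMDl ?expn_gt0 //.
by rewrite natrD natrM (pcharf0 charR) mulr0 add0r.
Qed.

End BitEvaluation.

Lemma iter_lfsr_lt r f i : (1 < r)%N -> (iter i (lfsr r f) 1%N < 2 ^ r)%N.
Proof.
by case: i => [|i] r1; rewrite ?iterS ?lfsr_lt // (ltn_exp2l 0) // ltnW.
Qed.

Lemma finField_generator (F : finFieldType) :
  exists2 g : F, g ^+ #|F|.-1 = 1 &
    forall i j, (i < #|F|.-1)%N -> (j < #|F|.-1)%N -> g ^+ i = g ^+ j -> i = j.
Proof.
have /cyclicP[u uE] := field_unit_group_cyclic [set: {unit F}].
have ou : #[u]%g = #|F|.-1 by rewrite orderE -uE card_finField_unit.
exists (val u) => [|i j iF jF].
  by rewrite -FinRing.val_unitX -ou expg_order.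
rewrite -!FinRing.val_unitX => /val_inj /eqP; rewrite eq_expg_mod_order ou !modn_small //.
by move/eqP.
Qed.

(** Counting replaces the theory of minimal polynomials. For a generator g of the field with 2^r
    elements and d < r, the F_2-span of 1, ..., g^(d-1) does not contain g^d. So the 2^r
    combinations of 1, ..., g^(r-1) are distinct and fill the field; one of them is g^r, and its
    digits are the taps. *)
Lemma primitive_taps_exist r : (1 < r)%N ->
  exists2 f, (f < 2 ^ r)%N & primitive_taps r f.
Proof.
move=> r1; have [F charF cardF] := pPrimePowerField (isT : prime 2) (ltnW r1).
have [g] := finField_generator F; rewrite cardF => g_ord g_inj.
pose im d := [set biteval g d v | v : 'I_(2 ^ d)].
have imP d v : (v < 2 ^ d)%N -> biteval g d v \in im d.
  by move=> vd; apply/imsetP; exists (Ordinal vd).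
(* If [im d] contained g^d, it would be closed under multiplication by g and contain all 2^r - 1
   powers of g, but it has at most 2^d elements. *)
have im_small d : g ^+ d \in im d -> (r <= d)%N.
  case/imsetP => f _ fE.
  have gi i : g ^+ i \in im d.
    elim: i => [|i /imsetP[v _ vE]].
      case: d f fE => [|d] f fE; last by rewrite expr0 -(biteval1 g (ltn0Sn d)) imP // (ltn_exp2l 0).
      by rewrite fE imP.
    by rewrite exprS vE -(biteval_lfsr charF (ltn_ord v) (esym fE)) imP ?lfsr_lt.
  have : ((2 ^ r).-1 <= 2 ^ d)%N.
    pose e (i : 'I_(2 ^ r).-1) : F := g ^+ i.
    have e_inj : {in setT &, injective e}.
      by move=> i j _ _ ij; apply: val_inj; apply: (g_inj _ _ _ _ ij).
    rewrite -[leqLHS]card_ord -cardsT -(card_in_imset e_inj) -[leqRHS]card_ord.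
    apply: (@leq_trans #|im d|); last by rewrite leq_imset_card.
    by apply: subset_leq_card; apply/subsetP => _ /imsetP[i _ ->]; apply: gi.
  apply: contraTleq => dr; rewrite -ltnNge.
  apply: (@leq_ltn_trans (2 ^ r.-1)%N); first by rewrite leq_exp2l // -ltnS prednK // ltnW.
  rewrite -{2}(prednK (ltnW r1)) expnS mul2n -addnn.
  have : (1 < 2 ^ r.-1)%N by rewrite (ltn_exp2l 0) // -subn1 subn_gt0.
  lia.
have inj d v w : (d <= r)%N -> (v < 2 ^ d)%N -> (w < 2 ^ d)%N ->
    biteval g d v = biteval g d w -> v = w.
  elim: d v w => [|d IH] v w dr; first by case: v w => [|//] [].
  rewrite expnS -!ltn_divLR ?expn_gt0 // => v2 w2.
  rewrite /biteval !big_ord_recr -!/(biteval g d _) /=.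
  rewrite -(biteval_mod g charF d v) -(biteval_mod g charF d w).
  have vd := ltn_pmod v (expn_gt0 2 d : (0 < 2 ^ d)%N).
  have wd := ltn_pmod w (expn_gt0 2 d : (0 < 2 ^ d)%N).
  (* This excludes equal values with different top digits: [im d] is closed under addition by
     [xorn]. *)
  have xP : biteval g d (v %% 2 ^ d) + biteval g d (w %% 2 ^ d) != g ^+ d.
    rewrite -(biteval_xorn g charF); apply: contraTneq dr => E; rewrite -ltnNge.
    by rewrite ltnS im_small // -E imP ?xorn_lt.
  have opp2 (x : F) : - x = x by exact: oppr_pchar2.
  rewrite {3}(divn_eq v (2 ^ d)) {3}(divn_eq w (2 ^ d)).
  case: (v %/ 2 ^ d)%N v2 => [|[|//]] _; case: (w %/ 2 ^ d)%N w2 => [|[|//]] _;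
    rewrite ?mul0r ?mul1r ?addr0 => E.
  - by rewrite (IH _ _ (ltnW dr) vd wd E).
  - by case/eqP: xP; rewrite E addrAC -{1}[biteval g d (w %% _)]opp2 addNr add0r.
  - by case/eqP: xP; rewrite -E addrA -{1}[biteval g d (v %% _)]opp2 addNr add0r.
  by rewrite (IH _ _ (ltnW dr) vd wd (addIr _ E)).
have card_im : im r = setT.
  apply/eqP; rewrite eqEcard subsetT cardsT cardF card_in_imset ?card_ord ?leqnn //.
  by move=> v w _ _ /inj vw; apply: val_inj; apply: vw.
have: g ^+ r \in im r by rewrite card_im inE.
case/imsetP => f _ fE; exists f => //.
have it i := biteval_iter_lfsr charF i (ltnW r1) (esym fE).
have it1 : biteval g r 1 = 1 by apply: biteval1; apply: ltnW.
have one_lt : (1 < 2 ^ r)%N by rewrite (ltn_exp2l 0) // ltnW.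
split=> [|i /andP[i0 ir] iE].
  by apply: (inj r) => //; rewrite ?iter_lfsr_lt // it // it1.
have Z0 : (0 < (2 ^ r).-1)%N by apply: ltn_trans ir.
have := it i; rewrite iE it1 -[LHS](expr0 g) => /(g_inj _ _ Z0 ir) i00.
by rewrite -i00 in i0.
Qed.

(** All that the norm graph has to know about the field. The map [phi] decodes words and [g] is the
    image of X; since every nonzero word is an iterate of the register, the number of steps is a
    discrete logarithm. *)
Definition lfsr_model r f (F : finFieldType) (phi : nat -> F) (g : F) : Prop :=
  [/\ 2%N \in [pchar F],
      forall a b, (a < 2 ^ r)%N -> (b < 2 ^ r)%N -> phi a = phi b -> a = b,
      forall a b, phi (xorn r a b) = phi a + phi b,
      phi 0%N = 0 /\ g ^+ (2 ^ r).-1 = 1 &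
      (forall i, phi (iter i (lfsr r f) 1%N) = g ^+ i) /\
      forall w, (0 < w < 2 ^ r)%N ->
        exists2 i, (i < (2 ^ r).-1)%N & w = iter i (lfsr r f) 1%N].

Lemma bits_inj r v w : (v < 2 ^ r)%N -> (w < 2 ^ r)%N ->
  (forall j, (j < r)%N -> (v %/ 2 ^ j) %% 2 = (w %/ 2 ^ j) %% 2)%N -> v = w.
Proof.
elim: r v w => [|r IH] v w; first by case: v w => [|//] [].
rewrite expnS mulnC -!ltn_divLR // => v2 w2 vw.
have v0 : (v %% 2 = w %% 2)%N by have := vw 0%N isT; rewrite expn0 !divn1.
rewrite (divn_eq v 2) (divn_eq w 2) v0; congr (_ * _ + _)%N.
by apply: IH => // j jr; have := vw j.+1 jr; rewrite expnS !divnMA.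
Qed.

Lemma biteval_poly r v :
  biteval ('X : {poly 'F_2}) r v = \poly_(j < r) (v %/ 2 ^ j)%:R.
Proof.
rewrite poly_def; apply: eq_bigr => j _.
by rewrite mulr_natl scaler_nat.
Qed.

Lemma biteval_polyX_inj r v w : (v < 2 ^ r)%N -> (w < 2 ^ r)%N ->
  biteval ('X : {poly 'F_2}) r v = biteval 'X r w -> v = w.
Proof.
move=> vr wr; rewrite !biteval_poly => /polyP E; apply: (bits_inj vr wr) => j jr.
have := E j; rewrite !coef_poly jr => /(congr1 val) /=.
by rewrite !val_Fp_nat.
Qed.

Lemma biteval_morph (R S : comNzRingType) (m : {rmorphism R -> S}) g r v :
  m (biteval g r v) = biteval (m g) r v.
Proof.
rewrite rmorph_sum; apply: eq_bigr => j _.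
by rewrite rmorphM rmorph_nat rmorphXn.
Qed.

(* If [X] has order [2 ^ r - 1] modulo [h], then every nonzero residue is a
   power of [X], hence invertible, and [h] cannot have a proper factor. *)
Lemma primitive_taps_model r f : (1 < r)%N -> (f < 2 ^ r)%N -> primitive_taps r f ->
  exists (F : finFieldType) (phi : nat -> F) (g : F), lfsr_model r f phi g.
Proof.
move=> r1 fr [it1 itN].
have r0 := ltnW r1.
have one_lt : (1 < 2 ^ r)%N by rewrite (ltn_exp2l 0).
have char2 : 2%N \in [pchar 'F_2] by rewrite pchar_Fp.
pose P v := biteval ('X : {poly 'F_2}) r v.
have sP v : (size (P v) <= r)%N by rewrite /P biteval_poly size_poly.
pose h := 'X^r + P f.
have sh : size h = r.+1.
  by rewrite /h size_polyDl size_polyXn // ltnS.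
have hM : h \is monic.
  by rewrite monicE /h lead_coefDl ?size_polyXn ?ltnS // lead_coefXn.
have mkh : mk_monic h = h by rewrite /mk_monic sh hM ltnS r0.
pose Q : comNzRingType := {poly %/ h}.
have char2Q : 2%N \in [pchar Q] by rewrite pchar_qpoly.
have opp2 (x : Q) : - x = x by exact: oppr_pchar2.
pose g : Q := 'qX.
have gE v : biteval g r v = in_qpoly h (P v).
  by rewrite /P (biteval_morph (in_qpoly h)).
have h0 : in_qpoly h h = 0.
  apply: val_inj => /=; rewrite mkh; exact: Pdiv.RingMonic.rmodpp.
have fg : biteval g r f = g ^+ r.
  apply/eqP; rewrite -subr_eq0 opp2 gE addrC.
  by rewrite -[g ^+ r](rmorphXn (in_qpoly h)) -rmorphD /= -/h h0.
have small (p : {poly 'F_2}) : (size p < size h)%N -> in_qpoly h p = 0 -> p = 0.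
  by move=> ph /(congr1 (@polyn _ _)); rewrite in_qpoly_small ?mkh.
have phi_inj v w : (v < 2 ^ r)%N -> (w < 2 ^ r)%N ->
    biteval g r v = biteval g r w -> v = w.
  move=> vr wr; rewrite !gE => /(congr1 (@polyn _ _)).
  by rewrite !in_qpoly_small ?mkh ?sh ?ltnS ?sP //; apply: biteval_polyX_inj.
have git i : biteval g r (iter i (lfsr r f) 1%N) = g ^+ i.
  exact: biteval_iter_lfsr.
have gZ : g ^+ (2 ^ r).-1 = 1 by rewrite -git it1 biteval1.
set n := (2 ^ r).-1 in it1 itN gZ *.
have n0 : (0 < n)%N by rewrite /n -subn1 subn_gt0.
have gU i : g ^+ i != 0.
  apply/eqP => gi0; have : (g ^+ i) ^+ n = 1 by rewrite exprAC gZ expr1n.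
  by rewrite gi0 expr0n gtn_eqF //; apply/eqP; rewrite eq_sym oner_eq0.
have g_inj : injective (fun i : 'I_n => g ^+ i).
  (* [Q] is not yet known to be a domain. Instead of cancelling, an equality of powers is multiplied
     by g^(n-j), which gives a return to 1 after n - (j - i) steps. *)
  have lt_neq (i j : nat) : (i < j < n)%N -> g ^+ i != g ^+ j.
    case/andP => ij jn; apply/eqP => gij.
    have {}gij : g ^+ (n - (j - i)) = 1.
      have -> : (n - (j - i) = i + (n - j))%N by lia.
      by rewrite exprD gij -exprD subnKC ?gZ // ltnW.
    case: (itN (n - (j - i))%N); first by lia.
    by apply: phi_inj; rewrite ?iter_lfsr_lt // git gij biteval1.
  move=> i j /= gij; apply: val_inj; apply/eqP => /=.
  case: (ltngtP i j) => // ij.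
    by have := lt_neq i j; rewrite ij ltn_ord gij eqxx => /(_ isT).
  by have := lt_neq j i; rewrite ij ltn_ord gij eqxx => /(_ isT).
(* [Q] has 2^r elements, so the 2^r - 1 distinct nonzero powers of [g] exhaust the rest. *)
have gP (x : Q) : x != 0 -> exists2 i, (i < n)%N & x = g ^+ i.
  move=> x0.
  have: x \in [set g ^+ (i : 'I_n) | i in 'I_n].
    suff -> : [set g ^+ (i : 'I_n) | i in 'I_n] = [set~ 0] by rewrite !inE.
    apply/eqP; rewrite eqEcard; apply/andP; split.
      by apply/subsetP => _ /imsetP[i _ ->]; rewrite !inE gU.
    rewrite card_imset // card_ord cardsC1.
    by rewrite [#|_|](@card_monic_qpoly _ h) ?sh // card_Fp.
  by case/imsetP => i _ ->; exists i.
have hI : monic_irreducible_poly h.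
  split=> //; split=> [|p p1 ph]; first by rewrite sh ltnS.
  have hn0 : h != 0 by rewrite -size_poly_gt0 sh.
  rewrite -dvdp_size_eqp //; apply: contraT => ps.
  have pn0 : p != 0 by apply: contraNneq hn0 => p0; rewrite p0 dvd0p in ph.
  have {}ps : (size p < size h)%N by rewrite ltn_neqAle ps dvdp_leq.
  case/dvdpP: ph => c hc.
  have cn0 : c != 0 by apply: contraNneq hn0 => c0; rewrite hc c0 mul0r.
  have cs : (size c < size h)%N.
    rewrite hc size_mul //; move: p1 pn0; rewrite -size_poly_gt0.
    by case: (size p) => [|[|m]] // _ _; rewrite !addnS /= ltnS leq_addr.
  have [i _ pi] : exists2 i, (i < n)%N & in_qpoly h p = g ^+ i.
    by apply: gP; apply: contra pn0 => /eqP /(small _ ps) ->.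
  have [j _ cj] : exists2 i, (i < n)%N & in_qpoly h c = g ^+ i.
    by apply: gP; apply: contra cn0 => /eqP /(small _ cs) ->.
  by have := gU (j + i)%N; rewrite exprD -pi -cj -rmorphM -hc /= h0 eqxx.
exists {poly %/ h with hI}, (biteval g r), g; split=> //.
- by move=> a b; apply: biteval_xorn.
- by split; first exact: biteval0.
split=> // w /andP[w0 wr].
have /gP[i i_lt wi] : biteval g r w != 0.
  apply: contraTneq w0 => w0; rewrite -leqNgt leqn0; apply/eqP.
  by apply: phi_inj; rewrite ?expn_gt0 // w0 biteval0.
by exists i => //; apply: phi_inj; rewrite ?iter_lfsr_lt // git.
Qed.

(** * Common neighbours in the projective norm graph *)

Lemma pigeonhole_fiber (D C : finType) (f : D -> C) (A : {set D}) N :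
  (N * #|C| < #|A|)%N -> exists c, (N < #|[set x in A | f x == c]|)%N.
Proof.
move=> NA; apply/existsP; apply: contraLR NA; rewrite negb_exists => /forallP H.
rewrite -leqNgt -sum1_card (partition_big f predT) //= mulnC -sum_nat_const.
apply: leq_sum => c _; move: (H c); rewrite -leqNgt -sum1_card.
by rewrite (eq_bigl (fun x => (x \in A) && (f x == c))) // => x; rewrite inE.
Qed.

Section NormIncidence.

Variables (F : finFieldType) (s k : nat) (phi : nat -> F) (g : F).
Variables (xr : nat -> nat -> nat) (L : nat -> nat).
Local Notation q := (2 ^ s)%N.
Local Notation q1 := (2 ^ s).-1.
Local Notation Z := (2 ^ (s * k))%N.
Hypotheses (s_gt0 : (0 < s)%N) (k_gt0 : (0 < k)%N).
Hypothesis charF : 2%N \in [pchar F].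
Hypothesis phi_inj : forall a b, (a < Z)%N -> (b < Z)%N -> phi a = phi b -> a = b.
Hypothesis phi0 : phi 0 = 0.
Hypothesis phiD : forall a b, (a < Z)%N -> (b < Z)%N ->
  phi (xr a b) = phi a + phi b.
Hypothesis xr_lt : forall a b, (a < Z)%N -> (b < Z)%N -> (xr a b < Z)%N.
Hypothesis g_order : g ^+ Z.-1 = 1.
Hypothesis phiL : forall w, (0 < w < Z)%N -> phi w = g ^+ L w.

(* The projective norm graph: [(a, alpha)] and [(b, beta)] are adjacent when
   the norm of [a + b] is the product of the field elements with discrete
   logarithms [alpha] and [beta]; the norm of [g ^+ i] only depends on [i]
   modulo [q - 1]. *)
Definition incident (u b : nat * nat) : bool :=
  (xr u.1 b.1 != 0)%N && (L (xr u.1 b.1) == u.2 + b.2 %[mod q1]).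

(** The norm from [F] to its subfield of q elements is x -> x^e, as the conjugates of x are the
    x^(q^l). *)
Let e := (\sum_(l < k) q ^ l)%N.

Let q_gt1 : (1 < q)%N. Proof. by rewrite (ltn_exp2l 0). Qed.
Let q1_gt0 : (0 < q1)%N. Proof. by rewrite -subn1 subn_gt0. Qed.

Let e_q1 : (q1 * e)%N = Z.-1. Proof. by rewrite expnM [RHS]predn_exp. Qed.

Let g_mod i j : i = j %[mod q1] -> (g ^+ i) ^+ e = (g ^+ j) ^+ e.
Proof.
have H m : (g ^+ m) ^+ e = (g ^+ (m %% q1)) ^+ e.
  rewrite {1}(divn_eq m q1) exprD exprMn -!exprM -mulnA e_q1 mulnC exprM.
  by rewrite g_order expr1n mul1r.
by move=> ij; rewrite H ij -H.
Qed.

Let frob l (x y : F) : (x + y) ^+ (q ^ l) = x ^+ (q ^ l) + y ^+ (q ^ l).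
Proof.
apply: exprDn_pchar; rewrite (eq_pnat _ (pcharf_eq charF)).
by rewrite -expnM pnatX.
Qed.

Let opp2 (x : F) : - x = x. Proof. exact: oppr_pchar2. Qed.

Let frob_inj l : injective (fun x : F => x ^+ (q ^ l)).
Proof.
move=> x y /= xy; apply/eqP; rewrite -subr_eq0 opp2.
suff: (x + y) ^+ (q ^ l) == 0 by rewrite expf_eq0 => /andP[].
by rewrite frob xy -{1}[_ ^+ _]opp2 addNr.
Qed.

Let prod_frob (x : F) : \prod_(l <- iota 0 k) x ^+ (q ^ l) = x ^+ e.
Proof.
have -> : iota 0 k = index_iota 0 k by rewrite /index_iota subn0.
rewrite big_mkord /e; elim/big_rec2: _ => [|l m y _ ->]; first by rewrite expr0.
by rewrite exprD.
Qed.

Let phi_eq0 w : (w < Z)%N -> (phi w == 0) = (w == 0)%N.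
Proof.
move=> wZ; apply/eqP/eqP => [w0|->//].
by apply: phi_inj; rewrite ?expn_gt0 // w0.
Qed.

Let incident_norm u b : (u.1 < Z)%N -> (b.1 < Z)%N -> incident u b ->
  phi u.1 + phi b.1 != 0 /\
  (phi u.1 + phi b.1) ^+ e = (g ^+ (u.2 + b.2)) ^+ e.
Proof.
move=> uZ bZ /andP[x0 /eqP LE].
rewrite -phiD // phi_eq0 ?xr_lt //; split=> //.
by rewrite phiL ?lt0n ?x0 ?xr_lt //; apply: g_mod.
Qed.

Let incident_snd u b b' : incident u b -> incident u b' -> b.1 = b'.1 ->
  (b.2 < q1)%N -> (b'.2 < q1)%N -> b = b'.
Proof.
case: u b b' => i al [b be] [b' be'] /=; rewrite /incident /=.
move=> /andP[_ /eqP H1] /andP[_ /eqP H2] bb lb lb'; subst b'.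
move: H2; rewrite H1 => /eqP; rewrite eqn_modDl !modn_small // => /eqP ->.
by [].
Qed.

Let incident_fst u u' b : incident u b -> incident u' b -> u.1 = u'.1 ->
  (u.2 < q1)%N -> (u'.2 < q1)%N -> u = u'.
Proof.
case: u u' b => i al [i' al'] [b be] /=; rewrite /incident /=.
move=> /andP[_ /eqP H1] /andP[_ /eqP H2] bb lb lb'; subst i'.
move: H2; rewrite H1 => /eqP; rewrite eqn_modDr !modn_small // => /eqP ->.
by [].
Qed.

(** Dividing the equation of u_i by that of u_0 eliminates beta. With d_i = u_i + u_0 and x = 1/(u_0
    + b), the quotient (u_i + b)/(u_0 + b) is d_i (x + 1/d_i), so the norm of x + 1/d_i is a
    constant. Written with the conjugates of x, this is a product system with k equations. *)
Lemma incident_few (us bs : seq (nat * nat)) :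
  uniq us -> size us = k.+1 -> uniq bs ->
  {in us, forall u, (u.1 < Z)%N && (u.2 < q1)%N} ->
  {in bs, forall b, (b.1 < Z)%N && (b.2 < q1)%N} ->
  {in us & bs, forall u b, incident u b} ->
  (size bs <= k`!)%N.
Proof.
case: us => [//|u0 us] uus [sus] ubs usP bsP inc.
case: bs => [//|b0 bs] in ubs bsP inc *.
set B := b0 :: bs in ubs bsP inc *.
have B0 : b0 \in B by rewrite mem_head.
(* For a common neighbour, the first component determines the second; so the field elements are
   distinct, and with them the constants of the system. *)
have us1_inj : {in u0 :: us &, injective fst}.
  move=> u v uu vv uv; have /andP[_ u2] := usP _ uu; have /andP[_ v2] := usP _ vv.
  by apply: (incident_fst (inc _ _ uu B0) (inc _ _ vv B0)).
pose c (b : nat * nat) := phi u0.1 + phi b.1.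
pose d i := phi (nth u0 us i).1 + phi u0.1.
have u0u : u0 \in u0 :: us by rewrite mem_head.
have /andP[u0Z u02] := usP _ u0u.
have usi i : (i < k)%N -> nth u0 us i \in u0 :: us.
  by move=> ik; rewrite inE mem_nth ?orbT // sus.
have c0 b : b \in B -> c b != 0.
  move=> Bb; have /andP[bZ _] := bsP _ Bb.
  by have [] := incident_norm u0Z bZ (inc _ _ u0u Bb).
have phi_us i : (i < k)%N -> phi (nth u0 us i).1 != phi u0.1.
  move=> ik; have ui := usi _ ik; have /andP[uZ _] := usP _ ui.
  apply: contraTneq uus => /phi_inj E.
  by rewrite /= -(us1_inj _ _ ui u0u (E uZ u0Z)) mem_nth ?sus.
have d0 i : (i < k)%N -> d i != 0.
  by move=> ik; rewrite /d -[phi u0.1]opp2 subr_eq0 phi_us.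
pose xs := [seq (c b)^-1 | b <- B].
rewrite -(size_map (fun b => (c b)^-1) B).
apply: (@card_product_system F k _ (fun l x => x ^+ (q ^ l))
  (fun i l => - ((d i)^-1) ^+ (q ^ l))
  (fun i => (g ^+ (nth u0 us i).2) ^+ e / ((g ^+ u0.2) ^+ e * d i ^+ e))) => //.
- rewrite map_inj_in_uniq // => b b' Bb Bb' /invr_inj /addrI E.
  have /andP[bZ b2] := bsP _ Bb; have /andP[bZ' b2'] := bsP _ Bb'.
  by apply: (incident_snd (inc _ _ u0u Bb) (inc _ _ u0u Bb')) => //; apply: phi_inj.
- move=> l lk i j; rewrite !mem_iota !add0n /= => ik jk /oppr_inj /frob_inj.
  move=> /invr_inj /addIr E.
  have ui := usi _ ik; have uj := usi _ jk.
  have /andP[uZ _] := usP _ ui; have /andP[uZ' _] := usP _ uj.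
  have /eqP := us1_inj _ _ ui uj (phi_inj uZ uZ' E).
  by rewrite nth_uniq ?sus // => [/eqP//|]; case/andP: uus.
move=> i _ ik /mapP[b Bb ->].
under eq_bigr do rewrite opprK -frob.
rewrite prod_frob.
have ui := usi _ ik; have /andP[uZ u2] := usP _ ui; have /andP[bZ b2] := bsP _ Bb.
have [_ N1] := incident_norm uZ bZ (inc _ _ ui Bb).
have [_ N0] := incident_norm u0Z bZ (inc _ _ u0u Bb).
have g0 : g != 0.
  apply: contra_eq_neq g_order => ->.
  by rewrite expr0n eqn0Ngt -e_q1 muln_gt0 q1_gt0 /= /e -(prednK k_gt0) big_ord_recl expn0 add1n /= eq_sym oner_eq0.
have -> : (c b)^-1 + (d i)^-1 = (phi (nth u0 us i).1 + phi b.1) / (c b * d i).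
  have -> : phi (nth u0 us i).1 + phi b.1 = c b + d i.
    rewrite /c /d addrACA -{2}[phi u0.1]opp2 [_ - _]addrC; ring.
  by field; rewrite c0 ?d0.
rewrite expr_div_n exprMn N1 /c N0 !exprD !exprMn.
have ge m : (g ^+ m) ^+ e != 0 by rewrite !expf_neq0.
by field; rewrite !ge expf_neq0 ?d0.
Qed.

(** Pigeonhole over all (b, beta) with b outside [is_], coloured by the alpha_i they determine. The
    b in [is_] are excluded because some a_i + b is 0 there; the summand k in the bound on q pays
    for them. *)
Lemma incident_many (is_ : seq nat) :
  uniq is_ -> size is_ = k -> {in is_, forall i, (i < Z)%N} ->
  (k`! + k <= q1)%N ->
  exists (al : nat -> nat) (bs : seq (nat * nat)),
    [/\ forall i, (al i < q1)%N, uniq bs, size bs = (k`!).+1,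
     {in bs, forall b, (b.1 < Z)%N && (b.2 < q1)%N} &
     {in is_ & bs, forall i b, incident (i, al i) b}].
Proof.
move=> uis sis isZ kq.
pose D : finType := ('I_Z * 'I_q1)%type.
(* The logarithm of a_j + b minus beta, modulo [q1]; beta is subtracted by adding [q1] - beta. *)
pose col (x : D) : {ffun 'I_k -> 'I_q1} := [ffun j : 'I_k =>
  Ordinal (ltn_pmod (L (xr (nth 0%N is_ j) (x.1 : 'I_Z)) + (q1 - (x.2 : 'I_q1))) q1_gt0)].
pose A : {set D} := [set x : D | (x.1 : nat) \notin is_].
have cA : #|A| = ((Z - k) * q1)%N.
  have -> : A = setX [set b : 'I_Z | (b : nat) \notin is_] setT.
    by apply/setP => -[b be]; rewrite !inE andbT.
  rewrite cardsX cardsT card_ord; congr (_ * _)%N.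
  rewrite -[in RHS](card_ord Z) -(cardsC [set b : 'I_Z | (b : nat) \in is_]).
  have -> : #|[set b : 'I_Z | (b : nat) \in is_]| = k.
    rewrite -[RHS]sis cardE -(size_map val); apply: perm_size; apply: uniq_perm => //.
      by rewrite map_inj_uniq ?enum_uniq //; apply: val_inj.
    move=> i; apply/mapP/idP => [[b]|ii]; first by rewrite mem_enum inE => ? ->.
    by exists (Ordinal (isZ i ii)); rewrite ?mem_enum ?inE.
  by rewrite addKn; apply: eq_card => b; rewrite !inE.
have [c cP] : exists c, (k`! < #|[set x in A | col x == c]|)%N.
  (* After division by [q1] the claim is k + k! q1^(k-1) < q^k, which follows from (k! + k + 1)
     q1^(k-1) <= q q1^(k-1) <= q^k. *)
  apply: pigeonhole_fiber; rewrite cA card_ffun !card_ord.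
  rewrite -[X in (q1 ^ X)%N](prednK k_gt0) expnSr mulnA ltn_pmul2r // ltn_subRL expnM.
  have qE : q = q1.+1 by rewrite prednK // ltnW.
  rewrite qE -[X in (_ < _ ^ X)%N](prednK k_gt0) expnS.
  apply: (@leq_trans (q1.+1 * q1 ^ k.-1)%N).
  2: by rewrite leq_mul2l; case: (k.-1) => // j; rewrite leq_exp2r // leqnSn orbT.
  have p0 : (0 < q1 ^ k.-1)%N by rewrite expn_gt0 q1_gt0.
  apply: (@leq_trans ((k`! + k).+1 * q1 ^ k.-1)%N).
    by rewrite -[q1.+1.-1]/q1; nia.
  by rewrite leq_mul2r ltnS kq orbT.
set S := [set x in A | col x == c] in cP.
exists (fun i => nth 0%N [seq (c j : nat) | j <- enum 'I_k] (index i is_)).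
exists [seq ((x.1 : nat), (x.2 : nat)) | x : D <- take (k`!).+1 (enum S)].
have sub x : x \in take (k`!).+1 (enum S) -> x \in S.
  by move=> /mem_take; rewrite mem_enum.
split.
- move=> i; case: (ltnP (index i is_) k) => ik; last first.
    by rewrite nth_default // size_map size_enum_ord.
  by rewrite (nth_map (Ordinal ik)) ?size_enum_ord.
- rewrite map_inj_uniq ?take_uniq ?enum_uniq // => -[x1 x2] [y1 y2] /= [E1 E2].
  by congr (_, _); apply: val_inj.
- by rewrite size_map size_takel // -cardE.
- by move=> _ /mapP[x _ ->] /=; rewrite !ltn_ord.
move=> i _ ii /mapP[x /sub xS ->].
have ik : (index i is_ < k)%N by rewrite -sis index_mem.
move: xS; rewrite !inE => /andP[xi /eqP xc].
rewrite /incident /= (nth_map (Ordinal ik)) ?size_enum_ord //.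
have -> : nth (Ordinal ik) (enum 'I_k) (index i is_) = Ordinal ik.
  by apply: val_inj; rewrite /= nth_enum_ord.
rewrite -xc ffunE /= nth_index //.
have iZ := isZ _ ii; have bZ := ltn_ord x.1.
apply/andP; split.
  apply: contra xi => /eqP xr0; have := phiD iZ bZ; rewrite xr0 phi0.
  move=> /esym /eqP; rewrite addr_eq0 opp2 => /eqP /(phi_inj iZ bZ) <-.
  by [].
have := ltn_ord x.2; rewrite modnDml -addnA subnK; last exact: ltnW.
by rewrite modnDr.
Qed.

End NormIncidence.

End FieldTheory.

(** * From cliques to bicliques *)

(** As subgraphs need not be induced, the image of an injective homomorphism can carry exactly the
    edges transported from [H]. *)
Lemma subgraph_embedding (S T : finType) (G : sgraph T) (H : sgraph S) :
  has_subgraph_isomorphic_to G H <->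
  exists2 f : S -> T, injective f & forall x y, H x y -> G (f x) (f y).
Proof.
split=> [[V [K [KG [f [g fK gK] fP]]]]|[f f_inj fP]].
  exists (fun x => val (f x)) => [x y /val_inj /(can_inj fK) //|x y xy].
  by apply: KG; rewrite fP.
pose V := [set f x | x : S].
have fV x : f x \in V by apply: imset_f.
have pre (v : {x : T | x \in V}) : exists x, f x == val v.
  by case/imsetP: (valP v) => x _ ->; exists x.
pose g v := xchoose (pre v).
have gE v : f (g v) = val v by apply/eqP/(xchooseP (pre v)).
pose K : rel {x : T | x \in V} := fun v w => H (g v) (g w).
have K_sym : symmetric K by move=> v w; apply: edge_sym.
have K_irr : irreflexive K by move=> v; apply: edge_irr.
exists V, (SGraph K_sym K_irr); split=> [v w /= vw|].
  by rewrite -!gE; apply: fP.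
pose f' x : {x : T | x \in V} := Sub (f x) (fV x).
have gf x : g (f' x) = x by apply: f_inj; rewrite gE.
exists f' => [|x y]; last by rewrite /= /K !gf.
by exists g => // v; apply: val_inj; rewrite /= gE.
Qed.

Fixpoint ordered_pairs (s : seq nat) : seq (nat * nat) :=
  if s is x :: s' then [seq (x, y) | y <- s'] ++ ordered_pairs s' else [::].

Lemma size_ordered_pairs s : size (ordered_pairs s) = 'C(size s, 2).
Proof.
by elim: s => //= x s IH; rewrite size_cat size_map IH binS bin1 addnC.
Qed.

Lemma mem_ordered_pairs s u v : sorted ltn s ->
  ((u, v) \in ordered_pairs s) = [&& u \in s, v \in s & u < v].
Proof.
elim: s => //= x s IH xs; rewrite mem_cat IH ?(path_sorted xs) // !inE.
have xlt y : y \in s -> x < y by move=> ys; apply: (allP (order_path_min ltn_trans xs)).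
have -> : ((u, v) \in [seq (x, y) | y <- s]) = (u == x) && (v \in s).
  apply/mapP/andP => [[y ys [-> ->]]|[/eqP-> vs]]; first by rewrite eqxx.
  by exists v.
case: (eqVneq u x) => [->|ux] /=.
  case: (eqVneq v x) => [->|vx] /=; last by case vs: (v \in s); rewrite /= ?andbF ?(xlt v).
  by rewrite ltnn !andbF orbF; case xs': (x \in s) => //; have := xlt _ xs'; rewrite ltnn.
case us: (u \in s) => //=; case: (eqVneq v x) => [->|//] /=.
by have := xlt _ us; case: (ltngtP u x); rewrite ?andbF.
Qed.

Lemma uniq_ordered_pairs s : sorted ltn s -> uniq (ordered_pairs s).
Proof.
elim: s => //= x s IH xs; rewrite cat_uniq IH ?(path_sorted xs) // andbT.
have /andP[xNs us] : (x \notin s) && uniq s.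
  by apply: (sorted_uniq ltn_trans ltnn (s := x :: s) xs).
rewrite map_inj_uniq => [|y z []//]; rewrite us /=.
apply/hasPn => -[u v]; rewrite mem_ordered_pairs ?(path_sorted xs) //.
by case/and3P=> us' _ _; apply: contra xNs => /mapP[y _ [<- _]].
Qed.

(** * The gadget over an abstract incidence relation; [l] stands for k! *)

Section Reduction.

Variables (n k q1 NB l : nat) (G : sgraph 'I_n).
Variables (Gn inc : nat -> nat -> bool).

Let M := n * q1.
Let pad := l.+1 - 'C(k, 2).
Let Lf := M * M + pad.

(* Left vertices of the norm graph are coded as [i * q1 + alpha], pairs of them
   as [u * M + v]; the left side of the gadget consists of the codes below
   [M * M] (isolated unless they stand for an edge of G) and of [pad] vertices
   joined to all [NB] right vertices. *)
Definition pair_edge (x b : nat) : bool :=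
  let u := x %/ (n * q1) in let v := x %% (n * q1) in
  [&& u %/ q1 < v %/ q1, Gn (u %/ q1) (v %/ q1), inc u b & inc v b].

Definition gadget_adj (x y : nat) : bool :=
  let a := minn x y in let b := maxn x y in
  [&& a < Lf, Lf <= b & (a < M * M) ==> pair_edge a (b - Lf)].

Definition gadget_rel : rel 'I_(Lf + NB) := fun x y => gadget_adj x y.

Lemma gadget_sym : symmetric gadget_rel.
Proof. by move=> x y; rewrite /gadget_rel /gadget_adj minnC maxnC. Qed.

Lemma gadget_irr : irreflexive gadget_rel.
Proof.
move=> x; rewrite /gadget_rel /gadget_adj minnn maxnn.
by case: ltnP.
Qed.

Definition gadget : sgraph 'I_(Lf + NB) := SGraph gadget_sym gadget_irr.

Hypotheses (n_gt0 : 0 < n) (k_gt0 : 0 < k) (q1_gt0 : 0 < q1).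
Hypothesis bin_le : 'C(k, 2) <= l.+1.
Hypothesis GnE : forall i j : 'I_n, Gn i j = G i j.
Hypothesis few : forall us bs : seq nat,
  uniq us -> size us = k.+1 -> {in us, forall u, u < M} ->
  uniq bs -> {in bs, forall b, b < NB} ->
  {in us & bs, forall u b, inc u b} -> size bs <= l.
Hypothesis many : forall is_ : seq nat,
  uniq is_ -> size is_ = k -> {in is_, forall i, i < n} ->
  exists (al : nat -> nat) (bs : seq nat),
  [/\ forall i, al i < q1, uniq bs, size bs = l.+1, {in bs, forall b, b < NB} &
      {in is_ & bs, forall i b, inc (i * q1 + al i) b}].

Let M_gt0 : 0 < M. Proof. by rewrite muln_gt0 n_gt0. Qed.

Lemma gadget_adjE x b : x < Lf -> gadget_adj x (Lf + b) = ((x < M * M) ==> pair_edge x b).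
Proof.
move=> xL; have xb : x <= Lf + b by lia.
by rewrite /gadget_adj (minn_idPl xb) (maxn_idPr xb) xL leq_addr addKn.
Qed.

(** With the [al] supplied by [many], each clique vertex becomes one norm graph vertex. Their C(k,2)
    pairs and the [pad] universal vertices make up the [l.+1] vertices on the left, and [bs] is the
    right side. *)
Lemma gadget_complete :
  has_subgraph_isomorphic_to G (clique k) ->
  has_subgraph_isomorphic_to gadget (biclique l.+1 l.+1).
Proof.
case/subgraph_embedding => f f_inj fG; apply/subgraph_embedding.
pose is_ := sort leq [seq val (f i) | i <- enum 'I_k].
have uis : uniq is_.
  rewrite sort_uniq map_inj_uniq ?enum_uniq // => i j /val_inj; exact: f_inj.
have sis : size is_ = k by rewrite size_sort size_map size_enum_ord.
have isP i : i \in is_ -> exists j, i = f j.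
  by rewrite mem_sort => /mapP[j _ ->]; exists j.
have isn : {in is_, forall i, i < n} by move=> i /isP[j ->].
have iss : sorted ltn is_ by rewrite ltn_sorted_uniq_leq uis sort_sorted //; exact: leq_total.
have [al [bs [al_lt ubs sbs bsN incP]]] := many uis sis isn.
pose code i := i * q1 + al i.
have codeK i : code i %/ q1 = i by rewrite divnMDl // divn_small ?addn0.
have codeM i : i \in is_ -> code i < M.
  by move=> /isn ii; rewrite -ltn_divLR // codeK.
pose pc (p : nat * nat) := code p.1 * M + code p.2.
pose X := [seq pc p | p <- ordered_pairs is_] ++ iota (M * M) pad.
have pcM p : p \in ordered_pairs is_ -> pc p < M * M.
  case: p => i j; rewrite mem_ordered_pairs // => /and3P[/codeM iM /codeM jM _].
  by rewrite /pc /=; nia.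
have sX : size X = l.+1.
  by rewrite size_cat size_map size_ordered_pairs sis size_iota subnKC.
have uX : uniq X.
  rewrite cat_uniq iota_uniq andbT; apply/andP; split.
    rewrite map_inj_in_uniq ?uniq_ordered_pairs //.
    move=> [i j] [i' j']; rewrite !mem_ordered_pairs //.
    move=> /and3P[/codeM iM /codeM jM _] /and3P[/codeM iM' /codeM jM' _].
    rewrite /pc /= => E.
    have E1 := congr1 (divn^~ M) E; have E2 := congr1 (modn^~ M) E.
    move: E1 E2; rewrite !divnMDl // !modnMDl !divn_small // !modn_small // !addn0.
    move=> /(congr1 (divn^~ q1)) + /(congr1 (divn^~ q1)).
    by rewrite !codeK => -> ->.
  apply/hasPn => x; rewrite mem_iota => /andP[Mx _].
  by apply/mapP => -[p /pcM pM xE]; rewrite xE leqNgt pM in Mx.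
have XL x : x \in X -> x < Lf.
  rewrite mem_cat mem_iota => /orP[/mapP[p /pcM pM ->]|/andP[]//].
  by apply: leq_trans pM _; rewrite leq_addr.
have adjP x b : x \in X -> b \in bs -> gadget_adj x (Lf + b).
  move=> xX bb; rewrite gadget_adjE ?XL //; apply/implyP => xM.
  move: xX; rewrite mem_cat mem_iota leqNgt xM orbF => /mapP[[i j]].
  rewrite mem_ordered_pairs // => /and3P[ii jj ij] xE.
  have [iM jM] := (codeM i ii, codeM j jj).
  rewrite /pair_edge -/M xE /pc /= divnMDl // modnMDl (divn_small jM) (modn_small jM).
  rewrite addn0 !codeK ij !incP // ?andbT /=.
  have [i0 iE] := isP i ii; have [j0 jE] := isP j jj.
  rewrite iE jE GnE; apply: fG; rewrite /= /clique_rel.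
  by apply: contraTneq ij => ij; rewrite iE jE ij ltnn.
have Ls i : nth 0 X i < Lf + NB.
  case: (ltnP i (size X)) => iX; last by rewrite nth_default // addn_gt0 /Lf addn_gt0 muln_gt0 M_gt0.
  by apply: ltn_addr; apply: XL; apply: mem_nth.
have Rs (j : 'I_l.+1) : Lf + nth 0 bs j < Lf + NB.
  by rewrite ltn_add2l bsN // mem_nth // sbs.
exists (fun v : 'I_l.+1 + 'I_l.+1 => match v with
  | inl i => Ordinal (Ls i) | inr j => Ordinal (Rs j) end).
  have XX (i : 'I_l.+1) : nth 0 X i < Lf by rewrite XL // mem_nth // sX.
  case=> [i|i] [j|j] /(congr1 val) /=.
  - by move=> /eqP; rewrite nth_uniq ?sX // => /eqP /val_inj ->.
  - by move=> E; have := XX i; rewrite E ltnNge leq_addr.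
  - by move=> E; have := XX j; rewrite -E ltnNge leq_addr.
  - by move=> /eqP; rewrite eqn_add2l nth_uniq ?sbs // => /eqP /val_inj ->.
case=> [i|i] [j|j] //= _; rewrite /gadget_rel /=.
  by apply: adjP; apply: mem_nth; rewrite ?sX ?sbs.
rewrite /gadget_adj minnC maxnC.
by apply: adjP; apply: mem_nth; rewrite ?sX ?sbs.
Qed.

(** At least C(k,2) left vertices of the biclique are genuine pairs, since only [pad] are not. The
    norm graph vertices in these pairs share [l.+1] neighbours, so by [few] there are at most [k] of
    them. Then C(k,2) distinct pairs force exactly [k], with every pair present; as the first
    components of a pair are strictly ordered and adjacent in [G], they form a clique. *)
Lemma gadget_sound :
  has_subgraph_isomorphic_to gadget (biclique l.+1 l.+1) ->
  has_subgraph_isomorphic_to G (clique k).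
Proof.
case/subgraph_embedding => f f_inj fG; apply/subgraph_embedding.
(* For [k] = 1 there need not be any pair to read a vertex from, but any vertex of [G] will do. *)
have [k1|k1] := leqP k 1.
  exists (fun=> Ordinal n_gt0) => [i j _|i j].
    by apply: val_inj; have := ltn_ord i; have := ltn_ord j => /=; lia.
  rewrite /= /clique_rel => /eqP[]; apply: val_inj.
  by have := ltn_ord i; have := ltn_ord j => /=; lia.
have gadP (x y : 'I_(Lf + NB)) : gadget x y -> x < Lf <= y \/ y < Lf <= x.
  by rewrite /= /gadget_rel /gadget_adj; case: (leqP x y) => xy /and3P[]; lia.
have lt3 (x y z : nat) : x < Lf <= z \/ z < Lf <= x -> y < Lf <= z \/ z < Lf <= y ->
  y < Lf -> x < Lf by lia.
have lt2 (x y : nat) : x < Lf <= y \/ y < Lf <= x -> Lf <= x -> y < Lf by lia.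
have ge2 (x y : nat) : x < Lf <= y \/ y < Lf <= x -> x < Lf -> Lf <= y by lia.
(* All edges cross [Lf], so one side of the biclique lies below it; the sides are exchanged if it is
   the second. *)
have {f f_inj fG} [fl [fr [fl_inj fr_inj flr fl_lt]]] : exists fl fr : 'I_l.+1 -> 'I_(Lf + NB),
    [/\ injective fl, injective fr, forall i j, gadget (fl i) (fr j) &
        forall i, fl i < Lf].
  have [f0|f0] := ltnP (f (inl ord0)) Lf.
    exists (f \o inl), (f \o inr); split=> [i j /f_inj[]//|i j /f_inj[]//|i j|i].
      exact: fG.
    apply: (lt3 _ _ _ _ _ f0); first exact: gadP (fG (inl i) (inr ord0) isT).
    exact: gadP (fG (inl ord0) (inr ord0) isT).
  exists (f \o inr), (f \o inl); split=> [i j /f_inj[]//|i j /f_inj[]//|i j|i].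
    exact: fG.
  exact: lt2 (gadP _ _ (fG (inl ord0) (inr i) isT)) f0.
have fr_ge j : Lf <= fr j.
  exact: ge2 (gadP _ _ (flr ord0 j)) (fl_lt ord0).
pose X := [seq (fl i : nat) | i <- enum 'I_l.+1].
pose bs := [seq fr j - Lf | j <- enum 'I_l.+1].
have uX : uniq X by rewrite map_inj_uniq ?enum_uniq // => i j /val_inj /fl_inj.
have ubs : uniq bs.
  rewrite map_inj_uniq ?enum_uniq // => i j E; apply/fr_inj/val_inj => /=.
  by rewrite -(subnK (fr_ge i)) -(subnK (fr_ge j)) E.
have sX : size X = l.+1 by rewrite size_map size_enum_ord.
have sbs : size bs = l.+1 by rewrite size_map size_enum_ord.
have bsN : {in bs, forall b, b < NB}.
  by move=> _ /mapP[j _ ->]; rewrite ltn_subLR.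
have Xbs : {in X & bs, forall x b, (x < M * M) ==> pair_edge x b}.
  move=> _ _ /mapP[i _ ->] /mapP[j _ ->]; rewrite -gadget_adjE ?fl_lt //.
  by rewrite subnKC //; apply: flr.
pose X' := [seq x <- X | x < M * M].
have uX' : uniq X' by apply: filter_uniq.
have sX' : 'C(k, 2) <= size X'.
  set Y := [seq x <- X | ~~ (x < M * M)].
  have sY : size Y <= pad.
    rewrite -(size_iota (M * M) pad); apply: uniq_leq_size; first exact: filter_uniq.
    move=> x; rewrite mem_filter mem_iota -leqNgt => /andP[-> /mapP[i _ ->]].
    exact: fl_lt.
  have E : size X' + size Y = l.+1 by rewrite -sX !size_filter count_predC.
  rewrite -(leq_add2r (size Y)) E; apply: (@leq_trans ('C(k, 2) + pad)).
    by rewrite leq_add2l.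
  by rewrite subnKC.
have b0 : nth 0 bs 0 \in bs by rewrite mem_nth // sbs.
have X'P x : x \in X' ->
    [/\ x %/ M < M, x %% M < M, x %/ M < x %% M &
      (x %/ M) %/ q1 < (x %% M) %/ q1 /\ Gn ((x %/ M) %/ q1) ((x %% M) %/ q1)].
  rewrite mem_filter => /andP[xM xX].
  have := Xbs _ _ xX b0; rewrite xM /= /pair_edge -/M => /and4P[lt_q Gx _ _].
  split=> //; rewrite ?ltn_mod //; first by rewrite ltn_divLR.
  by rewrite ltnNge; apply: contraL lt_q => le; rewrite -leqNgt leq_div2r.
have incX x b : x \in X' -> b \in bs -> inc (x %/ M) b /\ inc (x %% M) b.
  rewrite mem_filter => /andP[xM xX] bb.
  by have := Xbs _ _ xX bb; rewrite xM /= /pair_edge -/M => /and4P[_ _ -> ->].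
pose U := sort leq (undup ([seq x %/ M | x <- X'] ++ [seq x %% M | x <- X'])).
have uU : uniq U by rewrite sort_uniq undup_uniq.
have sU : sorted ltn U.
  by rewrite ltn_sorted_uniq_leq uU sort_sorted //; exact: leq_total.
have UP u : u \in U -> u < M /\ {in bs, forall b, inc u b}.
  rewrite mem_sort mem_undup mem_cat => /orP[] /mapP[x xX' ->].
    by have [] := X'P x xX'; split=> // b bb; have [] := incX x b xX' bb.
  by have [] := X'P x xX'; split=> // b bb; have [] := incX x b xX' bb.
have size_U : size U <= k.
  rewrite leqNgt; apply/negP => kU.
  suff H : size bs <= l by rewrite sbs ltnn in H.
  apply: (few (us := take k.+1 U)); rewrite ?take_uniq ?size_takel //.
    by move=> u /mem_take /UP[].
  by move=> u b /mem_take /UP[_ H]; apply: H.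
pose pr x := (x %/ M, x %% M).
have pr_sub : {subset [seq pr x | x <- X'] <= ordered_pairs U}.
  move=> _ /mapP[x xX' ->]; have [_ _ lt_x _] := X'P x xX'.
  rewrite mem_ordered_pairs // lt_x andbT.
  rewrite !mem_sort !mem_undup !mem_cat; apply/andP; split.
    by rewrite (map_f (fun x => x %/ M)).
  by rewrite (map_f (fun x => x %% M) xX') orbT.
have upr : uniq [seq pr x | x <- X'].
  rewrite map_inj_uniq // => x y [E1 E2].
  by rewrite (divn_eq x M) (divn_eq y M) E1 E2.
have sUk : size U = k.
  apply/eqP; rewrite eqn_leq size_U /= leqNgt; apply/negP => ltk.
  have := uniq_leq_size upr pr_sub; rewrite size_map size_ordered_pairs.
  apply/negP; rewrite -ltnNge; apply: leq_trans sX'.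
  rewrite -[X in _ < 'C(X, 2)](ltn_predK k1) binS bin1 -addn1 leq_add //.
    by rewrite leq_bin2l // -ltnS (ltn_predK k1).
  by rewrite -ltnS (ltn_predK k1).
have le_pr : size (ordered_pairs U) <= size [seq pr x | x <- X'].
  by rewrite size_ordered_pairs sUk size_map.
have [_ pr_eq] := uniq_min_size upr pr_sub le_pr.
have UG u v : u \in U -> v \in U -> u < v -> u %/ q1 < v %/ q1 /\ Gn (u %/ q1) (v %/ q1).
  move=> uU' vU' uv; have : (u, v) \in ordered_pairs U by rewrite mem_ordered_pairs // uU' vU'.
  by rewrite -pr_eq => /mapP[x /X'P[_ _ _ H] [-> ->]].
have g_lt (i : 'I_k) : nth 0 U i %/ q1 < n.
  rewrite ltn_divLR //; have [] // := UP (nth 0 U i) _.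
  by rewrite mem_nth // sUk.
have UG' (i j : 'I_k) : i < j -> nth 0 U i %/ q1 < nth 0 U j %/ q1 /\
   Gn (nth 0 U i %/ q1) (nth 0 U j %/ q1).
  move=> ij; apply: UG; rewrite ?mem_nth ?sUk //.
  by rewrite (sorted_ltn_nth ltn_trans 0 sU) ?inE ?sUk.
exists (fun i => Ordinal (g_lt i)) => [i j /(congr1 val) /= E|i j].
  apply: val_inj; case: (ltngtP i j) => // ij.
    by have [+ _] := UG' i j ij; rewrite E ltnn.
  by have [+ _] := UG' j i ij; rewrite E ltnn.
rewrite /= /clique_rel => ij.
case: (ltngtP i j) => [lt_ij|lt_ji|/val_inj eq_ij]; last by rewrite eq_ij eqxx in ij.
  by rewrite -GnE /=; have [] := UG' i j lt_ij.
by rewrite edge_sym -GnE /=; have [] := UG' j i lt_ji.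
Qed.

End Reduction.

(** * A loop language on the word RAM *)

(* Variables live in the cells below [tmp_lo], except cell 2, which stays 0;
   expressions are evaluated in the cells from [tmp_lo] to [heap_lo].  At the
   start these cells hold the beginning of row 0 of the matrix: its diagonal
   entry, in cell 2, is 0, and the others can be overwritten because column 0
   holds the same values. *)
Definition tmp_lo : nat := 44.
Definition heap_lo : nat := 60.

Inductive expr :=
  | Var (r : nat)
  | Lit (v : nat)
  | Bin (o : binop) (e1 e2 : expr)
  | Get (e : expr).

Inductive com :=
  | Asn (x : nat) (e : expr)
  | Put (e1 e2 : expr)
  | Seq (c1 c2 : com)
  | When (e : expr) (c : com)
  | Loop (x l : nat) (c : com).

Definition For x l c := Seq (Asn x (Lit 0)) (Loop x l c).

Definition upd (M : memory) (d v : nat) : memory := [eta M with d |-> v].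

Fixpoint ev (e : expr) (M : memory) : nat :=
  match e with
  | Var r => M r
  | Lit v => v
  | Bin o e1 e2 => eval_binop o (ev e1 M) (ev e2 M)
  | Get e => M (ev e M)
  end.

Fixpoint esize (e : expr) : nat :=
  match e with
  | Var _ | Lit _ => 1
  | Bin _ e1 e2 => esize e1 + esize e2 + 1
  | Get e => esize e + 1
  end.

(** A stack of temporaries: the value goes to cell [d], and only cells from [d] on are written.
    Adding cell 2, which holds 0, copies a cell. *)
Fixpoint ecode (e : expr) (d : nat) : program :=
  match e with
  | Var r => [:: Arith OpAdd d r 2]
  | Lit v => [:: Const d v]
  | Bin o e1 e2 => ecode e1 d ++ ecode e2 d.+1 ++ [:: Arith o d d d.+1]
  | Get e => ecode e d ++ [:: ReadAt d d]
  end.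

Fixpoint csize (c : com) : nat :=
  match c with
  | Asn _ e => esize e + 1
  | Put e1 e2 => esize e1 + esize e2 + 1
  | Seq c1 c2 => csize c1 + csize c2
  | When e c => esize e + 1 + csize c
  | Loop _ _ c => 2 + csize c + 3
  end.

(** Jump targets are absolute, hence the load address [o]. [JumpZ 2] always jumps; the loop test is
    the truncated difference of bound and counter. *)
Fixpoint ccode (c : com) (o : nat) : program :=
  match c with
  | Asn x e => ecode e tmp_lo ++ [:: Arith OpAdd x tmp_lo 2]
  | Put e1 e2 =>
      ecode e1 tmp_lo ++ ecode e2 tmp_lo.+1 ++ [:: WriteAt tmp_lo tmp_lo.+1]
  | Seq c1 c2 => ccode c1 o ++ ccode c2 (o + csize c1)
  | When e c =>
      ecode e tmp_lo ++ [:: JumpZ tmp_lo (o + esize e + 1 + csize c)]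
        ++ ccode c (o + esize e + 1)
  | Loop x l c =>
      [:: Arith OpSub tmp_lo l x; JumpZ tmp_lo (o + (2 + csize c + 3))]
        ++ ccode c (o + 2)
        ++ [:: Const tmp_lo 1; Arith OpAdd x x tmp_lo; JumpZ 2 o]
  end.

Fixpoint ewf (e : expr) (d : nat) : bool :=
  match e with
  | Var r => (r < tmp_lo) && (d < heap_lo)
  | Lit _ => d < heap_lo
  | Bin _ e1 e2 => ewf e1 d && ewf e2 d.+1
  | Get e => ewf e d
  end.

Definition writable (x : nat) : bool := (x < tmp_lo) && (x != 2).

Fixpoint mods (c : com) : seq nat :=
  match c with
  | Asn x _ => [:: x]
  | Put _ _ => [::]
  | Seq c1 c2 => mods c1 ++ mods c2
  | When _ c => mods c
  | Loop x _ c => x :: mods c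
  end.

(** A loop body may change neither its counter nor its bound, so the bound limits the number of
    rounds. *)
Fixpoint cwf (c : com) : bool :=
  match c with
  | Asn x e => writable x && ewf e tmp_lo
  | Put e1 e2 => ewf e1 tmp_lo && ewf e2 tmp_lo.+1
  | Seq c1 c2 => cwf c1 && cwf c2
  | When e c => ewf e tmp_lo && cwf c
  | Loop x l c => [&& writable x, l < tmp_lo, x != l, x \notin mods c,
                      l \notin mods c & cwf c]
  end.

Fixpoint no_put (c : com) : bool :=
  match c with
  | Asn _ _ => true
  | Put _ _ => false
  | Seq c1 c2 => no_put c1 && no_put c2
  | When _ c => no_put c
  | Loop _ _ c => no_put c
  end.

(** [lim l] is an a priori bound on variable [l] when it bounds a loop. A round costs 2 instructions
    for the test and 3 for the increment and the jump back; the last test costs 2. *)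
Fixpoint ctime (lim : nat -> nat) (c : com) : nat :=
  match c with
  | Asn _ e => esize e + 1
  | Put e1 e2 => esize e1 + esize e2 + 1
  | Seq c1 c2 => ctime lim c1 + ctime lim c2
  | When e c => esize e + 1 + ctime lim c
  | Loop _ l c => (ctime lim c + 5) * lim l + 2
  end.

Lemma size_ecode e d : size (ecode e d) = esize e.
Proof.
elim: e d => //= [o e1 IH1 e2 IH2|e IH] d; rewrite !size_cat.
  by rewrite IH1 IH2 /= addnA.
by rewrite IH.
Qed.

Lemma size_ccode c o : size (ccode c o) = csize c.
Proof.
elim: c o => //= [x e|e1 e2|c1 IH1 c2 IH2|e c IH|x l c IH] o;
  rewrite ?size_cat /= ?size_cat ?size_ecode ?IH ?IH1 ?IH2 //=; lia.
Qed.

(** * Timed semantics of the loop language and its simulation by the machine *)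

Section Semantics.

Variables (w : nat) (lim : nat -> nat).
Let B := 2 ^ w.

(** Excludes what could separate this semantics from the machine: overflow and reads of temporary
    cells. The other operations never exceed their first operand. *)
Fixpoint esafe (e : expr) (M : memory) : Prop :=
  match e with
  | Var _ => True
  | Lit v => v < B
  | Bin o e1 e2 => [/\ esafe e1 M, esafe e2 M &
      match o with
      | OpAdd | OpMul => eval_binop o (ev e1 M) (ev e2 M) < B
      | _ => True
      end]
  | Get e => esafe e M /\ heap_lo <= ev e M
  end.

Inductive bigstep : com -> memory -> nat -> memory -> Prop :=
  | BAsn x e M : esafe e M ->
      bigstep (Asn x e) M (esize e + 1) (upd M x (ev e M))
  | BPut e1 e2 M : esafe e1 M -> esafe e2 M -> heap_lo <= ev e1 M ->
      bigstep (Put e1 e2) M (esize e1 + esize e2 + 1)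
        (upd M (ev e1 M) (ev e2 M))
  | BSeq c1 c2 M M1 M2 t1 t2 : bigstep c1 M t1 M1 -> bigstep c2 M1 t2 M2 ->
      bigstep (Seq c1 c2) M (t1 + t2) M2
  | BWhenT e c M t M' : esafe e M -> ev e M != 0 -> bigstep c M t M' ->
      bigstep (When e c) M (esize e + 1 + t) M'
  | BWhenF e c M : esafe e M -> ev e M = 0 ->
      bigstep (When e c) M (esize e + 1) M
  | BLoopE x l c M : M l <= M x -> bigstep (Loop x l c) M 2 M
  | BLoopS x l c M M1 M2 t1 t2 : M x < M l -> M l <= lim l -> 1 < B ->
      bigstep c M t1 M1 ->
      bigstep (Loop x l c) (upd M1 x (M1 x).+1) t2 M2 ->
      bigstep (Loop x l c) M (2 + t1 + 3 + t2) M2.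

Lemma updE M d v a : upd M d v a = if a == d then v else M a.
Proof. by []. Qed.

Lemma bigstep_frame c M t M' : bigstep c M t M' -> forall a, a < heap_lo ->
  a \notin mods c -> M' a = M a.
Proof.
elim=> {c M t M'} //=.
- by move=> x e M _ a _; rewrite inE updE => /negbTE->.
- move=> e1 e2 M _ _ e1_heap a a_lo _; rewrite updE.
  by case: eqP => // ae; rewrite -ae leqNgt a_lo in e1_heap.
- move=> c1 c2 M M1 M2 _ _ _ IH1 _ IH2 a a_lo; rewrite mem_cat negb_or.
  by case/andP=> n1 n2; rewrite IH2 // IH1.
- move=> x l c M M1 M2 _ _ _ _ _ _ IH1 _ IH2 a a_lo a_n.
  rewrite IH2 // updE; move: a_n; rewrite inE negb_or => /andP[/negbTE-> a_n].
  exact: IH1.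
Qed.

Lemma bigstep_no_put c M t M' : bigstep c M t M' -> cwf c -> no_put c ->
  forall a, heap_lo <= a -> M' a = M a.
Proof.
have xE x a : writable x -> heap_lo <= a -> a == x = false.
  by rewrite /writable /tmp_lo /heap_lo => /andP[? _] ?; apply/eqP; lia.
elim=> {c M t M'} //=.
- by move=> x e M _ /andP[wx _] _ a a_hi; rewrite updE xE.
- move=> c1 c2 M M1 M2 _ _ _ IH1 _ IH2 /andP[w1 w2] /andP[n1 n2] a a_hi.
  by rewrite IH2 // IH1.
- by move=> e c M t M' _ _ _ IH /andP[_ wc] nc; apply: IH.
- move=> x l c M M1 M2 _ _ _ _ _ _ IH1 _ IH2 wl nc a a_hi.
  rewrite IH2 // updE; case/and5P: wl => wx _ _ _ /andP[_ wc]; rewrite xE //.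
  exact: IH1.
Qed.

(** A loop is charged only for the rounds that remain, so that the induction survives re-entering it
    with a larger counter. *)
Lemma bigstep_time c M t M' : bigstep c M t M' -> cwf c ->
  t <= match c with
       | Loop x l c' => (ctime lim c' + 5) * (lim l - M x) + 2
       | _ => ctime lim c
       end.
Proof.
have le_time c' M0 t0 : t0 <= match c' with
       | Loop x l c' => (ctime lim c' + 5) * (lim l - M0 x) + 2
       | _ => ctime lim c' end -> t0 <= ctime lim c'.
  case: c' => //= x l c' H; apply: leq_trans H _.
  by rewrite leq_add2r leq_mul2l leq_subr orbT.
elim=> {c M t M'} //=.
- move=> c1 c2 M M1 M2 t1 t2 _ IH1 _ IH2 /andP[w1 w2].
  by apply: leq_add; [apply: le_time (IH1 w1)|apply: le_time (IH2 w2)].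
- move=> e c M t M' _ _ _ IH /andP[_ wc].
  by rewrite leq_add2l; apply: le_time (IH wc).
- by move=> e c M _ _ _; rewrite leq_addr.
- by move=> x l c M *; rewrite leq_addl.
move=> x l c M M1 M2 t1 t2 xl l_lim _ H1 IH1 _ IH2 wl.
have := IH2 wl; case/and5P: (wl) => wx ll xNl xc /andP[lc wc].
have t1_le := le_time _ _ _ (IH1 wc).
have x_lo : x < heap_lo by case/andP: wx => x_lo _; apply: leq_trans x_lo _.
rewrite updE eqxx (bigstep_frame H1 x_lo xc) => t2_le.
have -> : lim l - M x = (lim l - (M x).+1).+1.
  by rewrite -subSn ?subSS // (leq_trans xl).
rewrite mulnS; lia.
Qed.

Lemma bigstep_ctime c M t M' : bigstep c M t M' -> cwf c -> t <= ctime lim c.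
Proof.
move=> H /(bigstep_time H); case: c H => //= x l c _ H; apply: leq_trans H _.
by rewrite leq_add2r leq_mul2l leq_subr orbT.
Qed.


Definition located (P : program) (o : nat) (s : program) : Prop :=
  forall i, i < size s -> onth P (o + i) = onth s i.

Lemma located_cat P o s1 s2 :
  located P o (s1 ++ s2) -> located P o s1 /\ located P (o + size s1) s2.
Proof.
move=> H; split=> i i_lt.
  rewrite H ?size_cat ?ltn_addr //.
  by rewrite !onthE map_cat nth_cat size_map i_lt.
rewrite -addnA H ?size_cat ?ltn_add2l //.
by rewrite !onthE map_cat nth_cat size_map ltnNge leq_addr addKn.
Qed.

Lemma located_head P o i s :
  located P o (i :: s) -> onth P o = Some i /\ located P o.+1 s.
Proof.
move=> H; split; first by have := H 0 isT; rewrite addn0.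
by move=> j js; rewrite addSnnS; apply: H.
Qed.

(* The machine may hold anything in the temporary cells. *)
Definition agrees (m M : memory) : Prop :=
  [/\ forall a, ~~ (tmp_lo <= a < heap_lo) -> m a = M a,
      forall a, m a < B & M 2 = 0].

Lemma step_at P o m i : onth P o = Some i ->
  step w P (Config o m) = exec w i (Config o m).
Proof. by rewrite /step /= => ->. Qed.

Lemma agrees_tmp m M d v : agrees m M -> tmp_lo <= d < heap_lo -> v < B ->
  agrees (upd m d v) M.
Proof.
case=> mM mB M2 d_tmp vB; split=> // a; rewrite updE; case: (a =P d) => // [->|_ a_tmp].
  by rewrite d_tmp.
exact: mM.
Qed.

Lemma agrees_upd m M d v : agrees m M -> ~~ (tmp_lo <= d < heap_lo) -> d != 2 ->
  v < B -> agrees (upd m d v) (upd M d v).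
Proof.
case=> mM mB M2 d_tmp d2 vB; split=> [a a_tmp|a|]; rewrite !updE.
- by rewrite mM.
- by case: (a =P d).
by rewrite eq_sym (negbTE d2).
Qed.

Lemma eval_binop_lt o x y : x < B ->
  match o with OpAdd | OpMul => is_true (eval_binop o x y < B) | _ => True end ->
  eval_binop o x y < B.
Proof.
case: o => //= xB _.
- exact: leq_ltn_trans (leq_subr _ _) xB.
- exact: leq_ltn_trans (leq_div _ _) xB.
- exact: leq_ltn_trans (leq_mod _ _) xB.
Qed.

Lemma ecode_correct P e d o m M : agrees m M -> ewf e d -> tmp_lo <= d ->
  esafe e M -> located P o (ecode e d) ->
  exists m', [/\ iter (esize e) (step w P) (Config o m) = Config (o + esize e) m',
    agrees m' M, m' d = ev e M & forall a, a < d -> m' a = m a].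
Proof.
elim: e d o m => [r|v|op e1 IH1 e2 IH2|e IH] d o m agr /= wf d_lo safe loc.
- have [loc1 _] := located_head loc; case/andP: wf => r_lo d_hi.
  have [mM mB M2] := agr.
  have rM : m r = M r by apply: mM; rewrite negb_and -ltnNge r_lo.
  have m2 : m 2 = 0 by rewrite mM.
  exists (upd m d (M r)); split.
  + by rewrite (step_at _ loc1) /exec /= rM m2 addn0 modn_small ?addn1 // -rM.
  + by apply: agrees_tmp; rewrite ?d_lo // -rM.
  + by rewrite updE eqxx.
  by move=> a a_lt; rewrite updE ltn_eqF.
- have [loc1 _] := located_head loc.
  exists (upd m d v); split.
  + by rewrite (step_at _ loc1) /exec /= modn_small ?addn1.
  + by apply: agrees_tmp; rewrite ?d_lo.
  + by rewrite updE eqxx.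
  by move=> a a_lt; rewrite updE ltn_eqF.
- have [loc1 loc'] := located_cat loc.
  have [loc2 loc3] := located_cat loc'; case/andP: wf => wf1 wf2.
  have [s1 s2 s3] := safe.
  have [m1 [it1 agr1 v1 fr1]] := IH1 d o m agr wf1 d_lo s1 loc1.
  rewrite size_ecode in loc2 loc3.
  have [m2 [it2 agr2 v2 fr2]] := IH2 d.+1 _ m1 agr1 wf2 (leqW d_lo) s2 loc2.
  rewrite size_ecode in loc3.
  have [i3 _] := located_head loc3.
  have d_hi : d.+1 < heap_lo.
    by clear -wf2; elim: e2 d wf2 => //= [r|o' e1 IH1 e2 IH2] d /andP[_ H] //; last exact: ltnW (IH2 _ H).
  have md : m2 d = ev e1 M by rewrite fr2 ?v1.
  have resB : eval_binop op (ev e1 M) (ev e2 M) < B.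
    have [_ mB1 _] := agr1; apply: eval_binop_lt => //; first by rewrite -v1.
  exists (upd m2 d (eval_binop op (ev e1 M) (ev e2 M))); split.
  + rewrite addn1 iterS addnC iterD it1 it2 (step_at _ i3) /exec /= md v2.
    by rewrite modn_small //; congr Config; lia.
  + by apply: agrees_tmp; rewrite ?d_lo //= ltnW.
  + by rewrite updE eqxx.
  by move=> a a_lt; rewrite updE ltn_eqF // fr2 ?fr1 // ltnW.
have [loc1 loc2] := located_cat loc; case: safe => s1 s2.
have [m1 [it1 agr1 v1 fr1]] := IH d o m agr wf d_lo s1 loc1.
rewrite size_ecode in loc2; have [i2 _] := located_head loc2.
have [mM mB M2] := agr1.
have d_hi : d < heap_lo.
  clear -wf; elim: e d wf => //= [r|o' e1 IH1 e2 IH2] d /andP[] //.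
  by move=> H _; apply: IH1.
have rd : m1 (ev e M) = M (ev e M) by apply: mM; rewrite negb_and -leqNgt s2 orbT.
exists (upd m1 d (M (ev e M))); split.
+ rewrite addn1 iterS it1 (step_at _ i2) /exec /= v1 rd modn_small ?addnS //.
  by rewrite -rd.
+ by apply: agrees_tmp; rewrite ?d_lo // -rd.
+ by rewrite updE eqxx.
by move=> a a_lt; rewrite updE ltn_eqF // fr1.
Qed.

Lemma ev_lt e M m : agrees m M -> ewf e tmp_lo -> esafe e M -> ev e M < B.
Proof.
move=> [mM mB _]; elim: e tmp_lo => [r|v|op e1 IH1 e2 IH2|e IH] d //=.
- case/andP=> r_lo _ _; rewrite -mM ?mB // negb_and -ltnNge r_lo //.
- by case/andP=> w1 w2 [s1 s2 s3]; apply: eval_binop_lt (IH1 _ w1 s1) s3.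
by move=> _ [_ s2]; rewrite -mM ?mB // negb_and -leqNgt s2 orbT.
Qed.

Lemma ccode_correct P c M t M' : bigstep c M t M' -> cwf c ->
  forall o m, agrees m M -> located P o (ccode c o) ->
  exists m', iter t (step w P) (Config o m) = Config (o + csize c) m' /\ agrees m' M'.
Proof.
elim=> {c M t M'} /=.
- move=> x e M safe /andP[/andP[x_lo x2] we] o m agr loc.
  have [loc1 loc2] := located_cat loc.
  rewrite size_ecode in loc2; have [i2 _] := located_head loc2.
  have [m1 [it1 agr1 v1 fr1]] := ecode_correct agr we (leqnn _) safe loc1.
  have vB := ev_lt agr we safe.
  have [mM mB M2] := agr1; have m12 : m1 2 = 0 by rewrite mM.
  exists (upd m1 x (ev e M)); split.
    rewrite addn1 iterS it1 (step_at _ i2) /exec /= v1 m12 addn0 modn_small //.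
    by rewrite addnS.
  by apply: agrees_upd => //; rewrite negb_and -ltnNge x_lo.
- move=> e1 e2 M s1 s2 heap_e1 /andP[w1 w2] o m agr loc.
  have [loc1 loc'] := located_cat loc; rewrite size_ecode in loc'.
  have [loc2 loc3] := located_cat loc'; rewrite size_ecode in loc3.
  have [i3 _] := located_head loc3.
  have [m1 [it1 agr1 v1 fr1]] := ecode_correct agr w1 (leqnn _) s1 loc1.
  have [m2 [it2 agr2 v2 fr2]] := ecode_correct agr1 w2 (leqnSn _) s2 loc2.
  have [_ mB _] := agr2.
  have m2t : m2 tmp_lo = ev e1 M by rewrite fr2.
  exists (upd m2 (ev e1 M) (ev e2 M)); split.
    rewrite addn1 iterS addnC iterD it1 it2 (step_at _ i3) /exec /= m2t v2.
    by rewrite modn_small -?v2 //; congr Config; lia.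
  apply: agrees_upd => //; last by rewrite -v2.
    by rewrite negb_and -[~~ (_ < _)]leqNgt heap_e1 orbT.
  by apply: contraTneq heap_e1 => ->.
- move=> c1 c2 M M1 M2 t1 t2 _ IH1 _ IH2 /andP[w1 w2] o m agr loc.
  have [loc1 loc2] := located_cat loc; rewrite size_ccode in loc2.
  have [m1 [it1 agr1]] := IH1 w1 o m agr loc1.
  have [m2 [it2 agr2]] := IH2 w2 _ m1 agr1 loc2.
  by exists m2; split=> //; rewrite addnC iterD it1 it2 addnA.
- move=> e c M t M' safe e0 _ IH /andP[we wc] o m agr loc.
  have [loc1 loc'] := located_cat loc; rewrite size_ecode in loc'.
  have [i2 loc2] := located_head loc'.
  have [m1 [it1 agr1 v1 _]] := ecode_correct agr we (leqnn _) safe loc1.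
  rewrite -[(o + esize e).+1]addn1 in loc2.
  have [m2 [it2 agr2]] := IH wc _ m1 agr1 loc2.
  exists m2; split=> //.
  rewrite addnC iterD addn1 iterS it1 (step_at _ i2) /exec /= v1 (negbTE e0).
  by rewrite -addn1 it2 addnS addn0 !addSn addnS -!addnA.
- move=> e c M safe e0 /andP[we wc] o m agr loc.
  have [loc1 loc'] := located_cat loc; rewrite size_ecode in loc'.
  have [i2 loc2] := located_head loc'.
  have [m1 [it1 agr1 v1 _]] := ecode_correct agr we (leqnn _) safe loc1.
  exists m1; split=> //.
  by rewrite addn1 iterS it1 (step_at _ i2) /exec /= v1 e0; congr Config; lia.
- move=> x l c M le_lx; rewrite -!andbA => /and5P[x_lo x2 l_lo xl _] o m agr loc.
  have [i1 loc1] := located_head loc; have [i2 _] := located_head loc1.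
  have [mM mB M2] := agr.
  have mx : m x = M x by apply: mM; rewrite negb_and -ltnNge x_lo.
  have ml : m l = M l by apply: mM; rewrite negb_and -ltnNge l_lo.
  exists (upd m tmp_lo 0); split; last by apply: agrees_tmp => //; rewrite expn_gt0.
  have lx0 : M l - M x = 0 by apply/eqP.
  rewrite (step_at _ i1) /exec /= mx ml lx0 mod0n.
  by rewrite (step_at _ i2).
move=> x l c M M1 M2 t1 t2 lt_xl l_lim B1 H1 IH1 _ IH2 wl o m agr loc.
have := wl; rewrite -!andbA => /and5P[x_lo x2 l_lo xl /and3P[xc lc wc]].
have [i1 loc1] := located_head loc; have [i2 loc2] := located_head loc1.
have [loc3 loc4] := located_cat loc2; rewrite size_ccode in loc4.
have [i5 loc5] := located_head loc4; have [i6 loc6] := located_head loc5.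
have [i7 _] := located_head loc6.
have [mM mB _] := agr.
have mx : m x = M x by apply: mM; rewrite negb_and -ltnNge x_lo.
have ml : m l = M l by apply: mM; rewrite negb_and -ltnNge l_lo.
have lB : M l - M x < B by apply: leq_ltn_trans (leq_subr _ _) _; rewrite -ml.
have agr0 : agrees (upd m tmp_lo (M l - M x)) M by apply: agrees_tmp.
rewrite -[o.+2]addn2 in loc3 i5 i6 i7.
have [m1 [it1 agr1]] := IH1 wc _ _ agr0 loc3.
have x_hi : x < heap_lo by apply: leq_trans x_lo _.
have M1x : M1 x = M x by apply: (bigstep_frame H1).
have [m1M m1B M12] := agr1.
have m1x : m1 x = M x by rewrite m1M // negb_and -ltnNge x_lo.
have xB : (M x).+1 < B by apply: leq_ltn_trans lt_xl _; rewrite -ml.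
have agr2 : agrees (upd (upd m1 tmp_lo 1) x (M1 x).+1) (upd M1 x (M1 x).+1).
  apply: agrees_upd => //; rewrite ?M1x //; first exact: agrees_tmp.
  by rewrite negb_and -ltnNge x_lo.
have [m2 [it2 agr2']] := IH2 wl o _ agr2 loc.
exists m2; split=> //.
have E2 : iter 2 (step w P) (Config o m) = Config (o + 2) (upd m tmp_lo (M l - M x)).
  rewrite /= (step_at _ i1) /exec /= mx ml modn_small //.
  rewrite (step_at _ i2) /exec /= addn2 -[M l - M x == 0]/(M l <= M x).
  by rewrite leqNgt lt_xl.
have x_tmp : x == tmp_lo = false by rewrite ltn_eqF.
have E3 : iter 3 (step w P) (Config (o + 2 + csize c) m1) =
          Config o (upd (upd m1 tmp_lo 1) x (M1 x).+1).
  rewrite /= (step_at _ i5) /exec /= modn_small //.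
  rewrite (step_at _ i6) /exec /= x_tmp m1x addn1 modn_small ?M1x //.
  rewrite (step_at _ i7) /exec /= [2 == x]eq_sym (negbTE x2) /=.
  by have := m1M 2 isT; rewrite M12 => ->.
rewrite -!iterS (_ : (0 + t1 + 3 + t2).+2 = t2 + (3 + (t1 + 2))); last lia.
by rewrite !iterD E2 it1 E3 it2.
Qed.

End Semantics.

Definition framed (S : seq nat) (p : bool) (M M' : memory) : Prop :=
  (forall a, a < heap_lo -> a \notin S -> M' a = M a) /\
  (p -> forall a, heap_lo <= a -> M' a = M a).

Lemma framed_refl S p M : framed S p M M. Proof. by []. Qed.

Lemma framed_trans S p M1 M2 M3 :
  framed S p M1 M2 -> framed S p M2 M3 -> framed S p M1 M3.
Proof.
case=> lo1 hi1 [lo2 hi2]; split=> [a a_lo aS|pT a a_hi].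
  by rewrite lo2 ?lo1.
by rewrite hi2 ?hi1.
Qed.

Lemma framed_upd S p M M' x v : x \in S -> x < heap_lo ->
  framed S p M M' -> framed S p M (upd M' x v).
Proof.
move=> xS x_lo [lo hi]; split=> [a a_lo aS|pT a a_hi]; rewrite updE.
  by case: (a =P x) => [ax|_]; [rewrite ax xS in aS|apply: lo].
by rewrite gtn_eqF ?hi // (leq_trans x_lo).
Qed.

Fixpoint look (l : seq (nat * nat)) (r : nat) : option nat :=
  if l is (r', v) :: l' then if r' == r then Some v else look l' r else None.

(** What is known of the variables, as an association list: newer entries shadow older ones, and
    lookups are settled by computation. *)
Definition regs (l : seq (nat * nat)) (M : memory) : Prop :=
  forall r v, look l r = Some v -> M r = v.

Lemma regs_cons l M r v : M r = v -> regs l M -> regs ((r, v) :: l) M.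
Proof. by move=> Mr rl r' v' /=; case: eqP => [<- [<-]|_ /rl]. Qed.

Lemma heap_lo_sqr n a : heap_lo <= n -> heap_lo <= 2 + n * n + a.
Proof.
move=> n_ge; apply: leq_trans n_ge _; apply: leq_trans (leq_addr _ _).
by case: n => // n; apply: leq_trans (leq_addl _ _); rewrite leq_pmulr.
Qed.

Lemma upd_hi M x v a : x < heap_lo -> heap_lo <= a -> upd M x v a = M a.
Proof. by move=> x_lo a_hi; rewrite updE gtn_eqF // (leq_trans x_lo). Qed.

Lemma regs_upd l M x v : regs l M -> regs ((x, v) :: l) (upd M x v).
Proof.
move=> rl r v' /=; rewrite updE eq_sym.
by case: (r == x) => [[<-]|/rl].
Qed.

Lemma look_mem l r v : look l r = Some v -> r \in unzip1 l.
Proof.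
elim: l => //= [[r' v'] l IH] /=; rewrite inE eq_sym.
by case: eqP => //= _ /IH.
Qed.

Lemma regs_sub l l' M : regs l M ->
  foldr (fun p P => look l p.1 = Some p.2 /\ P) True l' -> regs l' M.
Proof.
move=> rl; elim: l' => [//|[r v] l' IH] /= [lr /IH rl'].
by apply: regs_cons => //; apply: rl.
Qed.

Lemma regs_framed S p l M M' : framed S p M M' ->
  all (fun r => (r < heap_lo) && (r \notin S)) (unzip1 l) -> regs l M -> regs l M'.
Proof.
move=> [lo _] /allP lS rl r v lr; have /lS/andP[r_lo rS] := look_mem lr.
by rewrite lo ?(rl _ _ lr).
Qed.

Lemma regs_heap l M a v : regs l M -> heap_lo <= a ->
  all (fun r => r < heap_lo) (unzip1 l) -> regs l (upd M a v).
Proof.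
move=> rl a_hi /allP l_lo r v' lr; have /l_lo r_lo := look_mem lr.
by rewrite updE ltn_eqF ?(rl _ _ lr) // (leq_trans r_lo).
Qed.

(** * Rules for total correctness *)

Section Rules.

Variables (w : nat) (lim : nat -> nat).
Local Notation B := (2 ^ w).

Definition ok (c : com) (M : memory) (Q : memory -> Prop) : Prop :=
  exists t M', bigstep w lim c M t M' /\ Q M'.

Lemma ok_seq c1 c2 M Q : ok c1 M (fun M1 => ok c2 M1 Q) -> ok (Seq c1 c2) M Q.
Proof.
case=> t1 [M1 [H1 [t2 [M2 [H2 Q2]]]]].
by exists (t1 + t2), M2; split=> //; apply: BSeq H1 H2.
Qed.

Lemma ok_asn x e M (Q : memory -> Prop) :
  esafe w e M -> Q (upd M x (ev e M)) -> ok (Asn x e) M Q.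
Proof. by move=> s q; do 2 eexists; split; last exact: q; apply: BAsn. Qed.

Lemma ok_put e1 e2 M (Q : memory -> Prop) : esafe w e1 M -> esafe w e2 M ->
  heap_lo <= ev e1 M -> Q (upd M (ev e1 M) (ev e2 M)) -> ok (Put e1 e2) M Q.
Proof. by move=> s1 s2 a q; do 2 eexists; split; last exact: q; apply: BPut. Qed.

Lemma ok_when e c M (Q : memory -> Prop) : esafe w e M ->
  (ev e M <> 0 -> ok c M Q) -> (ev e M = 0 -> Q M) -> ok (When e c) M Q.
Proof.
move=> s HT HF; case: (ev e M =P 0) => [e0|e0].
  by do 2 eexists; split; last exact: HF; apply: BWhenF.
have [t [M' [H q]]] := HT e0.
by do 2 eexists; split; last exact: q; apply: BWhenT H => //; apply/eqP.
Qed.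

(** Consequence and frame rule in one: specifications of subprograms need only mention what they
    compute. *)
Lemma ok_conseq c M (Q Q' : memory -> Prop) : cwf c -> ok c M Q ->
  (forall M', framed (mods c) (no_put c) M M' -> Q M' -> Q' M') -> ok c M Q'.
Proof.
move=> wc [t [M' [H q]]] QQ; exists t, M'; split=> //; apply: QQ => //.
split=> [a|np a]; first exact: bigstep_frame H a.
exact: bigstep_no_put H wc np a.
Qed.

Lemma ok_loop (x l : nat) c M (I : nat -> memory -> Prop) N (Q : memory -> Prop) :
  cwf (Loop x l c) -> 1 < B -> M l = N -> N <= lim l -> M x = 0 -> I 0 M ->
  (forall i M', i < N -> M' x = i -> framed (x :: mods c) (no_put c) M M' ->
     I i M' -> ok c M' (fun M1 => I i.+1 (upd M1 x i.+1))) ->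
  (forall M', framed (x :: mods c) (no_put c) M M' -> M' x = N -> I N M' -> Q M') ->
  ok (Loop x l c) M Q.
Proof.
move=> wl B1 Ml Nlim Mx I0 step post.
have /and5P[wx l_lo xl xc /andP[lc wc]] := wl.
have x_lo : x < heap_lo by case/andP: wx => x_lo _; apply: leq_trans x_lo _.
have l_hi : l < heap_lo by apply: leq_trans l_lo _.
have ls : l \notin x :: mods c by rewrite inE negb_or eq_sym xl.
suff H j i M' : i + j = N -> M' x = i -> framed (x :: mods c) (no_put c) M M' ->
    I i M' -> ok (Loop x l c) M' Q.
  by apply: (H N 0 M) => //; apply: framed_refl.
elim: j i M' => [|j IH] i M' ij M'x fr IiM'.
  rewrite addn0 in ij; rewrite ij in M'x IiM'.
  exists 2, M'; split; last exact: post.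
  by apply: BLoopE; rewrite (fr.1 l) // Ml M'x.
have iN : i < N by rewrite -ij addnS ltnS leq_addr.
have [t1 [M1 [H1 I1]]] := step i M' iN M'x fr IiM'.
have M1x : M1 x = i by rewrite (bigstep_frame H1).
have fr1 : framed (x :: mods c) (no_put c) M (upd M1 x i.+1).
  apply: framed_upd; rewrite ?mem_head //; apply: framed_trans fr _.
  split=> [a a_lo|np a a_hi]; last exact: bigstep_no_put H1 wc np a a_hi.
  rewrite inE negb_or => /andP[_ a_n]; exact: bigstep_frame H1 a a_lo a_n.
have [||t2 [M2 [H2 Q2]]] := IH i.+1 (upd M1 x i.+1) _ _ fr1 I1.
- by rewrite addSnnS.
- by rewrite updE eqxx.
exists (2 + t1 + 3 + t2), M2; split=> //.
have M'l : M' l = N by rewrite (fr.1 l).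
apply: (BLoopS _ _ B1 H1); rewrite ?M'l ?M'x ?M1x //.
Qed.

Lemma ok_set l x e v c M Q : regs l M -> esafe w e M -> ev e M = v ->
  x < heap_lo ->
  (forall M', framed [:: x] true M M' -> regs ((x, v) :: l) M' -> ok c M' Q) ->
  ok (Seq (Asn x e) c) M Q.
Proof.
move=> rl s <- x_lo H; apply: ok_seq; apply: ok_asn => //; apply: H.
  by apply: framed_upd => //; rewrite ?mem_head.
exact: regs_upd.
Qed.

Lemma ok_for (x l : nat) c M (I : nat -> memory -> Prop) N (Q : memory -> Prop) :
  cwf (Loop x l c) -> 1 < B -> M l = N -> N <= lim l -> I 0 (upd M x 0) ->
  (forall i M', i < N -> M' x = i -> framed (x :: mods c) (no_put c) M M' ->
     I i M' -> ok c M' (fun M1 => I i.+1 (upd M1 x i.+1))) ->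
  (forall M', framed (x :: mods c) (no_put c) M M' -> M' x = N -> I N M' -> Q M') ->
  ok (For x l c) M Q.
Proof.
move=> wl B1 Ml Nlim I0 step post; apply: ok_seq; apply: ok_asn => /=.
  exact: ltnW.
have /and5P[wx l_lo xl xc /andP[lc wc]] := wl.
have x_lo : x < heap_lo by case/andP: wx => x_lo _; apply: leq_trans x_lo _.
have fr0 : framed (x :: mods c) (no_put c) M (upd M x 0).
  by apply: framed_upd; rewrite ?mem_head //; apply: framed_refl.
apply: (ok_loop (I := I) (N := N)) => //.
- by rewrite updE eq_sym (negbTE xl).
- by rewrite updE eqxx.
- by move=> i M' iN M'x fr; apply: step => //; apply: framed_trans fr0 fr.
by move=> M' fr; apply: post; apply: framed_trans fr0 fr.
Qed.

End Rules.

(** * Bounds by powers of n, which exclude overflow *)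

Section PolynomialBounds.

Variable n : nat.
Hypothesis n_ge : 60 <= n.

Lemma cap_le a i j : a <= n ^ i -> i <= j -> a <= n ^ j.
Proof. by move=> an ij; apply: leq_trans an _; rewrite leq_pexp2l //; lia. Qed.

Lemma capD a b i j : a <= n ^ i -> b <= n ^ j -> a + b <= n ^ (maxn i j).+1.
Proof.
move=> ai bj; have {}ai := cap_le ai (leq_maxl i j).
have {}bj := cap_le bj (leq_maxr i j).
apply: leq_trans (leq_add ai bj) _; rewrite addnn -mul2n expnS leq_mul2r.
by apply/orP; right; lia.
Qed.

Lemma capM a b i j : a <= n ^ i -> b <= n ^ j -> a * b <= n ^ (i + j).
Proof. by move=> ai bj; rewrite expnD leq_mul. Qed.

Lemma capB a b i : a <= n ^ i -> a - b <= n ^ i.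
Proof. exact: leq_trans (leq_subr _ _). Qed.

Lemma cap_div a b i : a <= n ^ i -> a %/ b <= n ^ i.
Proof. exact: leq_trans (leq_div _ _). Qed.

Lemma cap_mod a b i : a <= n ^ i -> a %% b <= n ^ i.
Proof. exact: leq_trans (leq_mod _ _). Qed.

Lemma cap_modr a b i : 0 < b -> b <= n ^ i -> a %% b <= n ^ i.
Proof. by move=> b0; apply: leq_trans; apply: ltnW; rewrite ltn_mod. Qed.

Lemma capS a i : a <= n ^ i -> a.+1 <= n ^ i.+1.
Proof. by move=> ai; rewrite -addn1 -(maxn0 i); apply: capD ai _. Qed.

Lemma cap_num a : a <= 60 -> a <= n ^ 1.
Proof. by move=> a60; rewrite expn1; apply: leq_trans a60 n_ge. Qed.

Lemma cap_lt a b i : a < b -> b <= n ^ i -> a <= n ^ i.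
Proof. by move=> /ltnW ab; apply: leq_trans ab. Qed.

Lemma cap_word w a i : n ^ 19 < 2 ^ w -> a <= n ^ i -> i <= 19 -> a < 2 ^ w.
Proof. by move=> nw an i19; apply: leq_ltn_trans nw; apply: cap_le an i19. Qed.

End PolynomialBounds.

Ltac numeral a := lazymatch a with 0 => idtac | S ?b => numeral b end.

(** Finds the exponent while proving the bound: it starts as an existential variable, and the shape
    of the expression determines it. *)
Ltac cap n_ge := first [
  lazymatch goal with |- is_true (?a <= _) => numeral a; apply (cap_num n_ge); reflexivity end
  | eassumption | lazymatch goal with
  | |- is_true (?a.+1 <= _) => eapply (capS n_ge); cap n_ge
  | |- is_true (?a + ?b <= _) => eapply (capD n_ge); [cap n_ge|cap n_ge]
  | |- is_true (?a * ?b <= _) => eapply capM; [cap n_ge|cap n_ge]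
  | |- is_true (?a - ?b <= _) => eapply capB; cap n_ge
  | |- is_true (?a %/ ?b <= _) => eapply cap_div; cap n_ge
  | |- is_true (?a %% ?b <= _) =>
      first [ eapply cap_modr; [eassumption|eassumption] | eapply cap_mod; cap n_ge ]
  | |- is_true (?a <= _) =>
      match goal with
        H : is_true (a < ?b), H' : is_true (?b <= _ ^ _) |- _ => apply (cap_lt H H')
      end
  end ].

Ltac word n_ge nw :=
  eapply (cap_word n_ge nw); [cap n_ge | reflexivity].

Ltac reg rl := lazymatch type of rl with regs _ ?M =>
  repeat match goal with |- context [M ?r] =>
    let E := fresh in
    first [ have E := rl r _ erefl; rewrite E; clear E ] end end.

(** * The program *)

Declare Scope prog_scope.
Delimit Scope prog_scope with prog.
Bind Scope prog_scope with expr.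
Bind Scope prog_scope with com.
Notation "$ r" := (Var r) (at level 1, r at level 0, format "$ r") : prog_scope.
Notation "# v" := (Lit v) (at level 1, v at level 0, format "# v") : prog_scope.
Notation "a + b" := (Bin OpAdd a b) : prog_scope.
Notation "a - b" := (Bin OpSub a b) : prog_scope.
Notation "a * b" := (Bin OpMul a b) : prog_scope.
Notation "a / b" := (Bin OpDiv a b) : prog_scope.
Notation "a %% b" := (Bin OpMod a b) : prog_scope.
Notation "x <~ e" := (Asn x e) (at level 70) : prog_scope.
Notation "c1 ;; c2" := (Seq c1 c2) (at level 71, right associativity) : prog_scope.

(* Final values: [rH] = k!, [rQ] = 2 ^ [rS], [rR] = [rS] * k, [rZ] = 2 ^ [rR],
   [rQ1] = [rQ] - 1; [rM], [rMM], [rLf] and [rm] delimit the vertex codes of the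
   gadget, [rBase] and [rOut] are the addresses of the table of logarithms and
   of the output matrix. *)
Notation rH := 3 (only parsing).
Notation rI := 4 (only parsing).
Notation rQ := 5 (only parsing).
Notation rP := 6 (only parsing).
Notation rJ := 7 (only parsing).
Notation rR := 8 (only parsing).
Notation rS := 9 (only parsing).
Notation rZ := 10 (only parsing).
Notation rFound := 11 (only parsing).
Notation rF := 12 (only parsing).
Notation rV := 13 (only parsing).
Notation rCnt := 14 (only parsing).
Notation rT := 15 (only parsing).
Notation rXa := 16 (only parsing).
Notation rXb := 17 (only parsing).
Notation rXc := 18 (only parsing).
Notation rXj := 19 (only parsing).
Notation rPw := 20 (only parsing).
Notation rBase := 21 (only parsing).
Notation rQ1 := 22 (only parsing).
Notation rM := 23 (only parsing).
Notation rMM := 24 (only parsing).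
Notation rLf := 25 (only parsing).
Notation rm := 26 (only parsing).
Notation rOut := 27 (only parsing).
Notation rRow := 28 (only parsing).
Notation rCol := 29 (only parsing).
Notation rLo := 30 (only parsing).
Notation rHi := 31 (only parsing).
Notation rVal := 32 (only parsing).
Notation rU := 33 (only parsing).
Notation rU2 := 34 (only parsing).
Notation rZm := 35 (only parsing).
Notation rV1 := 36 (only parsing).
Notation rV2 := 37 (only parsing).

Definition xor_prog : com := (
  rXc <~ #0 ;; rPw <~ #1 ;;
  For rXj rR (
    rXc <~ $rXc + (($rXa / $rPw + $rXb / $rPw) %% #2) * $rPw ;;
    rPw <~ $rPw + $rPw))%prog.

Definition fact_prog : com := (
  rH <~ #1 ;; For rI 1 (rH <~ $rH * ($rI + #1)))%prog.

(** Without unbounded loops, there are n rounds, of which only those act whose guard is nonzero,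
    that is, q <= k! + k or q^k < n. *)
Definition size_prog : com := (
  rQ <~ #1 ;; rS <~ #0 ;;
  For rI 0 (
    rP <~ #1 ;; For rJ 1 (rP <~ $rP * $rQ) ;;
    When (($rH + $1 + #1 - $rQ) + ($0 - $rP)) (
      rQ <~ $rQ + $rQ ;; rS <~ $rS + #1)) ;;
  rR <~ $rS * $1 ;;
  rZ <~ #1 ;; For rJ rR (rZ <~ $rZ + $rZ))%prog.

(* Subtraction is truncated, so this is 1 if the values agree, 0 otherwise. *)
Definition eq_expr (a b : expr) : expr := (#1 - ((a - b) + (b - a)))%prog.

(* Multiplies [rV] by X modulo X ^ [rR] + [rF], polynomials over F_2 being coded
   by their binary digits, after storing the logarithm [rT] of [rV]; [rCnt]
   counts the returns to 1. *)
Definition lfsr_prog : com := (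
  Put ($rBase + $rV) $rT ;;
  rV <~ $rV + $rV ;;
  When ($rV + #1 - $rZ) (
    rXa <~ $rV - $rZ ;; rXb <~ $rF ;; xor_prog ;; rV <~ $rXc) ;;
  rCnt <~ $rCnt + eq_expr $rV #1)%prog.

(** Each attempt overwrites the table of logarithms, so the flag must suspend all attempts after the
    first success. *)
Definition search_prog : com := (
  rBase <~ #2 + $0 * $0 ;; rZm <~ $rZ - #1 ;; rFound <~ #0 ;;
  For rF rZ (When (#1 - $rFound) (
    rV <~ #1 ;; rCnt <~ #0 ;;
    For rT rZm lfsr_prog ;;
    rFound <~ eq_expr $rV #1 * eq_expr $rCnt #1)))%prog.

Definition dims_prog : com := (
  rQ1 <~ $rQ - #1 ;; rM <~ $0 * $rQ1 ;; rMM <~ $rM * $rM ;;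
  rLf <~ $rMM + ($rH + #1 - ($1 * ($1 - #1)) / #2) ;;
  rm <~ $rLf + $rZ * $rQ1 ;; rOut <~ $rBase + $rZ)%prog.

(** With truncated subtraction, 1 - (1 - x) tells whether x is nonzero. Entry 0 of the table is no
    logarithm, but it is multiplied by 0. *)
Definition check_prog (r : nat) : com := (
  xor_prog ;;
  rVal <~ $rVal * ((#1 - (#1 - $rXc)) *
    eq_expr (Get ($rBase + $rXc) %% $rQ1)
            (($r %% $rQ1 + $rHi %% $rQ1) %% $rQ1)))%prog.

(** Truncated subtraction gives minimum and maximum. The matrix of [G] is read below its diagonal
    only, because row 0 has been overwritten by variables. *)
Definition entry_prog : com := (
  rLo <~ $rRow - ($rRow - $rCol) ;; rHi <~ $rCol + ($rRow - $rCol) ;;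
  rVal <~ #0 ;;
  When (($rLf - $rLo) * ($rHi + #1 - $rLf)) (
    rHi <~ $rHi - $rLf ;; rVal <~ #1 ;;
    When ($rMM - $rLo) (
      rVal <~ #0 ;;
      rU <~ $rLo / $rM ;; rU2 <~ $rLo %% $rM ;;
      rV1 <~ $rU / $rQ1 ;; rV2 <~ $rU2 / $rQ1 ;;
      When ($rV2 - $rV1) (
        rVal <~ Get (#2 + $rV2 * $0 + $rV1) ;; rXb <~ $rHi / $rQ1 ;;
        rXa <~ $rV1 ;; check_prog rU ;; rXa <~ $rV2 ;; check_prog rU2))))%prog.

Definition output_prog : com := (
  For rRow rm (For rCol rm (
    entry_prog ;; Put ($rOut + $rRow * $rm + $rCol) $rVal)) ;;
  0 <~ $rm ;; 1 <~ $rOut)%prog.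

Definition main_prog : com :=
  (fact_prog ;; size_prog ;; search_prog ;; dims_prog ;; output_prog)%prog.

(** If the last step returns to 1, a single return in total means that there is no earlier one. *)
Lemma primitive_taps_test r f : 1 < r ->
  (iter (2 ^ r).-1 (lfsr r f) 1 == 1) &&
  (\sum_(j < (2 ^ r).-1) (iter j.+1 (lfsr r f) 1 == 1) == 1) <->
  primitive_taps r f.
Proof.
move=> r1; have : 0 < (2 ^ r).-1 by rewrite -subn1 subn_gt0 (ltn_exp2l 0) // ltnW.
rewrite /primitive_taps; case: (2 ^ r).-1 => [//|m] _.
rewrite big_ord_recr /=; split=> [/andP[/eqP it1]|[it1 itN]].
  rewrite it1 eqxx addn1 eqSS sum_nat_eq0 => /forallP it0; split=> // i.
  case: i => [//|i] /andP[_]; rewrite ltnS => im it_i.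
  by have := it0 (Ordinal im); rewrite /= -/(iter i.+1 (lfsr r f) 1) it_i eqxx.
rewrite it1 eqxx /= big1 // => j _; apply/eqP; rewrite eqb0; apply/eqP.
by apply: (itN j.+1); rewrite /= ltnS ltn_ord.
Qed.

(** From equal values at [i] and [j], the steps left after [j] would lead to 1 too early when run
    from [i]. *)
Lemma primitive_taps_inj r f i j : primitive_taps r f -> i < j < (2 ^ r).-1 ->
  iter j (lfsr r f) 1 <> iter i (lfsr r f) 1.
Proof.
move=> [it1 itN] /andP[ij jn] vij; apply: (itN ((2 ^ r).-1 - j + i)); first by lia.
by rewrite iterD -vij -iterD subnK ?it1 // ltnW.
Qed.

Lemma eq_exprE (a b : nat) : 1 - ((a - b) + (b - a)) = (a == b).
Proof. by case: (ltngtP a b); lia. Qed.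

(** * Correctness of the arithmetic, the search and the choice of q *)

Section Correctness.

Variables (n k s w : nat) (lim : nat -> nat).
Local Notation R := (s * k).
Local Notation Z := (2 ^ R).
Hypothesis n_ge : 60 <= n.
Hypothesis nw : n ^ 19 < 2 ^ w.
Hypotheses (lim0 : n <= lim 0) (lim1 : k <= lim 1) (limR : R <= lim rR).
Hypotheses (k_cap : k <= n ^ 1) (H_cap : k`! <= n ^ 1) (s_cap : s <= n ^ 1).
Hypotheses (Z_cap : Z <= n ^ 6) (R_cap : R <= n ^ 6).

Let w1 : 1 < 2 ^ w.
Proof. by word n_ge nw. Qed.

Lemma pow2_cap i : i <= R -> 2 ^ i <= n ^ 6.
Proof. by move=> iR; apply: leq_trans Z_cap; rewrite leq_exp2l. Qed.

Lemma xor_ok M a b d : M rXa = a -> M rXb = b -> M rR = R ->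
  a <= n ^ d -> b <= n ^ d -> d <= 10 ->
  ok w lim xor_prog M (fun M' => M' rXc = xorn R a b).
Proof.
move=> Ma Mb MR a_cap b_cap d10.
apply: ok_seq; apply: ok_asn => /=; first by word n_ge nw.
apply: ok_seq; apply: ok_asn => /=; first by word n_ge nw.
apply: (ok_for (N := R)
  (I := fun i M' => M' rXc = xorn i a b /\ M' rPw = 2 ^ i)) => //.
  by rewrite /upd /= /xorn big_ord0.
move=> i M' iR M'i fr [M'c M'p].
have Ma' : M' rXa = a by rewrite (fr.1 rXa).
have Mb' : M' rXb = b by rewrite (fr.1 rXb).
have pi_cap := pow2_cap (ltnW iR).
have x_cap : xorn i a b <= n ^ 6 by apply: leq_trans (ltnW (xorn_lt _ _ _)) pi_cap.
have a1 := cap_le n_ge a_cap d10; have b1 := cap_le n_ge b_cap d10.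
apply: ok_seq; apply: ok_asn => /=; rewrite ?Ma' ?Mb' ?M'c ?M'p.
  by do !split => //; word n_ge nw.
apply: ok_asn => /=; rewrite /upd /= ?Ma' ?Mb' ?M'c ?M'p.
  by do !split => //; word n_ge nw.
split; last by rewrite expnS mul2n addnn.
  by rewrite /xorn big_ord_recr.
by move=> M' _ _ [].
Qed.

Lemma fact_ok M : M 1 = k -> ok w lim fact_prog M (fun M' => M' rH = k`!).
Proof.
move=> Mk.
apply: ok_seq; apply: ok_asn => /=; first by word n_ge nw.
apply: (ok_for (N := k) (I := fun i M' => M' rH = i`!)) => //.
move=> i M' ik M'i _ M'H.
have H1 : i`! * i.+1 <= n ^ 1.
  by rewrite mulnC -factS; apply: leq_trans H_cap; apply: leq_fact.
have i_cap := cap_lt ik k_cap.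
apply: ok_asn => /=; rewrite /upd /= ?M'H ?M'i ?addn1; last by rewrite factS mulnC.
by do !split => //; word n_ge nw.
Qed.

Hypothesis limZm : Z.-1 <= lim rZm.
Hypothesis limZ : Z <= lim rZ.

Lemma lfsr_ok f i M : (1 < R)%N -> f < Z -> i < Z.-1 ->
  regs [:: (rR, R); (rZ, Z); (rF, f); (rBase, 2 + n * n);
           (rV, iter i (lfsr R f) 1); (rT, i)] M -> M rCnt <= n ^ 6 ->
  ok w lim lfsr_prog M (fun M' =>
    [/\ M' rV = iter i.+1 (lfsr R f) 1,
        M' rCnt = M rCnt + (iter i.+1 (lfsr R f) 1 == 1),
        M' (2 + n * n + iter i (lfsr R f) 1) = i &
        forall a, heap_lo <= a -> a <> 2 + n * n + iter i (lfsr R f) 1 -> M' a = M a]).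
Proof.
move=> R1 fZ iZ rl cnt_cap.
set v := iter i _ 1 in rl *.
have vZ : v < Z by apply: iter_lfsr_lt.
have n_cap : n <= n ^ 1 by rewrite expn1.
have iZ' : i < Z by apply: leq_trans iZ (leq_pred _).
have base_lo : heap_lo <= 2 + n * n + v by apply: heap_lo_sqr.
rewrite iterS -/v.
set A := 2 + n * n + v in base_lo *.
have cnt1_cap b : (M rCnt + nat_of_bool b) <= n ^ 8.
  by case: b; rewrite ?addn0 ?addn1; apply: (cap_le n_ge); [cap n_ge| |cap n_ge|].
apply: ok_seq; apply: ok_put; rewrite /= ?(rl rBase _ erefl) ?(rl rV _ erefl) -/A //.
  by do !split => //; rewrite /A; word n_ge nw.
rewrite (rl rT _ erefl).
have M1A : upd M A i A = i by rewrite updE eqxx.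
have M1h a : heap_lo <= a -> a <> A -> upd M A i a = M a.
  by move=> _ /eqP/negbTE aA; rewrite updE aA.
have M1c : upd M A i rCnt = M rCnt.
  by rewrite updE ltn_eqF // (leq_trans _ base_lo).
have {}rl := regs_heap i rl base_lo isT.
move: (upd M A i) M1A M1h M1c rl => M1 M1A M1h M1c rl.
have vv_cap : v + v <= n ^ 7 by apply: (cap_le n_ge); [cap n_ge|].
apply: (ok_set rl (v := v + v)) => //=; reg rl => //.
  by do !split => //; word n_ge nw.
move=> M2 fr2 {}rl.
apply: ok_seq; apply: (ok_conseq (Q := fun M3 => M3 rV = lfsr R f v)) => //.
  apply: ok_when => /=; reg rl.
  - by do !split => //; word n_ge nw.
  - move=> c; have {c} zv : Z <= v + v by lia.
    apply: (ok_set rl (v := v + v - Z)) => //=; reg rl => // M3 fr3 {}rl.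
    apply: (ok_set rl (v := f)) => //=; reg rl => // M4 fr4 {}rl.
    apply: ok_seq; apply: (ok_conseq (Q := fun M' => M' rXc = xorn R (v + v - Z) f)) => //.
      by apply: (xor_ok (d := 7)); reg rl => //; [cap n_ge|apply: (cap_le n_ge); [cap n_ge|]].
    move=> M5 _ M5c; apply: ok_asn => //=.
    rewrite /upd /= M5c /lfsr mul2n -addnn ltnNge zv //.
  move=> c; have {c} zv : v + v < Z by lia.
  by rewrite /lfsr mul2n -addnn zv.
move=> M3 fr3 M3v.
have {}rl : regs [:: (rV, lfsr R f v)] M3 by apply: regs_cons.
have M3c : M3 rCnt = M rCnt by rewrite (fr3.1 rCnt) // (fr2.1 rCnt).
apply: ok_asn => /=; reg rl; rewrite M3c.
  have l_cap := leq_trans (ltnW (lfsr_lt R f v)) Z_cap.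
  have c1_cap := cnt1_cap (lfsr R f v == 1).
  do !split => //; rewrite ?eq_exprE; word n_ge nw.
rewrite /upd /= eq_exprE; split=> //.
  by rewrite gtn_eqF ?(fr3.2 isT) ?(fr2.2 isT) // (leq_trans _ base_lo).
move=> a a_hi aA.
by rewrite gtn_eqF ?(fr3.2 isT) ?(fr2.2 isT) ?M1h // (leq_trans _ a_hi).
Qed.

Local Notation base := (2 + n * n).

Definition log_table (f : nat) (M : memory) : Prop :=
  forall i, i < Z.-1 -> M (base + iter i (lfsr R f) 1) = i.

Lemma lfsr_loop_ok f M : 1 < R -> f < Z ->
  regs [:: (rR, R); (rZ, Z); (rZm, Z.-1); (rF, f); (rBase, base); (rV, 1);
           (rCnt, 0)] M ->
  ok w lim (For rT rZm lfsr_prog) M (fun M' =>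
    [/\ M' rV = iter Z.-1 (lfsr R f) 1,
        M' rCnt = \sum_(j < Z.-1) (iter j.+1 (lfsr R f) 1 == 1),
        primitive_taps R f -> log_table f M' &
        forall a, heap_lo <= a < base -> M' a = M a]).
Proof.
move=> R1 fZ rl.
have base_lo : heap_lo <= base by rewrite -[base]addn0; apply: heap_lo_sqr.
(* For arbitrary taps a recurring value overwrites its entry, so the invariant speaks only of values
   that have not recurred so far. *)
apply: (ok_for (N := Z.-1) (I := fun i M' =>
  [/\ M' rV = iter i (lfsr R f) 1,
      M' rCnt = \sum_(j < i) (iter j.+1 (lfsr R f) 1 == 1),
      forall j, j < i ->
        (forall j', j < j' < i -> iter j' (lfsr R f) 1 <> iter j (lfsr R f) 1) ->
        M' (base + iter j (lfsr R f) 1) = j &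
      forall a, heap_lo <= a < base -> M' a = M a])) => //.
- exact: rl.
- split=> //; rewrite /upd /=; first by rewrite (rl rV _ erefl).
    by rewrite (rl rCnt _ erefl) big_ord0.
  by move=> a /andP[a_hi _]; rewrite gtn_eqF // (leq_trans _ a_hi).
- move=> i M' iZ M'i fr [M'v M'c M'tab M'h].
  have rl0 : regs [:: (rR, R); (rZ, Z); (rF, f); (rBase, base)] M.
    by apply: (regs_sub rl).
  have rl' : regs [:: (rR, R); (rZ, Z); (rF, f); (rBase, base);
                      (rV, iter i (lfsr R f) 1); (rT, i)] M'.
    have rl1 : regs [:: (rV, iter i (lfsr R f) 1), (rT, i) &
        [:: (rR, R); (rZ, Z); (rF, f); (rBase, base)]] M'.
      by do 2 (apply: regs_cons => //); apply: (regs_framed fr).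
    by apply: (regs_sub rl1).
  have c_cap : M' rCnt <= n ^ 6.
    apply: leq_trans Z_cap; apply: (@leq_trans i); last first.
      by apply: leq_trans (ltnW iZ) (leq_pred _).
    rewrite M'c -[X in _ <= X]card_ord -sum1_card; apply: leq_sum => j _.
    exact: leq_b1.
  apply: (ok_conseq _ (lfsr_ok R1 fZ iZ rl' c_cap)) => //.
  move=> M2 fr2 [M2v M2c M2i M2h].
  have vhi j : heap_lo <= base + iter j (lfsr R f) 1 by apply: leq_trans (leq_addr _ _).
  split.
  + by rewrite /upd /= M2v.
  + by rewrite /upd [LHS]/= M2c M'c [RHS]big_ord_recr.
  + move=> j; rewrite ltnS leq_eqVlt => /orP[/eqP->|ji] jP.
      by rewrite upd_hi ?M2i.
    rewrite upd_hi // M2h //; last first.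
      by move/addnI; apply/nesym/(jP i); rewrite ji /=.
    apply: M'tab => // j' /andP[jj' j'i]; apply: jP.
    by rewrite jj' /= ltnW.
  move=> a /andP[a_hi a_lt]; rewrite upd_hi // M2h // ?M'h ?a_hi //.
  by move=> aE; rewrite aE ltnNge leq_addr in a_lt.
move=> M' fr _ [M'v M'c M'tab M'h]; split=> // taps i iZ.
by apply: M'tab => // j jP; apply: primitive_taps_inj taps _.
Qed.

Lemma search_ok M : 1 < R -> M 0 = n -> M rR = R -> M rZ = Z ->
  ok w lim search_prog M (fun M' =>
    [/\ M' rBase = base,
        exists2 f, f < Z & primitive_taps R f /\ log_table f M' &
        forall a, heap_lo <= a < base -> M' a = M a]).
Proof.
move=> R1 Mn MR MZ.
have n_cap : n <= n ^ 1 by rewrite expn1.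
have rl : regs [:: (0, n); (rR, R); (rZ, Z)] M.
  by do 3 (apply: regs_cons => //).
have hi_neq a r : r < heap_lo -> heap_lo <= a < base -> forall M v, upd M r v a = M a.
  by move=> r_lo /andP[a_hi _] M0 v; apply: upd_hi.
apply: (ok_set rl (v := base)) => //=; reg rl => //.
  by do !split => //; word n_ge nw.
move=> M1 fr1 {}rl.
apply: (ok_set rl (v := Z.-1)) => //=; reg rl; rewrite ?subn1 //.
move=> M2 fr2 {}rl.
apply: (ok_set rl (v := 0)) => //=; first by word n_ge nw.
move=> M3 fr3 {}rl.
apply: (ok_for (N := Z) (I := fun i M' =>
  ((M' rFound = 0 /\ forall f, f < i -> ~ primitive_taps R f) \/
   (M' rFound = 1 /\ exists2 f, f < Z & primitive_taps R f /\ log_table f M')) /\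
  forall a, heap_lo <= a < base -> M' a = M a)) => //.
- exact: rl.
- split; first by left; split => //; apply: (rl rFound _ erefl).
  move=> a a_lt; rewrite hi_neq //; case/andP: a_lt => a_hi _.
  by rewrite (fr3.2 isT) ?(fr2.2 isT) ?(fr1.2 isT).
- move=> f M4 fZ M4f fr4 [M4F M4h].
  have {}rl : regs [:: (rF, f), (0, n) & [:: (rR, R); (rZ, Z); (rZm, Z.-1); (rBase, base)]] M4.
    apply: regs_cons => //; apply: (regs_framed fr4) => //.
    by apply: (regs_sub rl).
  apply: ok_when => /=.
  + by do !split => //; word n_ge nw.
  + case: M4F => [[M4F no_f]|[-> _ //]] _.
    apply: (ok_set rl (v := 1)) => //=.
    move=> M5 fr5 {}rl; apply: (ok_set rl (v := 0)) => //=; first by word n_ge nw.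
    move=> M6 fr6 {}rl.
    have rl6 : regs [:: (rR, R); (rZ, Z); (rZm, Z.-1); (rF, f); (rBase, base); (rV, 1);
           (rCnt, 0)] M6 by apply: (regs_sub rl).
    apply: ok_seq; apply: (ok_conseq _ (lfsr_loop_ok R1 fZ rl6)) => //.
    move=> M7 fr7 [M7v M7c M7tab M7h].
    have v_cap : iter Z.-1 (lfsr R f) 1 <= n ^ 6.
      exact: leq_trans (ltnW (iter_lfsr_lt _ _ R1)) Z_cap.
    have c_cap : \sum_(j < Z.-1) (iter j.+1 (lfsr R f) 1 == 1) <= n ^ 6.
      apply: leq_trans Z_cap; apply: leq_trans (leq_pred _).
      rewrite -[X in _ <= X]card_ord -sum1_card; apply: leq_sum => j _.
      exact: leq_b1.
    apply: ok_asn => /=; rewrite M7v M7c.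
      by do !split => //; word n_ge nw.
    rewrite !eq_exprE mulnb; split.
      have M7E a v1 v2 : heap_lo <= a -> upd (upd M7 rFound v1) rF v2 a = M7 a.
        by move=> a_hi; rewrite !upd_hi.
      case test: (_ && _).
        right; split=> //; exists f => //.
        have taps : primitive_taps R f by apply/(primitive_taps_test f R1).
        split=> // i iZ; rewrite M7E ?(M7tab taps) //.
        exact: heap_lo_sqr.
      left; split=> // f'; rewrite ltnS leq_eqVlt => /orP[/eqP->|]; last exact: no_f.
      by move/(primitive_taps_test f R1); rewrite test.
    move=> a a_lt; rewrite !hi_neq // M7h // -M4h //.
    by case/andP: a_lt => a_hi _; rewrite (fr6.2 isT) ?(fr5.2 isT).
  move=> cond; case: M4F => [[M4F _]|[M4F [f0 f0Z [taps tab]]]].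
    by rewrite M4F in cond.
  split; last by move=> a a_lt; rewrite hi_neq ?M4h.
  right; split=> //; exists f0 => //; split=> // i iZ.
  by rewrite upd_hi ?tab //; apply: heap_lo_sqr.
move=> M4 fr4 _ [M4F M4h]; split=> //.
  by rewrite (fr4.1 rBase) //; apply: (rl rBase _ erefl).
case: M4F => [[_ no_f]|[_ //]].
have [f fZ taps] := primitive_taps_exist R1.
by case: (no_f f fZ taps).
Qed.

Hypotheses (s_big : k`! + k < 2 ^ s) (s_n : n <= 2 ^ (s * k)) (s_le_n : s <= n).
Hypothesis s_min : forall j, j < s -> (2 ^ j <= k`! + k) || (2 ^ (j * k) < n).

Lemma size_ok M : M 0 = n -> M 1 = k -> M rH = k`! ->
  ok w lim size_prog M (fun M' => [/\ M' rQ = 2 ^ s, M' rR = R & M' rZ = Z]).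
Proof.
move=> Mn Mk MH.
have sR : s <= R.
  case: k s_n n_ge => [|k' _ _]; first by rewrite muln0 expn0; lia.
  by rewrite leq_pmulr.
apply: ok_seq; apply: ok_asn => /=; first by word n_ge nw.
apply: ok_seq; apply: ok_asn => /=; first by word n_ge nw.
(* The guard holds for every exponent below [s] by [s_min] and fails at [s], where the state then
   stays. *)
apply: ok_seq; apply: (ok_for (N := n) (I := fun i M' =>
  M' rQ = 2 ^ minn i s /\ M' rS = minn i s)) => //.
- by rewrite /upd /= min0n.
- move=> i M' i_n M'i fr [M'q M's].
  have M'0 : M' 0 = n by rewrite (fr.1 0).
  have M'1 : M' 1 = k by rewrite (fr.1 1).
  have M'H : M' rH = k`! by rewrite (fr.1 rH).
  set j := minn i s in M'q M's.
  have js : j <= s by apply: geq_minr.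
  have pw_cap l : l <= k -> (2 ^ j) ^ l <= n ^ 6.
    by move=> lk; rewrite -expnM pow2_cap // leq_mul.
  have q_cap := pow2_cap (leq_trans js sR).
  apply: ok_seq; apply: ok_asn => /=; first by word n_ge nw.
  apply: ok_seq; apply: (ok_for (N := k) (I := fun l M' => M' rP = (2 ^ j) ^ l)) => //.
    move=> l M1 lk M1l fr1 M1p; apply: ok_asn; rewrite /= ?M1p (fr1.1 rQ) // /upd /= M'q.
      have pl_cap := pw_cap l (ltnW lk).
      by do !split => //; word n_ge nw.
    by rewrite expnSr.
  move=> M1 fr1 _ M1p.
  have [M1q M1s M1H] : [/\ M1 rQ = 2 ^ j, M1 rS = j & M1 rH = k`!].
    by rewrite !(fr1.1 _ _ _) //= /upd /= M'q M's M'H.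
  have [M10 M11] : M1 0 = n /\ M1 1 = k.
    by rewrite !(fr1.1 _ _ _) //= /upd /= M'0 M'1.
  have n_cap : n <= n ^ 1 by rewrite expn1.
  have j_cap := leq_trans js s_cap.
  apply: ok_when => /=; rewrite ?M1q ?M1p ?M1H ?M10 ?M11.
  + by do !split => //; word n_ge nw.
  + move=> cond; have {cond} lt_js : j < s.
      rewrite ltn_neqAle js andbT; apply/eqP => j_s; apply: cond.
      by rewrite j_s -expnM; apply/eqP; rewrite addn_eq0 !subn_eq0 addn1 s_big s_n.
    apply: ok_seq; apply: ok_asn; rewrite /= ?M1q; first by do !split => //; word n_ge nw.
    apply: ok_asn; rewrite /upd /= ?M1s; first by do !split => //; word n_ge nw.
    have -> : minn i.+1 s = j.+1 by rewrite /j in lt_js *; lia.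
    by rewrite expnS mul2n addnn addn1.
  move=> cond; rewrite /upd /= M1q M1s.
  suff -> : minn i.+1 s = j by [].
  rewrite /j; case: (ltnP i s) => i_s; last by rewrite !(minn_idPr _) // leqW.
  have ji : j = i by rewrite /j (minn_idPl _) // ltnW.
  move/eqP: cond; rewrite addn_eq0 !subn_eq0 addn1 => /andP[c1 c2].
  have := s_min i_s; rewrite -ji leqNgt c1 /= expnM.
  by rewrite ltnNge c2.
move=> M1 fr _ [M1q M1s].
have sn : minn n s = s by apply/minn_idPr.
rewrite sn in M1q M1s.
have M11 : M1 1 = k by rewrite (fr.1 1).
apply: ok_seq; apply: ok_asn; rewrite /= ?M1s ?M11; first by do !split => //; word n_ge nw.
apply: ok_seq; apply: ok_asn => /=; first by word n_ge nw.
apply: (ok_for (N := R) (I := fun i M' => M' rZ = 2 ^ i)) => //.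
  move=> i M2 iR M2i fr2 M2z; have pi_cap := pow2_cap (ltnW iR).
  apply: ok_asn; rewrite /upd /= M2z; first by do !split => //; word n_ge nw.
  by rewrite expnS mul2n addnn.
move=> M2 fr2 _ M2z; split=> //.
  by rewrite (fr2.1 rQ).
by rewrite (fr2.1 rR).
Qed.

End Correctness.

(** * Correctness of the output matrix *)

Section OutputCorrectness.

Variables (n k s w : nat) (lim : nat -> nat).
Local Notation R := (s * k).
Local Notation Z := (2 ^ R).
Local Notation base := (2 + n * n).
Hypothesis n_ge : 60 <= n.
Hypothesis nw : n ^ 19 < 2 ^ w.
Hypotheses (limR : R <= lim rR).
Hypotheses (k_cap : k <= n ^ 1) (H_cap : k`! <= n ^ 1) (s_cap : s <= n ^ 1).
Hypotheses (Z_cap : Z <= n ^ 6) (R_cap : R <= n ^ 6).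
Hypothesis (s_big : k`! + k < 2 ^ s).

Local Notation q1 := (2 ^ s).-1.
Local Notation Lf := ((n * q1) * (n * q1) + (k`!.+1 - 'C(k, 2))).
Local Notation m := (Lf + Z * q1).

Hypotheses (k_gt0 : 0 < k) (m_cap : m <= n ^ 7) (limm : m <= lim rm).

Let w1 : 1 < 2 ^ w. Proof. by word n_ge nw. Qed.

Let s_le_R : s <= R. Proof. by rewrite leq_pmulr. Qed.

Let q_cap : 2 ^ s <= n ^ 6. Proof. exact: (pow2_cap Z_cap s_le_R). Qed.

Let q1_cap : q1 <= n ^ 6. Proof. exact: leq_trans (leq_pred _) q_cap. Qed.

Let q1_gt0 : 0 < q1.
Proof.
rewrite -subn1 subn_gt0; apply: leq_ltn_trans s_big.
by rewrite -[1]addn0 leq_add ?fact_gt0.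
Qed.

Lemma dims_ok M : regs [:: (0, n); (1, k); (rH, k`!); (rQ, 2 ^ s); (rZ, Z);
    (rBase, base)] M ->
  ok w lim dims_prog M (fun M' =>
    regs [:: (rQ1, q1); (rM, n * q1); (rMM, (n * q1) * (n * q1)); (rLf, Lf);
             (rm, m); (rOut, base + Z)] M').
Proof.
move=> rl; have n_cap : n <= n ^ 1 by rewrite expn1.
have binE : k * (k - 1) %/ 2 = 'C(k, 2) by rewrite subn1 bin2 divn2.
apply: (ok_set rl (v := q1)) => //=; reg rl; rewrite ?subn1 //.
move=> M1 _ {}rl; apply: (ok_set rl (v := n * q1)) => //=; reg rl => //.
  by do !split => //; word n_ge nw.
move=> M2 _ {}rl; apply: (ok_set rl (v := (n * q1) * (n * q1))) => //=; reg rl => //.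
  by do !split => //; word n_ge nw.
move=> M3 _ {}rl; apply: (ok_set rl (v := Lf)) => //=; reg rl; rewrite ?binE ?addn1 //.
  by do !split => //; word n_ge nw.
move=> M4 _ {}rl; apply: (ok_set rl (v := m)) => //=; reg rl => //.
  by do !split => //; word n_ge nw.
move=> M5 _ {}rl; apply: ok_asn => //=; reg rl.
  by do !split => //; word n_ge nw.
by apply: (regs_sub (regs_upd (x := rOut) (v := base + Z) rl)).
Qed.

Lemma check_ok r u b v M : r < heap_lo -> r \notin mods xor_prog ->
  M r = u -> u <= n ^ 7 -> b <= n ^ 7 -> v <= 1 ->
  regs [:: (rXa, u %/ q1); (rXb, b %/ q1); (rR, R); (rBase, base); (rQ1, q1);
           (rHi, b); (rVal, v)] M ->
  ok w lim (check_prog r) M (fun M' => M' rVal =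
    v * incident s (xorn R) (fun a => M (base + a)) (u %/ q1, u %% q1) (b %/ q1, b %% q1)).
Proof.
move=> r_lo r_n Mr u_cap b_cap v1 rl.
have n_cap : n <= n ^ 1 by rewrite expn1.
apply: ok_seq; apply: ok_conseq.
- by [].
- apply: (xor_ok n_ge nw limR Z_cap (d := 7)); reg rl => //; exact: cap_div.
move=> M' fr M'c.
have M'r : M' r = u by rewrite (fr.1 r).
have x_cap : xorn R (u %/ q1) (b %/ q1) <= n ^ 6.
  by apply: leq_trans (ltnW (xorn_lt _ _ _)) Z_cap.
have {}rl : regs [:: (rXc, xorn R (u %/ q1) (b %/ q1)); (rBase, base); (rQ1, q1);
    (rHi, b); (rVal, v)] M'.
  apply: regs_cons => //; apply: (regs_framed fr) => //.
  by apply: (regs_sub rl).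
have base_lo a : heap_lo <= base + a by apply: heap_lo_sqr.
have v_cap : v <= n ^ 1 by apply: (leq_trans v1); rewrite expn1; lia.
apply: ok_asn => /=; rewrite M'r; reg rl.
  by do !split => //; word n_ge nw.
rewrite /upd /= !eq_exprE (fr.2 isT) //; congr (_ * _).
rewrite /incident /= -mulnb; congr (_ * nat_of_bool _).
by case: (xorn _ _ _) => //= a; rewrite subSS sub0n.
Qed.


Lemma incident_ext xr L L' u b : L =1 L' -> incident s xr L u b = incident s xr L' u b.
Proof. by move=> LL; rewrite /incident LL. Qed.

Lemma entry_ok (Gn : nat -> nat -> bool) x y M : x < m -> y < m ->
  regs [:: (0, n); (rR, R); (rBase, base); (rQ1, q1); (rM, n * q1);
           (rMM, (n * q1) * (n * q1)); (rLf, Lf); (rRow, x); (rCol, y)] M ->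
  (forall i j, i < j < n -> M (2 + j * n + i) = Gn i j) ->
  ok w lim entry_prog M (fun M' => M' rVal =
    gadget_adj n k q1 k`! Gn (fun u b => incident s (xorn R)
       (fun a => M (base + a)) (u %/ q1, u %% q1) (b %/ q1, b %% q1)) x y).
Proof.
move=> xm ym rl MG.
have n_cap : n <= n ^ 1 by rewrite expn1.
have n_gt0 : 0 < n by apply: leq_trans n_ge.
have nq1_gt0 : 0 < n * q1 by rewrite muln_gt0 n_gt0.
have Lf_cap : Lf <= n ^ 7 by apply: leq_trans m_cap; rewrite leq_addr.
set L := fun a => M (base + a).
rewrite /gadget_adj; set lo := minn x y; set hi := maxn x y.
have lo_m : lo < m by rewrite gtn_min xm.
have hi_m : hi < m by rewrite gtn_max xm.
have lo_cap := cap_lt lo_m m_cap; have hi_cap := cap_lt hi_m m_cap.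
have x_cap := cap_lt xm m_cap; have y_cap := cap_lt ym m_cap.
apply: (ok_set rl (v := lo)) => //=; reg rl; first by rewrite /lo minnE.
move=> M1 fr1 {}rl; apply: (ok_set rl (v := hi)) => //=; reg rl.
- by do !split => //; word n_ge nw.
- by rewrite /hi maxnC maxnE.
move=> M2 fr2 {}rl; apply: (ok_set rl (v := 0)) => //=; first by word n_ge nw.
move=> M3 fr3 {}rl; apply: ok_when => /=; reg rl.
- by do !split => //; word n_ge nw.
- move=> /eqP; rewrite muln_eq0 negb_or !subn_eq0 -!ltnNge addn1 ltnS => /andP[loL Lhi].
  rewrite loL Lhi /=.
  apply: (ok_set rl (v := hi - Lf)) => //=; reg rl => //.
  move=> M4 fr4 {}rl; apply: (ok_set rl (v := 1)) => //=.
  move=> M5 fr5 {}rl; apply: ok_when => /=; reg rl => //; last first.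
    by move=> /eqP; rewrite subn_eq0 leqNgt => /negbTE->.
  move=> /eqP; rewrite subn_eq0 -ltnNge => loMM; rewrite loMM /= /pair_edge.
  set u := lo %/ (n * q1); set v := lo %% (n * q1).
  have u_cap : u <= n ^ 7 by apply: cap_div.
  have v_cap : v <= n ^ 7 by apply: cap_mod.
  have vM : v < n * q1 by rewrite ltn_mod.
  have uq_cap : u %/ q1 <= n ^ 7 by apply: cap_div.
  have vq_n : v %/ q1 < n by rewrite ltn_divLR.
  have vq_cap := cap_lt vq_n n_cap.
  have b_cap : hi - Lf <= n ^ 7 by apply: capB.
  apply: (ok_set rl (v := 0)) => //=; first by word n_ge nw.
  move=> M6 fr6 {}rl; apply: (ok_set rl (v := u)) => //=; reg rl => //.
  move=> M7 fr7 {}rl; apply: (ok_set rl (v := v)) => //=; reg rl => //.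
  move=> M8 fr8 {}rl; apply: (ok_set rl (v := u %/ q1)) => //=; reg rl => //.
  move=> M9 fr9 {}rl; apply: (ok_set rl (v := v %/ q1)) => //=; reg rl => //.
  move=> M10 fr10 {}rl; apply: ok_when => /=; reg rl => //; last first.
    by move=> /eqP; rewrite subn_eq0 leqNgt => /negbTE->.
  move=> /eqP; rewrite subn_eq0 -ltnNge => uv; rewrite uv /=.
  have M10h a : heap_lo <= a -> M10 a = M a.
    by move=> a_hi; rewrite (fr10.2 isT) ?(fr9.2 isT) ?(fr8.2 isT) ?(fr7.2 isT)
      ?(fr6.2 isT) ?(fr5.2 isT) ?(fr4.2 isT) ?(fr3.2 isT) ?(fr2.2 isT) ?(fr1.2 isT).
  (* The row [v %/ q1] exceeds [u %/ q1], so it is not row 0; and row 0, of length n >= 60, covers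
     all cells used by variables and temporaries. *)
  have G_hi : heap_lo <= 2 + v %/ q1 * n + u %/ q1.
    apply: leq_trans n_ge _; apply: leq_trans (leq_addr _ _).
    by apply: leq_trans (leq_addl _ _); rewrite leq_pmull // (leq_ltn_trans _ uv).
  have GE : M10 (2 + v %/ q1 * n + u %/ q1) = Gn (u %/ q1) (v %/ q1).
    by rewrite M10h // MG ?uv.
  apply: (ok_set rl (v := nat_of_bool (Gn (u %/ q1) (v %/ q1)))) => //=; reg rl => //.
    by do !split => //; word n_ge nw.
  move=> M11 fr11 {}rl; apply: (ok_set rl (v := (hi - Lf) %/ q1)) => //=; reg rl => //.
  move=> M12 fr12 {}rl; apply: (ok_set rl (v := u %/ q1)) => //=; reg rl; rewrite ?addn0 //.
  move=> M13 fr13 {}rl.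
  have base_hi a : heap_lo <= base + a.
    apply: leq_trans n_ge _; apply: leq_trans (leq_addr _ _).
    by apply: leq_trans (leq_addl _ _); rewrite leq_pmulr.
  have LE13 : (fun a => M13 (base + a)) =1 L.
    by move=> a; rewrite (fr13.2 isT) ?(fr12.2 isT) ?(fr11.2 isT) ?M10h.
  apply: ok_seq; apply: (ok_conseq (Q := fun M' => M' rVal = Gn (u %/ q1) (v %/ q1) *
    incident s (xorn R) L (u %/ q1, u %% q1) ((hi - Lf) %/ q1, (hi - Lf) %% q1))).
  - by [].
  - apply: (ok_conseq _ (check_ok (r := rU) (u := u) (b := hi - Lf)
      (v := Gn (u %/ q1) (v %/ q1)) _ _ _ _ _ _ _)) => //.
    + exact: (rl rU _ erefl).
    + by case: (Gn _ _).
    + by apply: (regs_sub rl).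
    by move=> M' _ ->; rewrite (@incident_ext _ _ _ _ _ LE13).
  move=> M14 fr14 M14v.
  have {}rl : regs [:: (rVal, Gn (u %/ q1) (v %/ q1) *
      incident s (xorn R) L (u %/ q1, u %% q1) ((hi - Lf) %/ q1, (hi - Lf) %% q1));
      (rXb, (hi - Lf) %/ q1); (rR, R); (rBase, base); (rQ1, q1); (rHi, hi - Lf);
      (rV2, v %/ q1); (rU2, v)] M14.
    apply: regs_cons => //; apply: (regs_framed fr14) => //.
    by apply: (regs_sub rl).
  apply: (ok_set rl (v := v %/ q1)) => //=; reg rl => //.
  move=> M15 fr15 {}rl.
  have LE15 : (fun a => M15 (base + a)) =1 L.
    by move=> a; rewrite (fr15.2 isT) ?(fr14.2 isT) // [LHS]LE13.
  apply: (ok_conseq _ (check_ok (r := rU2) (u := v) (b := hi - Lf)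
    (v := Gn (u %/ q1) (v %/ q1) * incident s (xorn R) L (u %/ q1, u %% q1)
      ((hi - Lf) %/ q1, (hi - Lf) %% q1)) _ _ _ _ _ _ _)) => //.
  - exact: (rl rU2 _ erefl).
  - by rewrite mulnb leq_b1.
  - by apply: (regs_sub rl).
  move=> M' _ ->; rewrite (@incident_ext _ _ _ _ _ LE15) !mulnb -andbA.
  by [].
move=> /eqP; rewrite muln_eq0 !subn_eq0 addn1 => /orP[].
  by rewrite leqNgt => /negbTE->.
by rewrite ltnNge => /negbTE->; rewrite andbF.
Qed.


Definition table_adj (Gn : nat -> nat -> bool) (M : memory) : nat -> nat -> bool :=
  gadget_adj n k q1 k`! Gn (fun u b => incident s (xorn R)
       (fun a => M (base + a)) (u %/ q1, u %% q1) (b %/ q1, b %% q1)).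

(** Sums of field elements have codes below [Z], so output written behind the table does not affect
    adjacency. *)
Lemma table_adj_ext Gn M M' : (forall a, a < Z -> M' (base + a) = M (base + a)) ->
  table_adj Gn M' =2 table_adj Gn M.
Proof.
move=> MM x y; rewrite /table_adj /gadget_adj /pair_edge /incident /=.
by rewrite !MM ?xorn_lt.
Qed.

Lemma output_ok (Gn : nat -> nat -> bool) M :
  regs [:: (0, n); (rR, R); (rBase, base); (rQ1, q1); (rM, n * q1);
           (rMM, (n * q1) * (n * q1)); (rLf, Lf); (rm, m); (rOut, base + Z)] M ->
  (forall i j, i < j < n -> M (2 + j * n + i) = Gn i j) ->
  ok w lim output_prog M (fun M' => [/\ M' 0 = m, M' 1 = base + Z &
    forall x y, x < m -> y < m ->
      M' (base + Z + (x * m + y)) = table_adj Gn M x y]).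
Proof.
move=> rl MG.
have n_cap : n <= n ^ 1 by rewrite expn1.
have base_hi a : heap_lo <= base + a.
  apply: leq_trans n_ge _; apply: leq_trans (leq_addr _ _).
  by apply: leq_trans (leq_addl _ _); rewrite leq_pmulr // (leq_trans _ n_ge).
(* This range holds the rest of the input matrix and the table; the output starts at [base + Z]. *)
pose same (M' : memory) := forall a, heap_lo <= a < base + Z -> M' a = M a.
have same_upd M' r v : same M' -> r < heap_lo -> same (upd M' r v).
  by move=> MM r_lo a a_lt; rewrite upd_hi ?MM //; case/andP: a_lt.
pose done_upto (x y : nat) (M' : memory) := forall x' y', y' < m ->
  x' < x \/ x' = x /\ y' < y ->
  M' (base + Z + (x' * m + y')) = table_adj Gn M x' y'.
have hi_out a : heap_lo <= base + Z + a by rewrite -addnA.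
apply: ok_seq; apply: (ok_for (N := m)
  (I := fun x M' => same M' /\ done_upto x 0 M')) => //.
- exact: (rl rm _ erefl).
- split; first by apply: same_upd => // a /andP[].
  by move=> x' y' _ [|[_]].
- move=> x M1 xm M1x fr1 [M1same M1done].
  have {}rl : regs [:: (rRow, x), (0, n) & [:: (rR, R); (rBase, base); (rQ1, q1); (rM, n * q1);
           (rMM, (n * q1) * (n * q1)); (rLf, Lf); (rm, m); (rOut, base + Z)]] M1.
    by apply: regs_cons => //; apply: (regs_framed fr1).
  apply: (ok_for (N := m) (I := fun y M' => same M' /\ done_upto x y M')) => //.
  + exact: (rl rm _ erefl).
  + split; first exact: same_upd.
    by move=> x' y' y'm x'y'; rewrite upd_hi ?M1done.
  + move=> y M2 ym M2y fr2 [M2same M2done].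
    have {}rl : regs [:: (rCol, y), (rRow, x), (0, n) & [:: (rR, R); (rBase, base); (rQ1, q1);
        (rM, n * q1); (rMM, (n * q1) * (n * q1)); (rLf, Lf); (rm, m); (rOut, base + Z)]] M2.
      by apply: regs_cons => //; apply: (regs_framed fr2).
    have rl' : regs [:: (0, n); (rR, R); (rBase, base); (rQ1, q1); (rM, n * q1);
           (rMM, (n * q1) * (n * q1)); (rLf, Lf); (rRow, x); (rCol, y)] M2.
      by apply: (regs_sub rl).
    apply: ok_seq; apply: (ok_conseq _ (entry_ok (Gn := Gn) xm ym rl' _)) => //.
      move=> i j /andP[ij jn]; rewrite M2same ?MG ?ij //; apply/andP; split.
        apply: leq_trans n_ge _; apply: leq_trans (leq_addr _ _).
        by apply: leq_trans (leq_addl _ _); rewrite leq_pmull // (leq_ltn_trans _ ij).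
      apply: leq_trans (leq_addr _ _); rewrite -addnA ltn_add2l.
      by apply: (@leq_trans (j.+1 * n)); [rewrite mulSn addnC ltn_add2r (ltn_trans ij)|rewrite leq_mul2r jn orbT].
    move=> M3 fr3 M3v.
    have {}M3v : M3 rVal = table_adj Gn M x y.
      rewrite M3v -/(table_adj Gn M2 x y); congr (nat_of_bool _).
      apply: table_adj_ext => a aZ; apply: M2same.
      by rewrite base_hi ltn_add2l.
    have M3h a : heap_lo <= a -> M3 a = M2 a by apply: fr3.2.
    have {}rl : regs [:: (rVal, nat_of_bool (table_adj Gn M x y)); (rCol, y); (rRow, x); (rm, m); (rOut, base + Z)] M3.
      by apply: regs_cons => //; apply: (regs_framed fr3) => //; apply: (regs_sub rl).
    have x_cap := cap_lt xm m_cap; have y_cap := cap_lt ym m_cap.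
    apply: ok_put => //=; reg rl => //.
    * by do !split => //; word n_ge nw.
    * by rewrite -addnA.
    rewrite -addnA; split.
      apply: same_upd => // a a_lt; rewrite updE ltn_eqF ?M3h ?M2same //; case/andP: a_lt => // a_hi a_lt.
      exact: leq_trans a_lt (leq_addr _ _).
    move=> x' y' y'm x'y'; rewrite upd_hi // updE eqn_add2l.
    have [E|lt_xy] : (x' = x /\ y' = y) \/ x' * m + y' < x * m + y.
      case: x'y' => [x'x|[-> ]].
        right; apply: (@leq_trans (x'.+1 * m)); first by rewrite mulSn addnC ltn_add2r.
        by apply: leq_trans (leq_addr _ _); rewrite leq_mul2r x'x orbT.
      rewrite ltnS leq_eqVlt => /orP[/eqP->|y'y]; first by left.
      by right; rewrite ltn_add2l.
    - by case: E => -> ->; rewrite eqxx.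
    rewrite ltn_eqF // M3h // M2done //.
    case: x'y' => [|[E]]; first by left.
    rewrite ltnS leq_eqVlt => /orP[/eqP y'y|]; last by right.
    by rewrite E y'y ltnn in lt_xy.
  move=> M2 fr2 _ [M2same M2done]; split; first exact: same_upd.
  move=> x' y' y'm x'y'; rewrite upd_hi // M2done //.
  case: x'y' => [|[//]]; rewrite ltnS leq_eqVlt => /orP[/eqP->|]; last by left.
  by right.
move=> M1 fr1 _ [_ M1done].
have {}rl : regs [:: (rm, m); (rOut, base + Z)] M1.
  by apply: (regs_framed fr1) => //; apply: (regs_sub rl).
apply: (ok_set rl (v := m)) => //=; reg rl; rewrite ?addn0 //.
move=> M2 fr2 {}rl; apply: ok_asn => //=; reg rl.
split=> [||x y xm ym].
- exact: (rl 0 _ erefl).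
- by rewrite updE eqxx.
by rewrite upd_hi // (fr2.2 isT) // M1done //; left.
Qed.

End OutputCorrectness.

Lemma nth_allpairs_row (S T U : Type) (f : S -> T -> U) (r : seq S) (t : seq T)
    x0 i0 j0 a b : a < size r -> b < size t ->
  nth x0 [seq f i j | i <- r, j <- t] (a * size t + b) = f (nth i0 r a) (nth j0 t b).
Proof.
elim: r a => [//|i r IH] [|a] a_lt b_lt /=; rewrite nth_cat size_map.
  by rewrite mul0n add0n b_lt (nth_map j0).
by rewrite mulSn -addnA ltnNge leq_addr addKn IH.
Qed.

Lemma nth_adj_seq n (G : sgraph 'I_n) (i j : 'I_n) :
  nth 0 (adj_seq G) (i * n + j) = G i j.
Proof.
rewrite /adj_seq -[X in i * X + j](size_enum_ord n).
rewrite (nth_allpairs_row _ _ i j) ?size_enum_ord //.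
by rewrite !nth_ord_enum.
Qed.

Lemma size_adj_seq n (G : sgraph 'I_n) : size (adj_seq G) = n * n.
Proof. by rewrite size_allpairs size_enum_ord. Qed.

Lemma adj_seq_le1 n (G : sgraph 'I_n) a : nth 0 (adj_seq G) a <= 1.
Proof.
case: (ltnP a (size (adj_seq G))) => aG; last by rewrite nth_default.
by have /allpairsP[[i j] [_ _ ->]] := mem_nth 0 aG; case: (G _ _).
Qed.

(** Transposed, to match the access of the program, which for i < j reads row [j]. *)
Definition matrix_entry n (G : sgraph 'I_n) (i j : nat) : bool :=
  nth 0 (adj_seq G) (j * n + i) == 1.

Lemma matrix_entryE n (G : sgraph 'I_n) (i j : 'I_n) : matrix_entry G i j = G i j.
Proof. by rewrite /matrix_entry nth_adj_seq edge_sym; case: (G i j). Qed.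

(** * The computed table realizes the norm graph *)

Section TableIncidence.

Variables (n k s f : nat) (M : memory).
Local Notation R := (s * k).
Local Notation Z := (2 ^ (s * k)).
Local Notation q1 := (2 ^ s).-1.
Hypotheses (k_gt0 : 0 < k) (s_gt1 : 1 < s) (s_big : k`! + k < 2 ^ s) (n_Z : n <= Z).
Hypotheses (f_lt : f < Z) (taps : primitive_taps R f) (tab : log_table n k s f M).

Let inc u b := incident s (xorn R) (fun a => M (2 + n * n + a))
  (u %/ q1, u %% q1) (b %/ q1, b %% q1).

Let s_gt0 : 0 < s. Proof. exact: ltnW. Qed.

Let R_gt1 : 1 < R. Proof. by apply: leq_trans s_gt1 _; rewrite leq_pmulr. Qed.

Let q1_gt0 : 0 < q1.
Proof. by rewrite -subn1 subn_gt0 (ltn_exp2l 0). Qed.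

Let divmod_inj : injective (fun u => (u %/ q1, u %% q1)).
Proof. by move=> u v [E1 E2]; rewrite (divn_eq u q1) (divn_eq v q1) E1 E2. Qed.

Let bounded u N : u < N * q1 -> (u %/ q1 < N) && (u %% q1 < q1).
Proof. by move=> uN; rewrite ltn_divLR // uN ltn_mod. Qed.

Lemma table_few (us bs : seq nat) :
  uniq us -> size us = k.+1 -> {in us, forall u, u < n * q1} ->
  uniq bs -> {in bs, forall b, b < Z * q1} ->
  {in us & bs, forall u b, inc u b} -> size bs <= k`!.
Proof.
move=> uus sus usn ubs bsZ incP.
have [F [phi [g [charF phi_inj phiD [phi0 gZ] [phi_it phi_sur]]]]] :=
  primitive_taps_model R_gt1 f_lt taps.
have phiD' a b : a < Z -> b < Z -> phi (xorn R a b) = GRing.add (phi a) (phi b).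
  by move=> _ _; apply: phiD.
have xr_lt a b : a < Z -> b < Z -> xorn R a b < Z by move=> _ _; apply: xorn_lt.
(* The table is specified on iterates of the register, and these are all the nonzero words. *)
have phiL x : 0 < x < Z -> phi x = GRing.exp g (M (2 + n * n + x)).
  by move=> /phi_sur[i iZ ->]; rewrite tab.
rewrite -(size_map (fun u => (u %/ q1, u %% q1)) bs).
apply: (incident_few s_gt0 k_gt0 charF phi_inj phi0 phiD' xr_lt gZ phiL
  (us := [seq (u %/ q1, u %% q1) | u <- us])).
- by rewrite map_inj_uniq.
- by rewrite size_map.
- by rewrite map_inj_uniq.
- move=> _ /mapP[u uu ->]; apply: bounded; apply: leq_trans (usn u uu) _.
  by rewrite leq_mul2r n_Z orbT.
- by move=> _ /mapP[b bb ->]; apply: bounded; apply: bsZ.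
by move=> _ _ /mapP[u uu ->] /mapP[b bb ->]; apply: incP.
Qed.

Lemma table_many (is_ : seq nat) :
  uniq is_ -> size is_ = k -> {in is_, forall i, i < n} ->
  exists (al : nat -> nat) (bs : seq nat),
  [/\ forall i, al i < q1, uniq bs, size bs = (k`!).+1,
      {in bs, forall b, b < Z * q1} &
      {in is_ & bs, forall i b, inc (i * q1 + al i) b}].
Proof.
move=> uis sis isn.
have [F [phi [g [charF phi_inj phiD [phi0 gZ] [phi_it phi_sur]]]]] :=
  primitive_taps_model R_gt1 f_lt taps.
have phiD' a b : a < Z -> b < Z -> phi (xorn R a b) = GRing.add (phi a) (phi b).
  by move=> _ _; apply: phiD.
have isZ : {in is_, forall i, i < Z} by move=> i /isn i_n; apply: leq_trans n_Z.
have kq : k`! + k <= q1 by rewrite -ltnS prednK ?expn_gt0.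
have [al [bs [al_lt ubs sbs bsZ incP]]] := incident_many (fun a => M (2 + n * n + a))
  s_gt0 k_gt0 charF phi_inj phi0 phiD' uis sis isZ kq.
have decode b : b.2 < q1 -> ((b.1 * q1 + b.2) %/ q1, (b.1 * q1 + b.2) %% q1) = b.
  case: b => i be /= be_lt.
  by rewrite divnMDl // divn_small // addn0 modnMDl modn_small.
exists al, [seq b.1 * q1 + b.2 | b <- bs]; split=> //.
- rewrite map_inj_in_uniq // => b b' /bsZ/andP[_ b2] /bsZ/andP[_ b2'] E.
  by rewrite -(decode b) // -(decode b') // E.
- by rewrite size_map.
- move=> _ /mapP[b /bsZ/andP[b1 b2] ->].
  apply: (@leq_trans (b.1.+1 * q1)); last by rewrite leq_mul2r b1 orbT.
  by rewrite mulSn addnC ltn_add2r.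
move=> i _ ii /mapP[b bb ->]; have /andP[b1 b2] := bsZ b bb.
have := decode (i, al i) (al_lt i); rewrite /= => ui.
by rewrite /inc decode // ui; apply: incP.
Qed.

End TableIncidence.

(** * The whole program *)

Section MainProgram.

Variables (n k s w : nat) (lim : nat -> nat) (G : sgraph 'I_n).
Local Notation R := (s * k).
Local Notation Z := (2 ^ (s * k)).
Local Notation q1 := (2 ^ s).-1.
Local Notation base := (2 + n * n).
Local Notation Lf := ((n * q1) * (n * q1) + (k`!.+1 - 'C(k, 2))).
Local Notation m := (Lf + Z * q1).
Hypothesis n_ge : 60 <= n.
Hypothesis nw : n ^ 19 < 2 ^ w.
Hypotheses (lim0 : n <= lim 0) (lim1 : k <= lim 1) (limR : R <= lim rR).
Hypotheses (limZm : Z.-1 <= lim rZm) (limZ : Z <= lim rZ) (limm : m <= lim rm).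
Hypotheses (k_cap : k <= n ^ 1) (H_cap : k`! <= n ^ 1) (s_cap : s <= n ^ 1).
Hypotheses (Z_cap : Z <= n ^ 6) (R_cap : R <= n ^ 6) (m_cap : m <= n ^ 7).
Hypotheses (k_gt0 : 0 < k) (s_big : k`! + k < 2 ^ s) (s_n : n <= Z) (s_le_n : s <= n).
Hypothesis s_min : forall j, j < s -> (2 ^ j <= k`! + k) || (2 ^ (j * k) < n).

Lemma taps_size_gt1 : 1 < s.
Proof.
have : 2 ^ 1 < 2 ^ s.
  by apply: leq_ltn_trans s_big; rewrite expn1 -[2]/(1 + 1) leq_add // fact_gt0.
by rewrite ltn_exp2l.
Qed.

Lemma main_ok : ok w lim main_prog (input_memory G k) (fun M' =>
  exists f Mt, [/\ f < Z, primitive_taps R f, log_table n k s f Mt &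
    [/\ M' 0 = m, M' 1 = base + Z & forall x y, x < m -> y < m ->
      M' (base + Z + (x * m + y)) = table_adj n k s (matrix_entry G) Mt x y]]).
Proof.
have R_gt1 : 1 < R by apply: leq_trans taps_size_gt1 _; rewrite leq_pmulr.
set M0 := input_memory G k.
have rl0 : regs [:: (0, n); (1, k)] M0 by do 2 (apply: regs_cons => //).
have M0G i j : i < j < n -> M0 (2 + j * n + i) = matrix_entry G i j.
  move=> _; have := adj_seq_le1 G (j * n + i).
  by rewrite /M0 /input_memory -addnA /= /matrix_entry; case: (nth _ _ _) => [|[]].
apply: ok_seq; apply: (ok_conseq _ (fact_ok n_ge nw lim1 k_cap H_cap _)) => //.
move=> M1 fr1 M1H.
have rl1 : regs [:: (rH, k`!); (0, n); (1, k)] M1.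
  by apply: regs_cons => //; apply: (regs_framed fr1).
have ok_size : ok w lim size_prog M1 (fun M' => [/\ M' rQ = 2 ^ s, M' rR = R & M' rZ = Z]).
  by apply: (size_ok (n := n)) => //; apply: rl1.
apply: ok_seq; apply: (ok_conseq _ ok_size) => //.
move=> M2 fr2 [M2q M2R M2Z].
have rl2 : regs [:: (rQ, 2 ^ s); (rR, R); (rZ, Z); (rH, k`!); (0, n); (1, k)] M2.
  by do 3 (apply: regs_cons => //); apply: (regs_framed fr2).
have ok_search : ok w lim search_prog M2 (fun M' => [/\ M' rBase = base,
    exists2 f, f < Z & primitive_taps R f /\ log_table n k s f M' &
    forall a, heap_lo <= a < base -> M' a = M2 a]).
  by apply: search_ok => //; apply: rl2.
apply: ok_seq; apply: (ok_conseq _ ok_search) => //.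
move=> M3 fr3 [M3b [f f_lt [taps tab]] M3h].
have rl3 : regs [:: (rBase, base); (rQ, 2 ^ s); (rR, R); (rZ, Z); (rH, k`!); (0, n); (1, k)] M3.
  by apply: regs_cons => //; apply: (regs_framed fr3).
have rl3' : regs [:: (0, n); (1, k); (rH, k`!); (rQ, 2 ^ s); (rZ, Z); (rBase, base)] M3.
  by apply: (regs_sub rl3).
have ok_dims : ok w lim dims_prog M3 (fun M' =>
    regs [:: (rQ1, q1); (rM, n * q1); (rMM, (n * q1) * (n * q1)); (rLf, Lf);
             (rm, m); (rOut, base + Z)] M').
  exact: dims_ok.
apply: ok_seq; apply: (ok_conseq _ ok_dims) => //.
move=> M4 fr4 rl4.
have rl5 : regs [:: (0, n); (rR, R); (rBase, base); (rQ1, q1); (rM, n * q1);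
           (rMM, (n * q1) * (n * q1)); (rLf, Lf); (rm, m); (rOut, base + Z)] M4.
  have rl5 : regs [:: (0, n); (rR, R); (rBase, base)] M4.
    by apply: (regs_framed fr4) => //; apply: (regs_sub rl3).
  do 3 (apply: regs_cons; first by apply: rl5).
  exact: rl4.
have M4G i j : i < j < n -> M4 (2 + j * n + i) = matrix_entry G i j.
  move=> /[dup] ijn /andP[ij jn].
  have a_hi : heap_lo <= 2 + j * n + i.
    apply: leq_trans n_ge _; apply: leq_trans (leq_addr _ _).
    by apply: leq_trans (leq_addl _ _); rewrite leq_pmull // (leq_ltn_trans _ ij).
  have a_lo : 2 + j * n + i < base.
    rewrite -addnA ltn_add2l; apply: (@leq_trans (j.+1 * n)).
      by rewrite mulSn addnC ltn_add2r (ltn_trans ij).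
    by rewrite leq_mul2r jn orbT.
  by rewrite (fr4.2 isT) // M3h ?a_hi // (fr2.2 isT) // (fr1.2 isT) // M0G.
have ok_output : ok w lim output_prog M4 (fun M' => [/\ M' 0 = m, M' 1 = base + Z &
    forall x y, x < m -> y < m ->
      M' (base + Z + (x * m + y)) = table_adj n k s (matrix_entry G) M4 x y]).
  exact: output_ok.
apply: (ok_conseq _ ok_output) => //.
move=> M5 _ H5; exists f, M4; split=> // i iZ.
rewrite (fr4.2 isT) ?tab // (leq_trans n_ge) //.
apply: leq_trans (leq_addr _ _); apply: leq_trans (leq_addl _ _).
by rewrite leq_pmulr // (leq_trans _ n_ge).
Qed.

End MainProgram.

(** * Running time and choice of the field size *)

Lemma ctime_main lim : ctime lim main_prog <=
  500 * (1 + lim 1 + lim 0 * (1 + lim 1) + lim rR +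
         lim rZ * (1 + lim rZm * (1 + lim rR)) +
         lim rm * (1 + lim rm * (1 + lim rR))).
Proof. cbv -[addn muln leq]; lia. Qed.

(** With N = n^6, the search contributes N^3 and the output 9 N^3; the factor 40 absorbs everything
    of lower order. *)
Lemma time_bound n k R Z Zm m : 60 <= n -> k <= n -> R <= n ^ 6 -> Zm <= n ^ 6 ->
  Z <= n ^ 6 -> m <= 3 * n ^ 6 ->
  500 * (1 + k + n * (1 + k) + R + Z * (1 + Zm * (1 + R)) + m * (1 + m * (1 + R)))
    <= 500 * 40 * n ^ 18.
Proof.
move=> n_ge kn; have -> : n ^ 18 = n ^ 6 * (n ^ 6 * n ^ 6) by rewrite -!expnD.
have N_ge : n * n <= n ^ 6 by rewrite -[n * n]/(n ^ 2) leq_pexp2l //; lia.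
move: (n ^ 6) N_ge => N N_ge RN ZmN ZN mN; rewrite -mulnA leq_mul2l /=.
have N1 : 60 <= N by nia.
have H1 : Z * (1 + Zm * (1 + R)) <= N * (1 + N * (1 + N)).
  by do ?[apply: leq_mul => //|apply: leq_add => //].
have H2 : m * (1 + m * (1 + R)) <= (3 * N) * (1 + (3 * N) * (1 + N)).
  by do ?[apply: leq_mul => //|apply: leq_add => //].
have H3 : 1 + k + n * (1 + k) <= 4 * N by nia.
have NN : 60 * N <= N * N by rewrite leq_mul2r N1 orbT.
have NNN : 60 * (N * N) <= N * (N * N) by rewrite leq_mul2r N1 orbT.
nia.
Qed.

Lemma exp4_le_fact k : 4 ^ k <= (k + 6)`!.
Proof.
elim: k => [|k IH]; first by rewrite expn0 fact_gt0.
by rewrite expnS addSn factS leq_mul // ltnS; lia.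
Qed.

Lemma fact_add_le k : 0 < k -> 2 * (k`! + k) <= (k + 6)`!.
Proof.
move=> k_gt0.
apply: (@leq_trans (k.+1)`!.*2.*2).
  by rewrite mul2n leq_double factS; have := fact_gt0 k; have := fact_geq k; nia.
have -> : k + 6 = (k + 5).+1 by rewrite addnS.
have le5 : (k.+1)`! <= (k + 5)`! by apply: leq_fact; lia.
by rewrite [(k + 5).+1`!]factS -!muln2 -mulnA mulnC leq_mul //; lia.
Qed.

Section ParameterChoice.

Variables (n k : nat).
Hypotheses (k_gt0 : 0 < k) (big : (k + 6)`! ^ (k + 6) < n ^ 6).

(** Keep six of the [k + 6] factors and compare sixth powers. *)
Lemma fact_lt_n : (k + 6)`! < n.
Proof.
rewrite -(@ltn_exp2r _ _ 6) //; apply: leq_ltn_trans big.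
by rewrite leq_pexp2l ?fact_gt0 // leq_addl.
Qed.

Lemma n_ge60 : 60 <= n.
Proof.
apply: leq_trans (ltnW fact_lt_n); apply: (@leq_trans (6`!)) => //.
by apply: leq_fact; apply: leq_addl.
Qed.

(** Take [s] minimal, so that q/2 violates one of the two conditions. If q/2 <= k! + k, then q <=
    (k+6)! and q^(k+1) <= (k+6)!^(k+6) < n^6. If (q/2)^k < n, then q <= q^k <= 2^k n, so q^(k+1) <=
    4^k n^2 <= n^3 because 4^k <= (k+6)! < n. *)
Lemma parameters_exist : exists s,
  [/\ k`! + k < 2 ^ s, n <= 2 ^ (s * k), s <= n,
      forall j, j < s -> (2 ^ j <= k`! + k) || (2 ^ (j * k) < n) &
      2 ^ (s * k) * 2 ^ s <= n ^ 6 /\ 2 ^ s <= 2 * n].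
Proof.
pose P j := (k`! + k < 2 ^ j) && (n <= 2 ^ (j * k)).
have n_2n : n <= 2 ^ n by apply: ltnW; apply: ltn_expl.
have Pn : P n.
  have := fact_lt_n; have := fact_add_le k_gt0; rewrite /P => f1 f2.
  apply/andP; split; first by apply: leq_trans n_2n; lia.
  by apply: leq_trans n_2n _; rewrite leq_exp2l // leq_pmulr.
case: (ex_minnP (ex_intro _ n Pn)) => s /andP[s_big s_n] s_min.
exists s; split=> //; first exact: s_min.
  move=> j js; have : ~~ P j by apply/negP => /s_min; rewrite leqNgt js.
  by rewrite negb_and -leqNgt -ltnNge.
have s_gt0 : 0 < s by case: s s_big {s_n s_min} => //; rewrite expn0; have := fact_gt0 k; lia.
have lt1 : s.-1 < s by rewrite prednK.
have sE : 2 ^ s = 2 * 2 ^ s.-1 by rewrite -expnS prednK.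
have : ~~ P s.-1 by apply/negP => /s_min; rewrite leqNgt lt1.
rewrite negb_and -leqNgt -ltnNge => /orP[le_f|lt_n].
  have q_le : 2 ^ s <= (k + 6)`! by rewrite sE; apply: leq_trans (fact_add_le k_gt0); rewrite leq_mul2l.
  split; last by apply: leq_trans q_le _; have := fact_lt_n; lia.
  rewrite -expnD addnC -mulnS expnM; apply: leq_trans (ltnW big).
  apply: (@leq_trans ((k + 6)`! ^ k.+1)); first by rewrite leq_exp2r.
  by rewrite leq_pexp2l ?fact_gt0 //; lia.
have ZE : 2 ^ (s * k) = 2 ^ k * 2 ^ (s.-1 * k).
  by rewrite -expnD; congr expn; rewrite -[in LHS](prednK s_gt0) mulSn.
have q_n : 2 ^ s <= 2 * n.
  rewrite sE leq_mul2l /=; apply: leq_trans (ltnW lt_n).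
  by rewrite leq_exp2l // leq_pmulr.
have Z_n : 2 ^ (s * k) <= 2 ^ k * n by rewrite ZE leq_mul2l ltnW ?orbT.
split=> //.
have k_n : 4 ^ k <= n by apply: leq_trans (exp4_le_fact k) (ltnW fact_lt_n).
have q_Z : 2 ^ s <= 2 ^ (s * k) by rewrite leq_exp2l // leq_pmulr.
apply: (leq_trans (leq_mul Z_n (leq_trans q_Z Z_n))).
rewrite mulnACA -expnMn -[2 * 2]/4.
apply: (@leq_trans (n * (n * n))); first by rewrite leq_mul2r k_n orbT.
rewrite -[n * n]/(n ^ 2) -expnS leq_pexp2l //.
by apply: leq_trans n_ge60.
Qed.

End ParameterChoice.

(** * Assembling the reduction *)

Lemma nth_input_lt n (G : sgraph 'I_n) k w a : n < 2 ^ w -> k < 2 ^ w -> 1 < 2 ^ w ->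
  input_memory G k a < 2 ^ w.
Proof.
move=> nw kw w1; case: a => [|[|a]] //=.
exact: leq_ltn_trans (adj_seq_le1 G a) w1.
Qed.

Lemma word_size_large n : n ^ 19 < 2 ^ word_size 20 n.
Proof.
have n_lt : n < 2 ^ (trunc_log 2 n).+1 by apply: trunc_log_ltn.
rewrite /word_size mulnC expnM.
apply: (@leq_trans ((2 ^ (trunc_log 2 n).+1) ^ 19)); first by rewrite ltn_exp2r.
by rewrite leq_pexp2l // expn_gt0.
Qed.

Lemma mkseq_adj_seq m (H : sgraph 'I_m) (F : nat -> nat) :
  (forall x y : 'I_m, F (x * m + y) = H x y) -> mkseq F (m * m) = adj_seq H.
Proof.
move=> FH; apply: (@eq_from_nth _ 0) => [|a].
  by rewrite size_mkseq size_adj_seq.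
rewrite size_mkseq => a_lt; rewrite nth_mkseq //.
have m_gt0 : 0 < m by case: m a_lt {H FH} => [|//]; rewrite mul0n.
have x_lt : a %/ m < m by rewrite ltn_divLR.
have y_lt : a %% m < m by rewrite ltn_mod.
rewrite [in LHS](divn_eq a m) [in RHS](divn_eq a m).
by rewrite (FH (Ordinal x_lt) (Ordinal y_lt)) -nth_adj_seq.
Qed.

Definition machine : program := ccode main_prog 0.

Theorem clique_to_biclique n (G : sgraph 'I_n) k : 0 < k ->
  (k + 6)`! ^ (k + 6) < n ^ 6 ->
  exists (m : nat) (H : sgraph 'I_m),
    computes_within machine 20 G k H (500 * 40 * n ^ 18) /\
    (has_subgraph_isomorphic_to H (biclique (k`!).+1 (k`!).+1) <->
     has_subgraph_isomorphic_to G (clique k)).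
Proof.
move=> k_gt0 big; have n_ge := n_ge60 big.
have [fact_k1 k_n] : k`!.+1 <= n /\ k <= n.
  have := fact_lt_n big; have := fact_add_le k_gt0.
  by lia.
have fact_k := ltnW fact_k1.
have [s [s_big s_n s_le_n s_min [Zq_n q_n]]] := parameters_exist k_gt0 big.
set Z := 2 ^ (s * k) in s_n Zq_n *; set q1 := (2 ^ s).-1.
set w := word_size 20 n; have nw : n ^ 19 < 2 ^ w := word_size_large n.
have n_gt0 : 0 < n by apply: leq_trans n_ge.
have n6 i : i <= 6 -> n ^ i <= n ^ 6 by move=> i6; rewrite leq_pexp2l.
have q_gt0 : 0 < 2 ^ s by rewrite expn_gt0.
have q1_q : q1 <= 2 ^ s by rewrite leq_pred.
have Z_n6 : Z <= n ^ 6 by apply: leq_trans Zq_n; rewrite leq_pmulr.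
have R_Z : s * k < Z by apply: ltn_expl.
have R_n6 := leq_trans (ltnW R_Z) Z_n6.
(* Ensures that the subtraction defining the number of padding vertices is not truncated; it holds
   since k (k-1) <= k (k-1)!. *)
have bin_le : 'C(k, 2) <= (k`!).+1.
  rewrite bin2 -divn2; apply: leq_trans (leq_div _ _) _; apply: leqW.
  case: k k_gt0 {big s_big s_n Zq_n s_min fact_k1 fact_k k_n Z_n6 R_Z R_n6 Z} => //= j _.
  by rewrite factS leq_mul2l; apply/orP; right; apply: fact_geq.
set Lf := (n * q1) * (n * q1) + (k`!.+1 - 'C(k, 2)).
set m := Lf + Z * q1.
(* One n^6 for each summand of [m]; the pairs number at most (2 n^2)^2 because q <= 2n. *)
have m_n6 : m <= 3 * n ^ 6.
  have MM : (n * q1) * (n * q1) <= n ^ 6.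
    apply: (@leq_trans ((n * (2 * n)) * (n * (2 * n)))).
      by rewrite leq_mul // leq_mul2l (leq_trans q1_q q_n) orbT.
    have -> : n ^ 6 = (n * n) * ((n * n) * (n * n)) by rewrite !expnS expn0; lia.
    have n2_ge : 4 <= n * n by apply: (@leq_mul 2 2); apply: leq_trans n_ge.
    rewrite (_ : _ * _ = 4 * ((n * n) * (n * n))); last by lia.
    by rewrite leq_mul2r n2_ge orbT.
  have pad : k`!.+1 - 'C(k, 2) <= n ^ 6.
    apply: leq_trans (leq_subr _ _) _; apply: leq_trans (n6 1 isT).
    by rewrite expn1.
  have NB : Z * q1 <= n ^ 6 by apply: leq_trans Zq_n; rewrite leq_mul2l q1_q orbT.
  by rewrite /m /Lf; lia.
have m_n7 : m <= n ^ 7.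
  by apply: leq_trans m_n6 _; rewrite [n ^ 7]expnS leq_mul2r; apply/orP; right; lia.
(* Only these six variables serve as loop bounds, so 0 is a harmless default. *)
pose lim := fun r => odflt 0 (look [:: (0, n); (1, k); (rR, s * k); (rZ, Z);
  (rZm, Z.-1); (rm, m)] r).
have [t [M' [run [f [Mt [f_lt taps tab [M'0 M'1 M'adj]]]]]]] :
    ok w lim main_prog (input_memory G k) (fun M' =>
  exists f Mt, [/\ f < Z, primitive_taps (s * k) f, log_table n k s f Mt &
    [/\ M' 0 = m, M' 1 = 2 + n * n + Z & forall x y, x < m -> y < m ->
      M' (2 + n * n + Z + (x * m + y)) = table_adj n k s (matrix_entry G) Mt x y]]).
  by apply: main_ok; rewrite ?expn1.
pose inc u b := incident s (xorn (s * k)) (fun a => Mt (2 + n * n + a))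
  (u %/ q1, u %% q1) (b %/ q1, b %% q1).
pose H : sgraph 'I_m := gadget n k q1 (Z * q1) k`! (matrix_entry G) inc.
exists m, H.
have s_gt1 : 1 < s by apply: taps_size_gt1 s_big.
have q1_gt0 : 0 < q1 by rewrite /q1 -subn1 subn_gt0 (ltn_exp2l 0) // ltnW.
have few := table_few k_gt0 s_gt1 s_n f_lt taps tab.
have many := table_many Mt k_gt0 s_gt1 s_big s_n f_lt taps.
split; last first.
  split; first exact: (gadget_sound n_gt0 k_gt0 q1_gt0 bin_le (matrix_entryE G) few).
  exact: (gadget_complete n_gt0 k_gt0 q1_gt0 bin_le (matrix_entryE G) many).
have n_w : n < 2 ^ w by apply: leq_ltn_trans nw; rewrite -[n in n <= _]expn1 leq_pexp2l.
have k_w : k < 2 ^ w by apply: leq_ltn_trans n_w.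
have agr : agrees w (input_memory G k) (input_memory G k).
  split=> // [a|].
    by apply: nth_input_lt => //; apply: leq_ltn_trans k_w.
  have := nth_adj_seq G (Ordinal n_gt0) (Ordinal n_gt0).
  by rewrite edge_irr /input_memory.
have wf : cwf main_prog by [].
have loc : located machine 0 (ccode main_prog 0) by [].
have [Ml [it [mM _ _]]] := ccode_correct run wf agr loc.
exists t.
  apply: leq_trans (bigstep_ctime run wf) _; apply: leq_trans (ctime_main lim) _.
  by apply: time_bound => //; apply: leq_trans (leq_pred _) Z_n6.
rewrite it; split; first by rewrite /halted /machine size_ccode.
have Ml0 : Ml 0 = m by rewrite mM.
have Ml1 : Ml 1 = 2 + n * n + Z by rewrite mM.
have a_hi a : heap_lo <= 2 + n * n + Z + a.
  apply: leq_trans n_ge _; rewrite -!addnA; apply: leq_trans (leq_addl _ _).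
  by apply: leq_trans (leq_addr _ _); rewrite leq_pmulr.
split=> //=.
  rewrite Ml1; apply: ltnW; have n_cap : n <= n ^ 1 by rewrite expn1.
  by word n_ge nw.
apply: mkseq_adj_seq => x y.
by rewrite Ml1 mM ?M'adj // negb_and -leqNgt a_hi orbT.
Qed.

(** * Asymptotics *)

From mathcomp Require Import all_classical all_reals all_analysis.
Import Order.TTheory GRing.Theory Num.Theory.
Import numFieldNormedType.Exports.
Local Open Scope classical_set_scope.
Local Open Scope ring_scope.

(** Raising to the power [d] clears the root and turns the real hypothesis into one on natural
    numbers. *)
Lemma powR_ratio_gt (R : realType) (a n c d : nat) : (0 < d)%N ->
  a%:R < (n%:R : R) `^ (c%:R / d%:R) -> (a ^ d < n ^ c)%N.
Proof.
move=> d_gt0 a_lt; rewrite -(ltr_nat R) !natrX.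
have -> : (n%:R : R) ^+ c = (n%:R `^ (c%:R / d%:R)) ^+ d.
  rewrite -[RHS]powR_mulrn ?powR_ge0 // -powRrM divfK ?powR_mulrn //.
  by rewrite pnatr_eq0 -lt0n.
by rewrite ltrXn2r // -lt0n.
Qed.

Lemma eqO_scaled_power (R : realType) (c d : nat) :
  (fun n : nat => (c * n ^ d)%:R : R) =O_\oo (fun n : nat => n%:R ^+ d : R).
Proof.
apply/eqO_exP; exists (c.+1)%:R => //; near=> n.
by rewrite natrM natrX normrM normr_nat ler_wpM2r // ler_nat.
Unshelve. all: by end_near. Qed.

Lemma eqTheta_succ_fact (R : realType) :
  (fun k : nat => (k`!.+1)%:R : R) =Theta_\oo (fun k : nat => (k`!)%:R : R).
Proof.
rewrite eqThetaE bigThetaE; split.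
  apply/eqO_exP; exists 2 => //; near=> k.
  by rewrite !normr_nat -natrM ler_nat mul2n -addnn -add1n leq_add2r fact_gt0.
rewrite eqOmegaO; apply/eqO_exP; exists 1 => //; near=> k.
by rewrite mul1r !normr_nat ler_nat.
Unshelve. all: by end_near. Qed.

Theorem theorem1 (R : realType) :
  exists (P : program) (c : nat) (time : nat -> nat) (k' : nat -> nat),
    [/\ (fun n : nat => (time n)%:R : R) =O_\oo (fun n : nat => n%:R ^+ 18 : R),
        (fun k : nat => (k' k)%:R : R) =Theta_\oo (fun k : nat => (k`!)%:R : R)
      & forall (n : nat) (G : sgraph 'I_n) (k : nat), (0 < k)%N ->
          ((k + 6)`!)%:R < (n%:R : R) `^ (6%:R / (k + 6)%:R) ->
          exists (m : nat) (G' : sgraph 'I_m),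
            computes_within P c G k G' (time n) /\
            (has_subgraph_isomorphic_to G' (biclique (k' k) (k' k)) <->
             has_subgraph_isomorphic_to G (clique k))].
Proof.
exists machine, 20%N, (fun n => 500 * 40 * n ^ 18)%N, (fun k => (k`!).+1).
split=> [||n G k k_gt0 big].
- exact: eqO_scaled_power.
- exact: eqTheta_succ_fact.
apply: clique_to_biclique => //.
by apply: powR_ratio_gt big; rewrite addnS.
Qed.
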